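(* Fix a partition $\rho$ and a real number $0<\epsilon<\frac12$, and for each $j\ge1$, let $m_j(\rho)$ denote the number of parts of size $j$ in $\rho$. Let $n\ge\max(|\rho|,1)$ and $\epsilon n\le k\le(1-\epsilon)n$ be integers, and set $t:=\frac kn\in[\epsilon,1-\epsilon]$. Suppose a permutation $\pi\in S_n$ and a subset $R\subseteq\{1,\dots,n\}$ of size $|\rho|$ are selected uniformly at random. Then $$\frac{\mathbb{E}[N_{\mathrm{id}_k}(\pi)\mid\pi(R)=R\text{ and }\pi|_R\text{ has cycle type }\rho]}{\mathbb{E}[N_{\mathrm{id}_k}(\pi)]}=\left(\frac{m_1(\rho)}2\right)!\cdot\left(\frac{nt^3}{1-t}\right)^{\frac{m_1(\rho)}2}\left(\prod_{j\ge2}(1-t^j)^{m_j(\rho)}\right)+O\left(n^{\frac{m_1(\rho)-1}2}\right),$$ where the implicit constant of the big $O$ depends only on $\rho$ and $\epsilon$.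
   Context: For $\pi\in S_n$ and $k\ge0$, $N_{\mathrm{id}_k}(\pi)$ is the number of index sequences $1\le i_1<\dots<i_k\le n$ with $\pi(i_1)<\dots<\pi(i_k)$. For real $x$ that is not a negative integer, $x!:=\Gamma(x+1)$. *)

(* Defs.v *)
From HB Require Import structures.
From mathcomp Require Import all_boot all_order all_algebra all_fingroup.
From mathcomp Require Import all_classical all_reals all_analysis.
Set Implicit Arguments.
Unset Strict Implicit.
Unset Printing Implicit Defensive.
Import Order.TTheory GRing.Theory Num.Theory.
Import numFieldNormedType.Exports.
Local Open Scope ring_scope.

(* Partitions are nonincreasing sequences of positive integers, so that
   |rho| = sumn rho and m_j(rho) = count_mem j rho. *)
Definition is_partition (rho : seq nat) : bool :=
  sorted geq rho && (0%N \notin rho).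

(* Euler's integral. It converges exactly for s > 0, and the real-valued
   integral is 0 otherwise. *)
Definition Gamma (R : realType) (s : R) : R :=
  \int[@lebesgue_measure R]_(x in `]0, +oo[%classic)
    (x `^ (s - 1) * expR (- x)).

(* Valid for x > -1, the range of convergence of Euler's integral. *)
Definition real_fact (R : realType) (x : R) : R := Gamma (x + 1).

(* N_{id_k}(pi); i is the index sequence i_1 < ... < i_k. *)
Definition N_id (n k : nat) (pi : 'S_n) : nat :=
  #|[set i : k.-tuple 'I_n |
      sorted (fun a b : 'I_n => (a < b)%N) i &&
      sorted (fun a b : 'I_n => (pi a < pi b)%N) i]|.

(* restr_perm S pi is the permutation pi|_S extended by the identity outside S,
   provided pi maps S to itself. Only its orbits through S are listed; fixed
   points in S are cycles of length 1. *)
Definition cycle_type_on (n : nat) (S : {set 'I_n}) (pi : 'S_n) : seq nat :=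
  sort geq [seq #|C| |
             C : {set _} <- enum (porbit (restr_perm S pi) @: S)].

Section UniformProbability.
Variables (R : realType) (T : finType).
Implicit Types (A B : {set T}) (f : T -> R).

(* A is the sample space, with the uniform law; B is an event. *)
Definition Prob_unif A B : R := #|A :&: B|%:R / #|A|%:R.

Definition E_unif A f : R := (\sum_(x in A) f x) / #|A|%:R.

Definition E_unif_cond A B f : R :=
  E_unif A (fun x => f x * (x \in B)%:R) / Prob_unif A B.

End UniformProbability.

Definition perm_subsets (n r : nat) : {set 'S_n * {set 'I_n}} :=
  [set x : 'S_n * {set 'I_n} | #|x.2| == r].

Definition restricts_with_type (n : nat) (rho : seq nat)
  : {set 'S_n * {set 'I_n}} :=
  [set x : 'S_n * {set 'I_n} |
     (x.1 @: x.2 == x.2) && (cycle_type_on x.2 x.1 == rho)].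

(* Main.v *)
(* Write the ratio as a mean over independent uniform k-subsets I and J: N_{id_k}(pi) counts the
   pairs (I, J) such that pi extends the increasing bijection phi : I -> J. Replacing the set R by
   lists of disjoint cycles of shape rho, the conditioning becomes a sum over such lists, where each
   list weighs, up to a factor 1 + O(1/n), the product of its entries in the mean M of the
   permutation matrices that extend phi. Lists with repeated points contribute less, so that each
   part j of rho yields the number of closed walks of length j for M, minus those that follow phi
   if j >= 2, since phi has no cycle of length j >= 2.
   For j = 1 this is the number of fixed points of phi up to a bounded error. For j >= 2, cutting the
   walks at their steps outside phi is a renewal argument: the result depends only on the numbers d_l
   of points where phi^l is defined, and d_l = t^l n + O(n^(1/2)) in L^2, because d_(l+1) - t d_l is
   a martingale transform plus an explicit drift. This gives 1 - t^j.
   The q-th binomial moment of the number of fixed points has generating function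
   (XY)^q G^(q+1), where G = sum_(m,j) C(m,j)^2 X^m Y^j is the inverse square root of a quadratic
   polynomial in X. Hence a recursion from q to q + 2, matching (x+1)! = (x+1) x!; the case q = 1 is
   Wallis' formula, by the log-convexity of x! at half-integers. *)
Require Import Defs.
From HB Require Import structures.
From mathcomp Require Import all_boot all_order all_algebra all_fingroup.
From mathcomp Require Import all_classical all_reals all_analysis.
From mathcomp Require Import measurable_realfun.
From mathcomp Require Import zify ring lra.
Set Implicit Arguments.
Unset Strict Implicit.
Unset Printing Implicit Defensive.
Import Order.TTheory GRing.Theory Num.Theory.
Import numFieldNormedType.Exports.
Local Open Scope ring_scope.

(** * Averages over words with a fixed number of ones *)

(** When [rho] has no part 1, the required error O(n^(-1/2)) tends to 0, so not even bounded errors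
    are allowed; this dictates discarding the walks along phi before anything is estimated. In
    general the number of fixed points of phi is of order n^(1/2) and carries the whole growth of
    the ratio, so every error is expressed through its moments: it must have one fixed point less
    than the main term, or a factor n^(-1/2). Second moments suffice, because the deviations of the
    d_l are separated from the powers of the number of fixed points by the arithmetic-geometric mean
    inequality. The recursion from q to q + 2 multiplies a moment by the order of n, and the
    admissible error grows by the same factor, so the induction loses no precision. The number
    (1/2)! is never evaluated: the Euler integral itself enters Wallis' bounds, and this is the
    constant which the statement asks for at m_1 = 1. Shifts of n and k in that recursion leave the
    range given by eps, so the asymptotics is proved for all eps together. *)

Section Words.
Variable R : realFieldType.
Implicit Types (n k : nat) (F : seq bool -> R).

(** Sum over the words of length [n] with [k] ones, which encode the k-subsets of an n-set.
    Recursion on the first letter lets later inductions expose one letter at a time. *)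
Fixpoint wsum n k F : R :=
  if n is n'.+1 then
    wsum n' k (fun v => F (false :: v)) +
    (if k is k'.+1 then wsum n' k' (fun v => F (true :: v)) else 0)
  else (if k is 0%N then F [::] else 0).

Lemma wsum0 k F : wsum 0 k F = if k is 0%N then F [::] else 0.
Proof. by []. Qed.

Lemma wsumS n k F : wsum n.+1 k F = wsum n k (fun v => F (false :: v)) +
  (if k is k'.+1 then wsum n k' (fun v => F (true :: v)) else 0).
Proof. by []. Qed.

Lemma eq_wsum n k F F' : (forall v, size v = n -> count id v = k -> F v = F' v) ->
  wsum n k F = wsum n k F'.
Proof.
elim: n k F F' => [|n IH] [|k] F F' eqF //=.
- exact: eqF.
- by congr (_ + _); apply: IH => v sv cv; apply: eqF; rewrite /= ?sv ?cv.
- by congr (_ + _); apply: IH => v sv cv; apply: eqF; rewrite /= ?sv ?cv ?add0n ?add1n.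
Qed.

Lemma wsumD n k F F' : wsum n k (fun v => F v + F' v) = wsum n k F + wsum n k F'.
Proof.
elim: n k F F' => [|n IH] [|k] F F' //=; rewrite ?addr0 ?IH //.
by rewrite addrACA.
Qed.

Lemma wsumZ n k c F : wsum n k (fun v => c * F v) = c * wsum n k F.
Proof.
elim: n k F => [|n IH] [|k] F //=; rewrite ?addr0 ?mulr0 ?IH //.
by rewrite mulrDr.
Qed.

Lemma wsum_ge0 n k F : (forall v, size v = n -> 0 <= F v) -> 0 <= wsum n k F.
Proof.
elim: n k F => [|n IH] [|k] F F0 //=; rewrite ?addr0 ?F0 //.
  by apply: IH => v sv; apply: F0; rewrite /= sv.
by apply: addr_ge0; apply: IH => v sv; apply: F0; rewrite /= sv.
Qed.

Lemma wsum_le n k F F' : (forall v, size v = n -> F v <= F' v) ->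
  wsum n k F <= wsum n k F'.
Proof.
move=> leF; rewrite -subr_ge0 -mulN1r -wsumZ -wsumD.
by apply: wsum_ge0 => v sv; rewrite mulN1r subr_ge0 leF.
Qed.

Lemma wsum_sum (I : Type) (r : seq I) (P : pred I) n k (F : I -> seq bool -> R) :
  wsum n k (fun v => \sum_(i <- r | P i) F i v) = \sum_(i <- r | P i) wsum n k (F i).
Proof.
elim: n k F => [|n IH] [|k] F /=; rewrite ?big1_eq ?addr0 ?IH //.
  by apply: eq_bigr => i _; rewrite addr0.
by rewrite big_split.
Qed.

Lemma wsum_cst n k c : wsum n k (fun=> c) = c * 'C(n, k)%:R.
Proof.
elim: n k => [|n IH] [|k] /=; rewrite ?mulr1 ?mulr0 ?IH ?addr0 ?bin0 ?mulr1 //.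
by rewrite binS natrD mulrDr.
Qed.

Lemma wsum_small n k F : (n < k)%N -> wsum n k F = 0.
Proof.
elim: n k F => [|n IH] [|k] F //= nk.
by rewrite !IH ?addr0 // ltnW.
Qed.

Lemma wsum_cat m n k F : wsum (m + n) k F =
  \sum_(j < k.+1) wsum m j (fun v => wsum n (k - j) (fun w => F (v ++ w))).
Proof.
elim: m k F => [|m IH] k F /=.
  rewrite add0n big_ord_recl /= subn0 [X in _ + X]big1 ?addr0 // => i _.
rewrite big_split /= IH; congr (_ + _).
by case: k => [|k]; rewrite big_ord_recl /= ?big_ord0 ?addr0 // add0r IH.
Qed.

End Words.

Arguments wsum : simpl never.

(** * Predictable sums along a random word *)

Section Martingale.
Local Arguments wsum {R} !n !k F : simpl nomatch.
Variable R : realType.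
Implicit Types (n k : nat) (h F : seq bool -> R) (v : seq bool) (t : R).

Lemma mulrn_bin_left n k :
  k.+1%:R * 'C(n, k.+1)%:R = (n%:R - k%:R) * 'C(n, k)%:R :> R.
Proof.
have [kn|nk] := leqP k n; first by rewrite -natrB // -!natrM mul_bin_left.
by rewrite !bin_small ?mulr0 // ltnW.
Qed.

(** Cauchy-Schwarz with weights, read off from a nonnegative variance: A / W is the weighted mean of
    the quotients a i / w i. *)
Lemma sum_sqr_weighted (I : finType) (w a : I -> R) : (forall i, 0 < w i) ->
  (\sum_i a i) ^+ 2 <= (\sum_i w i) * (\sum_i a i ^+ 2 / w i).
Proof.
move=> w0; set W := \sum_i w i; set A := \sum_i a i.
have [i0 _|noI] := pickP (@predT I); last first.
  have z (f : I -> R) : \sum_i f i = 0 by apply: big1 => i; have := noI i.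
  by rewrite /A /W !z expr0n mul0r.
have W0 : 0 < W.
  rewrite /W (bigD1 i0) //= ltr_pwDl //; apply: sumr_ge0 => i _; exact: ltW.
have key : 0 <= \sum_i w i * (a i / w i - A / W) ^+ 2.
  by apply: sumr_ge0 => i _; rewrite mulr_ge0 ?sqr_ge0 // ltW.
have e : \sum_i w i * (a i / w i - A / W) ^+ 2 = \sum_i a i ^+ 2 / w i - A ^+ 2 / W.
  transitivity (\sum_i (a i ^+ 2 / w i - a i * (2 * A / W) + w i * (A / W) ^+ 2)).
    by apply: eq_bigr => i _; field; rewrite !gt_eqF.
  rewrite !big_split /= sumrN -!mulr_suml -/A -/W; field; exact/lt0r_neq0.
move: key; rewrite e subr_ge0 ler_pdivrMr // mulrC; exact.
Qed.

(** A sum of martingale differences: [h] of the prefix read so far, times the next letter minus its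
    conditional probability; [n] and [k] are the letters and the ones that remain. *)
Fixpoint mart n k h v : R := if v is b :: v' then
    h [::] * (b%:R - k%:R / n%:R) + mart n.-1 (k - b) (fun p => h (b :: p)) v'
  else 0.

(** The conditional probability that letter [i] is one, given the letters before it: remaining ones
    over remaining letters. The subtraction [k - b] does not truncate on a word with [k] ones. *)
Fixpoint cprob n k v i : R := match i, v with
  | i'.+1, b :: v' => cprob n.-1 (k - b) v' i'
  | _, _ => k%:R / n%:R
  end.

(** Doob's decomposition: inserting the conditional probability of each letter separates a
    martingale from a predictable drift. *)
Lemma mart_decomp t n k h v :
  \sum_(i < size v) h (take i v) * ((nth false v i)%:R - t) =
  mart n k h v + \sum_(i < size v) h (take i v) * (cprob n k v i - t).
Proof.
elim: v n k h => [|b v IH] n k h /=; first by rewrite !big_ord0 addr0.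
rewrite !big_ord_recl /= (IH n.-1 (k - b)%N (fun p => h (b :: p))).
ring.
Qed.

(** Each increment has conditional mean zero, which amounts to (k + 1) C(n, k + 1) = (n - k) C(n,
    k). *)
Lemma wsum_mart n k h : wsum n k (mart n k h) = 0.
Proof.
elim: n k h => [|n IH] [|k] h //=; rewrite wsumD wsum_cst subn0 IH ?addr0.
  by rewrite mul0r subrr mulr0 mul0r.
rewrite wsumD wsum_cst subn1 /= IH addr0 -!mulrA -mulrDr.
apply/eqP; rewrite mulf_eq0; apply/orP; right; apply/eqP.
have := mulrn_bin_left n k; rewrite -!natr1 => e.
have n0 : n%:R + 1 != 0 :> R by rewrite natr1 pnatr_eq0.
apply: (mulfI n0). rewrite mulr0 mulrDr.
transitivity ((n%:R - k%:R) * 'C(n, k)%:R - (k%:R + 1) * 'C(n, k.+1)%:R : R).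
  by field.
by rewrite e subrr.
Qed.

Lemma cprob_range n k : (k <= n)%N -> 0 <= (k%:R / n%:R : R) <= 1.
Proof.
move=> kn; rewrite divr_ge0 //=; case: n kn => [|n] kn; first by rewrite invr0 mulr0.
by rewrite ler_pdivrMr ?ltr0n // mul1r ler_nat.
Qed.

Lemma wsum_sqrD n k (a : R) F : wsum n k F = 0 ->
  wsum n k (fun v => (a + F v) ^+ 2) = a ^+ 2 * 'C(n, k)%:R + wsum n k (fun v => F v ^+ 2).
Proof.
move=> F0; transitivity (wsum n k (fun v => a ^+ 2 + (2 * a * F v + F v ^+ 2))).
  by apply: eq_wsum => v _ _; ring.
by rewrite !wsumD wsum_cst (wsumZ n k (2 * a) F) F0 mulr0 add0r.
Qed.

(** The increments are orthogonal, and each is at most 1 in absolute value because |h| <= 1 and a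
    letter differs from its probability by at most 1. *)
Lemma wsum_mart_sqr n k h : (forall v, `|h v| <= 1) ->
  wsum n k (fun v => mart n k h v ^+ 2) <= n%:R * 'C(n, k)%:R.
Proof.
elim: n k h => [|n IH] k h h1.
  by case: k => [|k] /=; rewrite ?expr0n /= ?mul0r.
have [nk|kn] := ltnP n.+1 k; first by rewrite wsum_small // bin_small ?mulr0.
have /andP[p0 p1] := cprob_range kn.
have sq (x : R) : `|x| <= 1 -> (h [::] * x) ^+ 2 <= 1.
  move=> x1; rewrite -real_normK ?num_real // exprn_ile1 ?normr_ge0 // normrM.
  by rewrite mulr_ile1.
have sq0 : (h [::] * (0 - k%:R / n.+1%:R)) ^+ 2 <= 1.
  by apply: sq; rewrite sub0r normrN ger0_norm.
have sq1 : (h [::] * (1 - k%:R / n.+1%:R)) ^+ 2 <= 1.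
  by apply: sq; rewrite ger0_norm ?subr_ge0 //; lra.
have hS b v : `|(fun p => h (b :: p)) v| <= 1 by apply: h1.
have step (b : bool) j : wsum n j (fun v => (h [::] * (b%:R - k%:R / n.+1%:R) +
     mart n j (fun p => h (b :: p)) v) ^+ 2) <= n.+1%:R * 'C(n, j)%:R.
  have -> : n.+1%:R * 'C(n, j)%:R = 'C(n, j)%:R + n%:R * 'C(n, j)%:R :> R.
    by rewrite -natr1; ring.
  rewrite wsum_sqrD ?wsum_mart // lerD ?IH // ler_piMl //.
  by case: b.
case: k kn sq0 sq1 p0 p1 step => [|k] kn sq0 sq1 p0 p1 step /=.
  by have := step false 0%N; rewrite !bin0 addr0.
have := lerD (step false k.+1) (step true k).
by rewrite -mulrDr -natrD -binS /= subn1 /=; apply.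
Qed.

(** The conditional probability is itself a martingale along the word, so its mean stays k / n. *)
Lemma wsum_cprob n k i : (i < n)%N ->
  wsum n k (fun v => cprob n k v i - k%:R / n%:R) = 0.
Proof.
elim: n k i => // n IH k [_|i].
  by rewrite (@eq_wsum _ _ _ _ (fun=> 0)) ?wsum_cst ?mul0r // => -[|b v] *; rewrite /= subrr.
rewrite ltnS => ltin; set c := k%:R / _.
have step j : wsum n j (fun v => cprob n j v i - c) = (j%:R / n%:R - c) * 'C(n, j)%:R.
  rewrite -wsum_cst -[RHS]add0r -(IH j i) // -wsumD; apply: eq_wsum => v _ _.
  by rewrite addrA subrK.
have n0 : n%:R != 0 :> R by rewrite pnatr_eq0 -lt0n (leq_trans _ ltin).
have n1 : n%:R + 1 != 0 :> R by rewrite natr1 pnatr_eq0.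
rewrite /c; case: k @c step => [|k] c step /=.
  by rewrite step /c !mul0r subrr mul0r addr0.
rewrite subn1 /= !step /c.
have := mulrn_bin_left n k; rewrite -!natr1 => e.
transitivity (((k%:R + 1) * 'C(n, k.+1)%:R - (n%:R - k%:R) * 'C(n, k)%:R) / (n%:R * (n%:R + 1)) : R).
  by field; rewrite n0 n1.
by rewrite e subrr mul0r.
Qed.

(** Reading one of m + 1 remaining letters moves the conditional probability by at most 1/m, and
    1/m^2 <= 2 (1/m - 1/(m + 1)), which telescopes. *)
Lemma wsum_cprob_var n k i : (i < n)%N ->
  wsum n k (fun v => (cprob n k v i - k%:R / n%:R) ^+ 2) <=
  2 * ((n - i)%:R^-1 - n%:R^-1) * 'C(n, k)%:R.
Proof.
elim: n k i => // n IH k [_|i].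
  rewrite subn0 subrr mulr0 mul0r.
  by rewrite (@eq_wsum _ _ _ _ (fun=> 0)) ?wsum_cst ?mul0r // => -[|b v] *; rewrite /= subrr expr0n.
rewrite ltnS => ltin; rewrite subSS.
have [nk|kn] := ltnP n.+1 k; first by rewrite wsum_small // bin_small ?mulr0.
have /andP[p0 p1] := cprob_range kn.
have n0 : 0 < n%:R :> R by rewrite ltr0n (leq_trans _ ltin).
have n1 : 1 <= n%:R :> R by rewrite ler1n (leq_trans _ ltin).
have n2 : 0 < n%:R + 1 :> R by rewrite ltr_pwDr.
have step j : `|j%:R / n%:R - k%:R / n.+1%:R| <= n%:R^-1 :> R ->
    wsum n j (fun v => (cprob n j v i - k%:R / n.+1%:R) ^+ 2) <=
  2 * ((n - i)%:R^-1 - n.+1%:R^-1) * 'C(n, j)%:R.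
  set p := k%:R / n.+1%:R.
  move=> jp; rewrite (@eq_wsum _ _ _ _ (fun v => (j%:R / n%:R - p + (cprob n j v i - j%:R / n%:R)) ^+ 2)); last first.
    by move=> v _ _; congr (_ ^+ 2); ring.
  rewrite wsum_sqrD ?wsum_cprob //.
  apply: le_trans (lerD (lexx _) (IH j i ltin)) _.
  rewrite -mulrDl ler_wpM2r //.
  have : (j%:R / n%:R - p) ^+ 2 <= n%:R^-1 ^+ 2.
    by rewrite -real_normK ?num_real // lerXn2r // nnegrE invr_ge0 ltW.
  have : n%:R^-1 ^+ 2 <= 2 * (n%:R^-1 - n.+1%:R^-1) :> R; last first.
    by move: ((j%:R / n%:R - p) ^+ 2) (n%:R^-1 ^+ 2) (n.+1%:R^-1 : R) => x y z; lra.
  rewrite -[n.+1%:R]natr1; have -> : n%:R^-1 - (n%:R + 1)^-1 = n%:R^-1 * (n%:R + 1)^-1 :> R.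
    by field; rewrite !gt_eqF.
  rewrite expr2 mulrCA ler_wpM2l ?invr_ge0 ?(ltW n0) //.
  by rewrite ler_pdivlMr // ler_pdivrMl //; lra.
have e0 : k%:R / n%:R - k%:R / n.+1%:R = (k%:R / n.+1%:R) / n%:R :> R.
  by rewrite -natr1; field; rewrite !gt_eqF.
have s0 : wsum n k (fun v => (cprob n k v i - k%:R / n.+1%:R) ^+ 2) <=
  2 * ((n - i)%:R^-1 - n.+1%:R^-1) * 'C(n, k)%:R.
  apply: step; rewrite e0 ger0_norm ?divr_ge0 // ?divr_ge0 //.
  by rewrite ler_pdivrMr // mulVf ?gt_eqF.
case: k kn p0 p1 step e0 s0 => [|k] kn p0 p1 step e0 s0 /=.
  by move: s0; rewrite !bin0 addr0.
rewrite subn1 /= binS natrD mulrDr; apply: lerD => //; apply: step.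
have -> : k%:R / n%:R - k.+1%:R / n.+1%:R = - ((1 - k.+1%:R / n.+1%:R) / n%:R) :> R.
  by rewrite -!natr1; field; rewrite !gt_eqF.
rewrite normrN ger0_norm ?divr_ge0 ?subr_ge0 //.
rewrite ler_pdivrMr // mulVf ?gt_eqF //; lra.
Qed.

Lemma sum_invsqrt n : \sum_(i < n) (Num.sqrt (n - i)%:R)^-1 <= 2 * Num.sqrt n%:R :> R.
Proof.
have -> : \sum_(i < n) (Num.sqrt (n - i)%:R)^-1 = \sum_(i < n) (Num.sqrt i.+1%:R)^-1 :> R.
  rewrite (reindex_inj rev_ord_inj) /=; apply: eq_bigr => i _.
  by rewrite subKn.
elim: n => [|n IH]; first by rewrite big_ord0 sqrtr0 mulr0.
rewrite big_ord_recr /= (le_trans (lerD IH (lexx _))) //.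
set a := Num.sqrt n%:R; set b := Num.sqrt n.+1%:R.
have b0 : 0 < b by rewrite sqrtr_gt0.
have a0 : 0 <= a by rewrite sqrtr_ge0.
have ab : b ^+ 2 = a ^+ 2 + 1 by rewrite !sqr_sqrtr // natr1.
rewrite -(ler_pM2r b0) mulrDl mulVf ?gt_eqF //.
have := sqr_ge0 (b - a); rewrite sqrrB; nra.
Qed.

(** The term of the drift at place i has second moment at most 2 / (n - i). Cauchy-Schwarz with
    weights (n - i)^(-1/2) keeps the bound linear in n, where equal weights would give n log n. The
    martingale contributes 2 n and the drift 16 n. *)
Lemma wsum_predictable_sqr n k h : (forall v, `|h v| <= 1) ->
  wsum n k (fun v => (\sum_(i < n) h (take i v) * ((nth false v i)%:R - k%:R / n%:R)) ^+ 2)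
  <= 18 * n%:R * 'C(n, k)%:R.
Proof.
move=> h1; set t := k%:R / n%:R; pose w (i : 'I_n) : R := (Num.sqrt (n - i)%:R)^-1.
have w0 i : 0 < w i by rewrite invr_gt0 sqrtr_gt0 ltr0n subn_gt0.
pose D v := \sum_(i < n) (cprob n k v i - t) ^+ 2 / w i.
have wW : \sum_i w i <= 2 * Num.sqrt n%:R by apply: sum_invsqrt.
have W0 : 0 <= \sum_i w i by apply: sumr_ge0 => i _; apply: ltW.
apply: (@le_trans _ _ (wsum n k (fun v => 2 * mart n k h v ^+ 2 + 4 * Num.sqrt n%:R * D v))).
  apply: wsum_le => v sv.
  have := mart_decomp t n k h v; rewrite sv => ->.
  set d := \sum_(i < n) _; set m := mart _ _ _ _.
  have D0 : 0 <= D v by apply: sumr_ge0 => i _; rewrite divr_ge0 ?sqr_ge0 // ltW.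
  have : d ^+ 2 <= (\sum_i w i) * D v.
    apply: le_trans (sum_sqr_weighted _ w0) _; apply: ler_wpM2l => //.
    apply: ler_sum => i _; rewrite ler_wpM2r ?invr_ge0 ?(ltW (w0 i)) //.
    rewrite exprMn ler_piMl ?sqr_ge0 // -real_normK ?num_real //.
    by rewrite exprn_ile1.
  have := ler_wpM2r D0 wW; have := sqr_ge0 (m - d); rewrite sqrrB sqrrD; lra.
rewrite wsumD !wsumZ /D wsum_sum.
have : \sum_(i < n) wsum n k (fun v => (cprob n k v i - t) ^+ 2 / w i) <=
       2 * (\sum_i w i) * 'C(n, k)%:R.
  rewrite mulr_sumr mulr_suml; apply: ler_sum => i _.
  rewrite (@eq_wsum _ _ _ _ (fun v => (w i)^-1 * (cprob n k v i - t) ^+ 2)); last by move=> *; rewrite mulrC.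
  rewrite wsumZ ler_pdivrMl //; apply: le_trans (wsum_cprob_var _ (ltn_ord i)) _.
  have ni : 0 < (n - i)%:R :> R by rewrite ltr0n subn_gt0.
  have e : w i * w i = (n - i)%:R^-1 by rewrite -invfM -expr2 sqr_sqrtr // ltW.
  rewrite !mulrA [w i * 2]mulrC -[2 * _ * w i]mulrA e ler_wpM2r // ler_wpM2l //.
  by rewrite gerBl invr_ge0.
have := wsum_mart_sqr n k h1.
have S0 : 0 <= Num.sqrt n%:R :> R by apply: sqrtr_ge0.
have SS : Num.sqrt n%:R * Num.sqrt n%:R = n%:R :> R by rewrite -expr2 sqr_sqrtr.
set X := wsum _ _ _; set Y := \sum_(i < n) wsum _ _ _ => hX hY.
have C0 : 0 <= 'C(n, k)%:R :> R by [].
have hY2 : Y <= 4 * Num.sqrt n%:R * 'C(n, k)%:R.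
  apply: le_trans hY _; rewrite ler_wpM2r //; lra.
have := ler_wpM2l S0 hY2.
have -> : Num.sqrt n%:R * (4 * Num.sqrt n%:R * 'C(n, k)%:R) = 4 * n%:R * 'C(n, k)%:R :> R.
  by rewrite -[in RHS]SS; ring.
lra.
Qed.

End Martingale.

(** * Factorial moments of the number of fixed points *)

Section SeriesCongruence.
Variable A : comNzRingType.
Implicit Types (p q : {poly A}) (N : nat).

(** Formal power series are represented by polynomials modulo X^N. *)
Definition series_eq N p q := forall m, (m < N)%N -> p`_m = q`_m.

Lemma series_eq_sym N p q : series_eq N p q -> series_eq N q p.
Proof. by move=> h m mN; rewrite h. Qed.
Lemma series_eq_trans N p q r : series_eq N p q -> series_eq N q r -> series_eq N p r.
Proof. by move=> h h' m mN; rewrite h ?h'. Qed.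
Lemma series_eqD N p q p' q' :
  series_eq N p q -> series_eq N p' q' -> series_eq N (p + p') (q + q').
Proof. by move=> h h' m mN; rewrite !coefD h ?h'. Qed.
Lemma series_eqM N p q p' q' :
  series_eq N p q -> series_eq N p' q' -> series_eq N (p * p') (q * q').
Proof.
move=> h h' m mN; rewrite !coefM; apply: eq_bigr => j _.
rewrite h ?h' //; last by apply: leq_ltn_trans mN; rewrite -ltnS.
by apply: leq_ltn_trans mN; rewrite leq_subr.
Qed.
Lemma series_eqMl N p q r : series_eq N p q -> series_eq N (r * p) (r * q).
Proof. by move=> h; apply: series_eqM. Qed.

Definition theta p := 'X * p^`().

Lemma coef_theta p m : (theta p)`_m = p`_m *+ m.
Proof. by rewrite /theta mulrC coefMX coef_deriv; case: m. Qed.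

Lemma theta_series_eq N p q : series_eq N p q -> series_eq N (theta p) (theta q).
Proof. by move=> h m mN; rewrite !coef_theta h. Qed.

Lemma thetaM p q : theta (p * q) = theta p * q + p * theta q.
Proof. by rewrite /theta derivM; ring. Qed.

Lemma thetaX p n : theta (p ^+ n.+1) = theta p * p ^+ n *+ n.+1.
Proof. by rewrite /theta deriv_exp /= mulrnAr mulrA. Qed.

End SeriesCongruence.

(** * The generating function of squared binomial coefficients *)

Section Generating.
Variable R : realType.
Local Notation P := {poly {poly R}}.
Implicit Types (N m q : nat).

(** The outer variable marks the length of a word, [Y] its number of ones. The identity [Dl] = [U]^2
    - 4 X^2 [Y] drives the recursion on moments. *)
Let Y : P := ('X)%:P.
Let Dl : P := 1 - 2 * 'X * (1 + Y) + 'X ^+ 2 * (1 - Y) ^+ 2.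
Let U : P := 1 - 'X * (1 + Y).

Definition binsq_poly m : {poly R} := \poly_(j < m.+1) ('C(m, j) ^ 2)%:R.
Definition binsq_series N : P := \poly_(m < N) binsq_poly m.

Lemma coef_binsq m j : (binsq_poly m)`_j = ('C(m, j) ^ 2)%:R.
Proof. by rewrite coef_poly ltnS; case: leqP => // h; rewrite bin_small. Qed.

Lemma coef_mul1DX (p : {poly R}) j :
  ((1 + 'X) * p)`_j = p`_j + (if j is j'.+1 then p`_j' else 0).
Proof. by rewrite mulrDl mul1r coefD coefXM; case: j. Qed.

Lemma coef_mul1BXsq (p : {poly R}) j :
  ((1 - 'X) ^+ 2 * p)`_j = p`_j - 2 * (if j is j'.+1 then p`_j' else 0)
     + (if j is j'.+2 then p`_j' else 0).
Proof.
have -> : (1 - 'X) ^+ 2 * p = p - 2 * ('X * p) + 'X * ('X * p) by ring.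
rewrite coefD coefB mulr_natl coefMn -mulr_natl.
case: j => [|[|j]]; rewrite !coefXM //= ?coefXM //=; ring.
Qed.

(* (m+2) P_(m+2) = (2m+3) (1+Y) P_(m+1) - (m+1) (1-Y)^2 P_m is the three-term recurrence of the
   Legendre polynomials, as P_m(Y) = (1-Y)^m Leg_m((1+Y)/(1-Y)). *)
Lemma binsq_rec m :
  binsq_poly m.+2 *+ m.+2 =
  (1 + 'X) * binsq_poly m.+1 *+ (2 * m + 3) - (1 - 'X) ^+ 2 * binsq_poly m *+ m.+1.
Proof.
apply/poly.polyP => j; rewrite coefB !coefMn coef_mul1DX coef_mul1BXsq !coef_binsq -(mulr_natl _ m.+2) -(mulr_natl _ (2 * m + 3)) -(mulr_natl _ m.+1) natrD natrM.
have natS (a b : nat) : ('C(a.+1, b.+1) ^ 2)%:R = ('C(a, b.+1)%:R + 'C(a, b)%:R) ^+ 2 :> R.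
  by rewrite natrX binS natrD.
have natE (a b : nat) : ('C(a, b) ^ 2)%:R = 'C(a, b)%:R ^+ 2 :> R by rewrite natrX.
case: j => [|[|j]]; rewrite ?coef_binsq.
- by rewrite !bin0; ring.
- by rewrite !bin1 !bin0; ring.
have := mulrn_bin_left R m j.+1; have := mulrn_bin_left R m j.
rewrite !natE !binS !natrD -!natr1.
move: ('C(m, j)%:R : R) ('C(m, j.+1)%:R : R) ('C(m, j.+2)%:R : R) => z y x e2 e1.
apply/eqP; rewrite -subr_eq0; apply/eqP.
(* In terms of three neighbouring binomials the claim is this combination of the ratio relations
   [e1] and [e2]. *)
have : 2 * (- (x + y) * ((j%:R + 1) * y - (m%:R - j%:R) * z)
     + (z + y) * ((j%:R + 1 + 1) * x - (m%:R - (j%:R + 1)) * y)) = 0.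
  by rewrite e1 e2 !subrr !mulr0 addr0 mulr0.
move=> <-; ring.
Qed.

Lemma coefDl p m : (Dl * p)`_m = p`_m
   - (if m is m'.+1 then 2 * (1 + 'X) * p`_m' else 0)
   + (if m is m'.+2 then (1 - 'X) ^+ 2 * p`_m' else 0).
Proof.
have -> : Dl * p = p - 'X * ((2 * (1 + 'X))%:P * p) + 'X * ('X * (((1 - 'X) ^+ 2)%:P * p)).
  by rewrite /Dl /Y !(rmorphM, rmorphD, rmorphB, rmorphXn, rmorph1, rmorph_nat); ring.
rewrite coefD coefB !coefXM; case: m => [|[|m]] /=; by rewrite ?coefCM ?subr0 ?addr0.
Qed.

Lemma coefU p m : (U * p)`_m = p`_m - (if m is m'.+1 then (1 + 'X) * p`_m' else 0).
Proof.
have -> : U * p = p - 'X * ((1 + 'X)%:P * p) by rewrite /U /Y polyCD polyC1; ring.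
by rewrite coefB coefXM; case: m => [|m] /=; rewrite ?coefCM.
Qed.

Lemma coef_series N m : (m < N)%N -> (binsq_series N)`_m = binsq_poly m.
Proof. by move=> mN; rewrite coef_poly mN. Qed.

Lemma thetaDl : theta Dl = 2 * Dl - 2 * U.
Proof.
apply/poly.polyP => m; rewrite coefB coef_theta -[Dl]mulr1 -[U]mulr1 !(mulr_natl _ 2).
rewrite !coefMn coefDl coefU !coef1.
case: m => [|[|[|m]]] /=; rewrite ?coef1 /= ?(mulr0, subr0, addr0, mul0rn) //; ring.
Qed.

Lemma binsq_poly0 : binsq_poly 0 = 1.
Proof.
apply/poly.polyP => j; rewrite coef_binsq coef1.
by case: j => [|j]; rewrite ?bin0 ?bin_small //= exp0n.
Qed.

Lemma binsq_poly1 : binsq_poly 1 = 1 + 'X.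
Proof.
apply/poly.polyP => j; rewrite coef_binsq coefD coef1 coefX.
by case: j => [|[|j]]; rewrite ?bin0 ?bin1 ?bin_small //= ?exp0n ?addr0 ?add0r.
Qed.

(** Coefficientwise this is the three-term recurrence. It is the differential equation of [Dl] to
    the power -1/2, because theta Dl = 2 Dl - 2 U. *)
Lemma binsq_series_ode N :
  series_eq N (Dl * theta (binsq_series N)) ((U - Dl) * binsq_series N).
Proof.
set G := binsq_series N; move=> m mN.
rewrite mulrBl coefB coefU !coefDl.
case: m mN => [|[|m]] mN; rewrite !coef_theta !coef_series // ?(ltnW mN) ?(ltnW (ltnW mN)) //.
- ring.
- by rewrite binsq_poly0 binsq_poly1; ring.
have := binsq_rec m.
rewrite -(mulr_natl _ m.+2) -(mulr_natl _ (2 * m + 3)) -(mulr_natl _ m.+1) natrD natrM -!natr1 => e.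
rewrite -(mulr_natl _ m.+1) -(mulr_natl _ m) -!natr1.
apply/eqP; rewrite -subr_eq0; apply/eqP.
move/eqP: e; rewrite -subr_eq0 => /eqP <-; ring.
Qed.

(** The differential equation makes [theta] of Dl G^2 vanish; in characteristic 0 only the constant
    term 1 is left. *)
Lemma binsq_series_sqr N : series_eq N (Dl * binsq_series N ^+ 2) 1.
Proof.
set G := binsq_series N.
have th : series_eq N (theta (Dl * G ^+ 2)) 0.
  have -> : theta (Dl * G ^+ 2) =
      2 * G * (Dl * theta G) + (theta Dl * G ^+ 2).
    by rewrite thetaM expr2 thetaM; ring.
  apply: (@series_eq_trans _ _ _ (2 * G * ((U - Dl) * G) + theta Dl * G ^+ 2)).
    by apply: series_eqD => //; apply: series_eqMl; apply: binsq_series_ode.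
  by rewrite thetaDl; have -> : 2 * G * ((U - Dl) * G) + (2 * Dl - 2 * U) * G ^+ 2 = 0 by ring.
case=> [|m] mN.
  rewrite coefDl expr2 coef0M !coef_series // binsq_poly0 coef1 /=; ring.
have := th _ mN; rewrite coef_theta coef0 coef1 /= => /eqP.
have /negPf m0 : m.+1%:R != 0 :> {poly R} by rewrite -polyC_natr polyC_eq0 pnatr_eq0.
by rewrite -(mulr_natl _ m.+1) mulf_eq0 m0 => /eqP.
Qed.

(** Multiplying the differential equation by G^2 and using Dl G^2 = 1 gives theta G + G = U G^3, the
    case q = 1; the other powers follow by the chain rule. *)
Lemma binsq_series_theta_pow N q : let G := binsq_series N in
  series_eq N (theta (G ^+ q) + q%:R * G ^+ q) (q%:R * (U * G ^+ q.+2)).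
Proof.
move=> G; case: q => [|q].
  by rewrite !mul0r addr0 /theta expr0 derivC mulr0.
have e1 : series_eq N (theta G) ((U - Dl) * G ^+ 3).
  apply: (@series_eq_trans _ _ _ (Dl * G ^+ 2 * theta G)).
    by rewrite -[X in series_eq _ X _]mul1r; apply: series_eqM => //; apply/series_eq_sym/binsq_series_sqr.
  have -> : Dl * G ^+ 2 * theta G = G ^+ 2 * (Dl * theta G) by ring.
  have -> : (U - Dl) * G ^+ 3 = G ^+ 2 * ((U - Dl) * G) by ring.
  by apply: series_eqMl; apply: binsq_series_ode.
rewrite thetaX -mulr_natl -mulrDr; apply: series_eqMl.
apply: (@series_eq_trans _ _ _ ((U - Dl) * G ^+ 3 * G ^+ q + Dl * G ^+ 2 * G ^+ q.+1)).
  apply: series_eqD; first by apply: series_eqM.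
  rewrite -[X in series_eq _ X _]mul1r; apply: series_eqM => //; exact/series_eq_sym/binsq_series_sqr.
by have -> : (U - Dl) * G ^+ 3 * G ^+ q + Dl * G ^+ 2 * G ^+ q.+1 = U * G ^+ q.+3 by rewrite !exprS; ring.
Qed.

(** A further factor U produces U^2 = Dl + 4 X^2 Y, and Dl lowers G^(q+2) to G^q. This links the
    orders q and q + 2. *)
Lemma binsq_series_step N q : let G := binsq_series N in
  series_eq N (U * (theta (G ^+ q) + q%:R * G ^+ q))
    (q%:R * G ^+ q + (4 * q)%:R * ('X ^+ 2 * Y * G ^+ q.+2)).
Proof.
move=> G; apply: series_eq_trans (series_eqMl _ (@binsq_series_theta_pow N q)) _.
have -> : U * (q%:R * (U * G ^+ q.+2)) =
   q%:R * (Dl * G ^+ 2 * G ^+ q) + (4 * q)%:R * ('X ^+ 2 * Y * G ^+ q.+2).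
  by rewrite natrM !exprS /U /Dl; ring.
apply: series_eqD => //; apply: series_eqMl; rewrite -[X in series_eq _ _ X]mul1r.
by apply: series_eqM => //; apply: binsq_series_sqr.
Qed.

End Generating.

(** * Enumeration of fixed points *)

Section FixedPoints.
Variable R : realType.
Implicit Types (n k q x : nat) (v w : seq bool).

(** With [v] and [w] encoding I and J, the increasing bijection from I to J fixes [x] when [x] lies
    in both sets with the same rank. *)
Definition fixat v w x : bool :=
  [&& nth false v x, nth false w x & count id (take x v) == count id (take x w)].

Definition fixes v w : nat := \sum_(x < size v) fixat v w x.

Definition fixbin q n k : R :=
  wsum n k (fun v => wsum n k (fun w => 'C(fixes v w, q)%:R)).

(** A set of q + 1 true places consists of its least element and q later ones. *)
Lemma bin_sum_bool n (b : nat -> bool) q :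
  ('C(\sum_(x < n) b x, q.+1) =
  \sum_(x < n) b x * 'C(\sum_(y < n - x.+1) b (x.+1 + y), q))%N.
Proof.
elim: n b => [|n IH] b; first by rewrite !big_ord0.
rewrite !big_ord_recl /= subn1 /=.
case: (b 0%N); rewrite /= ?mul1n ?mul0n ?add1n ?add0n ?binS ?(IH (fun x => b x.+1)) //.
by rewrite addnC; congr (_ + _).
Qed.

Lemma fixes_drop x v w : fixat v w x ->
  fixes (drop x.+1 v) (drop x.+1 w) = (\sum_(y < size v - x.+1) fixat v w (x.+1 + y))%N.
Proof.
case/and3P=> vx wx /eqP e; rewrite /fixes size_drop; apply: eq_bigr => y _.
have xv : (x < size v)%N by rewrite ltnNge; apply: contraTN vx => h; rewrite nth_default.
have xw : (x < size w)%N by rewrite ltnNge; apply: contraTN wx => h; rewrite nth_default.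
rewrite /fixat !nth_drop !takeD !count_cat !(take_nth false) // -!cats1 !count_cat /= vx wx e.
by rewrite eqn_add2l.
Qed.

Lemma bin_fixesS q v w : ('C(fixes v w, q.+1) =
  \sum_(x < size v) fixat v w x * 'C(fixes (drop x.+1 v) (drop x.+1 w), q))%N.
Proof.
rewrite {1}/fixes bin_sum_bool; apply: eq_bigr => x _.
by case fx: (fixat v w x); rewrite ?mul0n // (fixes_drop fx).
Qed.

Lemma wsum_head_true n k (F G : seq bool -> R) :
  (forall v, size v = n.+1 -> G v = (head false v)%:R * F (behead v)) ->
  wsum n.+1 k G = if k is k'.+1 then wsum n k' F else 0.
Proof.
move=> GE; rewrite (@eq_wsum _ _ _ _ (fun v => (head false v)%:R * F (behead v))); last first.
  by move=> v sv _; apply: GE.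
rewrite wsumS wsumZ mul0r add0r; case: k => [|k] //.
by apply: eq_wsum => v _ _; rewrite mul1r.
Qed.

(** Cutting at a fixed point x: both prefixes have the same number j of ones, the letter x is a one
    in each word, and both suffixes carry k - j - 1 ones. *)
Lemma wsum2_fixat x m k (H : seq bool -> seq bool -> R) :
  wsum (x + m.+1) k (fun v => wsum (x + m.+1) k (fun w =>
     (fixat v w x)%:R * H (drop x.+1 v) (drop x.+1 w))) =
  \sum_(j < k.+1) ('C(x, j) ^ 2)%:R *
    (if (k - j)%N is i.+1 then wsum m i (fun v => wsum m i (H v)) else 0).
Proof.
rewrite wsum_cat; apply: eq_bigr => j _.
pose T i := if (k - j)%N is i'.+1 then wsum m i' (H i) else 0.
transitivity (wsum x j (fun=> wsum m.+1 (k - j) (fun v2 =>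
    (head false v2)%:R * ('C(x, j)%:R * T (behead v2))))).
  apply: eq_wsum => v1 sv1 cv1; apply: eq_wsum => v2 sv2 _.
  have drop_cat' (u1 u2 : seq bool) : size u1 = x -> size u2 = m.+1 -> drop x.+1 (u1 ++ u2) = behead u2.
    by move=> <- _; rewrite drop_cat ltnNge leqnSn /= subSn // subnn drop1.
  have nth_cat' (a b : seq bool) : size a = x -> size b = m.+1 -> nth false (a ++ b) x = head false b.
    by move=> <- _; rewrite nth_cat ltnn subnn nth0.
  have take_cat' (c d : seq bool) : size c = x -> take x (c ++ d) = c.
    by move=> <-; rewrite take_size_cat.
  rewrite wsum_cat (bigD1 j) //= [X in _ + X]big1 ?addr0 => [|i ij].
    rewrite (@eq_wsum _ _ _ _ (fun=> (head false v2)%:R * T (behead v2))); last first.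
      move=> w1 sw1 cw1.
      rewrite (@wsum_head_true m (k - j) (fun w => (head false v2)%:R * H (behead v2) w)).
        by rewrite /T; case: (k - j)%N => [|i]; rewrite ?mulr0 // wsumZ.
      move=> w2 sw2; rewrite /fixat !drop_cat' // !nth_cat' // !take_cat' // cv1 cw1 eqxx andbT.
      by rewrite -mulnb natrM mulrCA mulrA.
    by rewrite wsum_cst mulrC mulrCA.
  rewrite (@eq_wsum _ _ _ _ (fun=> 0)) ?wsum_cst ?mul0r // => w1 sw1 cw1.
  rewrite (@eq_wsum _ _ _ _ (fun=> 0)) ?wsum_cst ?mul0r // => w2 sw2 _.
  rewrite /fixat !nth_cat' // !take_cat' // cv1 cw1.
  by rewrite [_ == _ :> nat]eq_sym (negPf (_ : nat_of_ord i != j)) // !andbF mul0r.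
rewrite wsum_cst (@wsum_head_true m (k - j) (fun v => 'C(x, j)%:R * T v)) // /T.
by case: (k - j)%N => [|i]; rewrite ?mul0r ?mulr0 // wsumZ natrX mulrAC -expr2.
Qed.

Lemma fixbinS q n k : fixbin q.+1 n.+1 k.+1 =
  \sum_(x < n.+1) \sum_(j < k.+1) ('C(x, j) ^ 2)%:R * fixbin q (n - x) (k - j).
Proof.
transitivity (\sum_(x < n.+1) wsum n.+1 k.+1 (fun v => wsum n.+1 k.+1 (fun w =>
     (fixat v w x)%:R * 'C(fixes (drop x.+1 v) (drop x.+1 w), q)%:R)) : R).
  rewrite -wsum_sum; apply: eq_wsum => v sv _; rewrite -wsum_sum.
  by apply: eq_wsum => w _ _; rewrite bin_fixesS sv natr_sum; under eq_bigr do rewrite natrM.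
apply: eq_bigr => x _; have xn : (x <= n)%N by rewrite -ltnS.
case: x xn => x /= _ xn; have -> : n.+1 = (x + (n - x).+1)%N by lia.
rewrite (wsum2_fixat x (n - x) k.+1 (fun v w => 'C(fixes v w, q)%:R)) big_ord_recr /= subnn mulr0 addr0.
by apply: eq_bigr => j _; rewrite subSn // -ltnS.
Qed.

Lemma fixbin0 n k : fixbin 0 n k = ('C(n, k) ^ 2)%:R.
Proof.
rewrite /fixbin (@eq_wsum _ _ _ _ (fun=> 'C(n, k)%:R)) ?wsum_cst -?natrM //.
move=> v _ _; rewrite -[RHS]mul1r -wsum_cst; apply: eq_wsum => w _ _; by rewrite bin0.
Qed.

Lemma fixbin_small q n k : (n < k)%N -> fixbin q n k = 0.
Proof. by move=> nk; rewrite /fixbin wsum_small. Qed.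

Lemma fixbinS_n0 q k : fixbin q.+1 0 k = 0.
Proof. by rewrite /fixbin wsum0; case: k => // ; rewrite wsum0 /fixes big_ord0. Qed.

Lemma fixbinS_k0 q n : fixbin q.+1 n 0 = 0.
Proof.
rewrite /fixbin (@eq_wsum _ _ _ _ (fun=> 0)) ?wsum_cst ?mul0r // => v sv cv.
rewrite (@eq_wsum _ _ _ _ (fun=> 0)) ?wsum_cst ?mul0r // => w sw cw.
rewrite bin_fixesS big1 // => x _; rewrite /fixat.
suff -> : nth false v x = false by [].
apply/negbTE; move/eqP: cv; rewrite -leqn0 leqNgt -has_count => /hasPn h.
by apply: (h (nth false v x)); rewrite mem_nth.
Qed.

Definition fix_poly q n : {poly R} := \poly_(k < n.+1) fixbin q n k.
Definition fix_series N q : {poly {poly R}} := \poly_(n < N) fix_poly q n.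

Lemma coef_fix_poly q n k : (fix_poly q n)`_k = fixbin q n k.
Proof. by rewrite coef_poly ltnS; case: leqP => // /fixbin_small ->. Qed.

Lemma coef_fix_series N q n : (n < N)%N -> (fix_series N q)`_n = fix_poly q n.
Proof. by move=> nN; rewrite coef_poly nN. Qed.

Lemma fix_poly0 n : fix_poly 0 n = binsq_poly R n.
Proof. by apply/poly.polyP => k; rewrite coef_fix_poly coef_binsq fixbin0. Qed.

Lemma fix_polyS q n : fix_poly q.+1 n.+1 = 'X * \sum_(x < n.+1) binsq_poly R x * fix_poly q (n - x).
Proof.
apply/poly.polyP => -[|k]; rewrite coef_fix_poly coefXM /= ?fixbinS_k0 // fixbinS coef_sum.
apply: eq_bigr => x _; rewrite coefM; apply: eq_bigr => j _.
by rewrite coef_binsq coef_fix_poly.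
Qed.

Let Y : {poly {poly R}} := ('X)%:P.

(** Each of the q chosen fixed points contributes X Y, and each of the q + 1 stretches around them
    is a pair of words of equal length with equally many ones, contributing G. *)
Lemma fix_seriesE N q :
  series_eq N (fix_series N q) (('X * Y) ^+ q * binsq_series R N ^+ q.+1).
Proof.
elim: q => [|q IH].
  by move=> n nN; rewrite expr0 mul1r expr1 coef_fix_series // coef_series // fix_poly0.
apply: (@series_eq_trans _ _ _ ('X * Y * (binsq_series R N * fix_series N q))).
  move=> [|n] nN; rewrite coef_fix_series //.
    rewrite -mulrA coefXM /=; apply/poly.polyP => k; by rewrite coef_fix_poly coef0 fixbinS_n0.
  rewrite fix_polyS -mulrA coefXM /= coefCM coefM; congr (_ * _); apply: eq_bigr => x _.
  have xn : (x <= n)%N by rewrite -ltnS.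
  by rewrite coef_series ?coef_fix_series //; lia.
have -> : ('X * Y) ^+ q.+1 * binsq_series R N ^+ q.+2 =
   'X * Y * (binsq_series R N * (('X * Y) ^+ q * binsq_series R N ^+ q.+1)).
  by rewrite !exprS; ring.
by do 2!apply: series_eqMl.
Qed.

End FixedPoints.

(** * Recursion for the binomial moments *)

Section FixRecurrence.
Variable R : realType.
Implicit Types (n k q : nat).
Local Notation fixbin := (fixbin R).

Lemma thetaXY q : theta (('X * ('X)%:P) ^+ q : {poly {poly R}}) = q%:R * ('X * ('X)%:P) ^+ q.
Proof.
case: q => [|q]; first by rewrite mul0r /theta expr0 derivC mulr0.
by rewrite thetaX /theta derivM derivX derivC mulr0 addr0 mul1r -mulr_natl exprS !mulrA.
Qed.

(** The coefficient of X^(n+1) Y^(k+2) in the identity for G^(q+1), multiplied by (X Y)^q Y; the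
    extra Y completes X^2 Y (X Y)^q to (X Y)^(q+2). *)
Lemma fixbin_rec q n k :
  4 * q.+1%:R * fixbin q.+2 n.+1 k.+2 =
  (n.+1%:R - q%:R) * fixbin q n.+1 k.+1 -
  n.+1%:R * (fixbin q n k.+1 + fixbin q n k).
Proof.
pose N := n.+2; set Y : {poly {poly R}} := ('X)%:P; set U := 1 - 'X * (1 + Y).
pose G := binsq_series R N; pose S := fix_series R N q.
have e : series_eq N ('X%:P * (U * (theta S + S)))
   ('X%:P * ((q.+1)%:R * S) + (4 * q.+1)%:R * fix_series R N q.+2).
  pose S' := ('X * Y) ^+ q * G ^+ q.+1.
  have SS' : series_eq N S S' by apply: fix_seriesE.
  apply: (@series_eq_trans _ _ _ ('X%:P * (U * (theta S' + S')))).
    by do 2!apply: series_eqMl; apply: series_eqD => //; apply: theta_series_eq.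
  have -> : 'X%:P * (U * (theta S' + S')) =
     ('X * Y) ^+ q * Y * (U * (theta (G ^+ q.+1) + q.+1%:R * G ^+ q.+1)).
    by rewrite /S' thetaM thetaXY -/Y -[q.+1%:R]natr1; ring.
  apply: series_eq_trans (series_eqMl _ (@binsq_series_step R N q.+1)) _.
  rewrite -/G -/Y; have -> : ('X * Y) ^+ q * Y * (q.+1%:R * G ^+ q.+1 +
     (4 * q.+1)%:R * ('X ^+ 2 * Y * G ^+ q.+3)) =
     'X%:P * (q.+1%:R * S') + (4 * q.+1)%:R * (('X * Y) ^+ q.+2 * G ^+ q.+3).
    by rewrite /S' -/Y !exprS; ring.
  apply: series_eqD; first by do 2!apply: series_eqMl; apply: series_eq_sym.
  by apply: series_eqMl; apply: series_eq_sym; apply: fix_seriesE.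
have natC (m : nat) (p : {poly {poly R}}) i : (m%:R * p)`_i = m%:R * p`_i.
  by rewrite mulr_natl coefMn mulr_natl.
have natC' (m : nat) (p : {poly R}) i : (m%:R * p)`_i = m%:R * p`_i.
  by rewrite mulr_natl coefMn mulr_natl.
have := e n.+1 (ltnSn _).
rewrite coefD !coefCM !natC coefU !coefD !coef_theta !coef_fix_series ?ltnSn // 1?ltnW //.
move/(congr1 (fun p : {poly R} => p`_k.+2)).
rewrite coefD !natC' !coefXM /= !natC' mulrDl mul1r !(coefB, coefD) coefXM /= coefD.
rewrite !coefMn !coef_fix_poly -(mulr_natl _ n.+1) -(mulr_natl _ n).
rewrite natrM -!natr1. move=> h; apply/eqP; rewrite -subr_eq0; apply/eqP; move/eqP: h; rewrite eq_sym -subr_eq0 => /eqP <-; ring.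
Qed.

(** Half of C(2n, 2k - 1), the closed form of the first moment; k = 0 is split off because 2k - 1
    would be negative. *)
Definition bin2 n k : R := if k is k'.+1 then 'C(n.*2, k'.*2.+1)%:R / 2 else 0.

Lemma bin2_rec n k :
  bin2 n.+2 k = 2 * (bin2 n.+1 k + (if k is k'.+1 then bin2 n.+1 k' else 0))
   - (bin2 n k - 2 * (if k is k'.+1 then bin2 n k' else 0) + (if k is k'.+2 then bin2 n k' else 0)).
Proof.
case: k => [|[|[|k]]]; rewrite /bin2 ?doubleS ?(binS, bin0, bin1, natrD); try by field.
all: by rewrite ?natrD; field.
Qed.

(** As G^2 is the inverse of Dl, the first moment has the rational generating function X Y / Dl,
    hence a linear recurrence, which [bin2] shares. *)
Lemma fixbin1 n k : fixbin 1 n k = bin2 n k.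
Proof.
pose N := n.+1; set Y : {poly {poly R}} := ('X)%:P.
pose D : {poly {poly R}} := 1 - 2 * 'X * (1 + Y) + 'X ^+ 2 * (1 - Y) ^+ 2.
pose h m := \poly_(j < m.+1) bin2 m j.
have hE m j : (h m)`_j = bin2 m j.
  rewrite coef_poly ltnS; case: leqP => // mj; case: j mj => // j mj.
  by rewrite /bin2 bin_small ?mul0r //; lia.
pose H : {poly {poly R}} := \poly_(m < N) h m.
have DH : series_eq N (D * H) ('X * Y).
  move=> m mN; rewrite coefDl coefXM.
  have HE j : (j <= m)%N -> H`_j = h j by move=> jm; rewrite coef_poly (leq_ltn_trans jm).
  have h0 : h 0%N = 0.
    apply/poly.polyP => j; rewrite hE coef0 /bin2; case: j => // j.
    by rewrite bin_small // mul0r.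
  case: m mN HE => [|[|m]] mN HE; rewrite !HE ?leqnn ?leqnSn // ?(leqW (leqnSn m)) //= ?h0.
  - by rewrite subr0 addr0.
  - rewrite coefC /= mulr0 subr0 addr0; apply/poly.polyP => j; rewrite hE coefX /bin2.
    case: j => [|[|j]] //=; last by rewrite bin_small ?mul0r //; lia.
    by rewrite bin1 mulfV ?pnatr_eq0.
  - rewrite coefC /=; apply/poly.polyP => j; rewrite coef0 coefD coefB -mulrA (mulr_natl _ 2) coefMn.
    rewrite coef_mul1DX coef_mul1BXsq !hE bin2_rec.
    by case: j => [|[|j]]; rewrite ?hE; ring.
have e : series_eq N H (fix_series R N 1).
  apply: (@series_eq_trans _ _ _ (D * binsq_series R N ^+ 2 * H)).
    by rewrite -[X in series_eq _ X _]mul1r; apply: series_eqM => //; apply/series_eq_sym/binsq_series_sqr.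
  have -> : D * binsq_series R N ^+ 2 * H = binsq_series R N ^+ 2 * (D * H) by ring.
  apply: (@series_eq_trans _ _ _ (binsq_series R N ^+ 2 * ('X * Y))); first exact: series_eqMl.
  by apply: series_eq_sym; rewrite mulrC -[X in X * _]expr1; apply: fix_seriesE.
have := e n (ltnSn _); rewrite coef_fix_series ?ltnSn // coef_poly ltnSn.
by move/(congr1 (fun p : {poly R} => p`_k)); rewrite hE coef_fix_poly.
Qed.

End FixRecurrence.

(** * Half-integer factorials *)

Section HalfIntegerFactorials.
Variable R : realType.
Local Open Scope classical_set_scope.
Local Notation mu := (@lebesgue_measure R).
Implicit Types (m : nat) (x : R).

Definition half_fact m : R := real_fact (m%:R / 2).

(** The density x^(m/2) exp(-x), written with a square root so that it is continuous on the whole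
    line. *)
Definition gden m x : R := Num.sqrt x ^+ m * expR (- x).
Definition halfexp x : R := expR (- (x / 2)).
Definition gden_bound m : R := 1 + 2 ^+ m * m`!%:R.

Lemma gden_bound_ge0 m : 0 <= gden_bound m.
Proof. by rewrite addr_ge0 // mulr_ge0 // exprn_ge0. Qed.

Lemma gden_ge0 m x : 0 <= gden m x.
Proof. by rewrite mulr_ge0 ?expR_ge0 // exprn_ge0 ?sqrtr_ge0. Qed.

(** With y = x^(m/2), y <= 1 + y^2 = 1 + x^m, and the exponential series bounds x^m by 2^m m!
    exp(x/2). This gives an integrable majorant. *)
Lemma gden_le m x : 0 <= x -> gden m x <= gden_bound m * halfexp x.
Proof.
move=> x0; rewrite /gden /halfexp.
have -> : - x = x / 2 * -1 + - (x / 2) by field.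
rewrite expRD mulrA ler_wpM2r ?expR_ge0 // mulrN1 expRN ler_pdivrMr ?expR_gt0 //.
have x20 : 0 <= x / 2 by rewrite divr_ge0.
have e1 : 1 <= expR (x / 2) by rewrite -[leLHS]expR0 ler_expR.
have h1 : x ^+ m <= 2 ^+ m * m`!%:R * expR (x / 2).
  case: m => [|m]; first by rewrite !expr0 fact0 !mul1r.
  have := expR_ge1Dxn m x20; rewrite expr_div_n => h.
  have f0 : 0 < m.+1`!%:R :> R by rewrite ltr0n fact_gt0.
  have p0 : 0 < 2 ^+ m.+1 :> R by rewrite exprn_gt0.
  have : x ^+ m.+1 / 2 ^+ m.+1 / m.+1`!%:R <= expR (x / 2) by lra.
  rewrite !ler_pdivrMr // => /le_trans; apply; rewrite le_eqVlt; apply/orP; left; apply/eqP; ring.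
have : x ^+ m = (Num.sqrt x ^+ m) ^+ 2 by rewrite exprAC sqr_sqrtr.
set y := Num.sqrt x ^+ m => h2.
have : y <= 1 + y ^+ 2 by have := sqr_ge0 (y - 1); have := sqr_ge0 y; nra.
by rewrite -h2 /gden_bound; lra.
Qed.

Lemma continuous_halfexp : continuous halfexp.
Proof.
move=> x; apply: continuous_comp; last exact: continuous_expR.
by apply: continuousN; apply: continuousM => //; apply: cst_continuous.
Qed.

Lemma continuous_gden m : continuous (gden m).
Proof.
move=> x; apply: (@continuousM _ _ (fun x => Num.sqrt x ^+ m) (fun x => expR (- x))).
  apply: (@continuous_comp _ _ _ Num.sqrt (fun y : R => y ^+ m)).
    exact: sqrt_continuous.
  exact: exprn_continuous.
apply: continuous_comp; last exact: continuous_expR.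
exact: continuousN.
Qed.

Lemma cvg_halfexp : halfexp x @[x --> +oo] --> (0 : R).
Proof.
rewrite (_ : halfexp = (fun z => expR (- z)) \o (fun z => 2^-1 * z)); last first.
  by apply/funext => x /=; rewrite /halfexp mulrC.
apply: (@cvg_comp _ _ _ (fun z : R => 2^-1 * z) (fun z => expR (- z)) _ (pinfty_nbhs R)).
  exact: gt0_cvgMry.
exact: cvgr_expR.
Qed.

Lemma cvg_gden m : gden m x @[x --> +oo] --> (0 : R).
Proof.
apply: (@squeeze_cvgr _ _ _ _ (fun=> 0) (fun x => gden_bound m * halfexp x)).
- near=> x; rewrite gden_ge0 gden_le //; near: x; exact: nbhs_pinfty_ge.
- exact: cvg_cst.
- rewrite -[X in _ --> X](mulr0 (gden_bound m)); apply: cvgM; first exact: cvg_cst.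
  exact: cvg_halfexp.
Unshelve. all: by end_near. Qed.

Lemma is_derive_halfexp x : is_derive x 1 halfexp (- (halfexp x / 2)).
Proof.
by rewrite /halfexp; apply: is_derive_eq; rewrite /GRing.scale /=; field.
Qed.

Lemma derivable_halfexp x : derivable halfexp x 1.
Proof. by have [] := is_derive_halfexp x. Qed.

Lemma is_derive_gden m x : 0 < x ->
  is_derive x 1 (gden m.+2) (m.+2%:R / 2 * gden m x - gden m.+2 x).
Proof.
move=> x0; have ds := is_derive1_sqrt x0.
have s0 : 0 < Num.sqrt x by rewrite sqrtr_gt0.
have e : Num.sqrt x ^+ m.+2 = x * Num.sqrt x ^+ m by rewrite !exprS mulrA -expr2 sqr_sqrtr // ltW.
have de : is_derive x 1 (fun y : R => expR (- y)) (- expR (- x)).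
  by apply: is_derive_eq; rewrite /GRing.scale /= mulrN1.
have dX := is_deriveX m.+2 ds.
have -> : gden m.+2 = ((@Num.sqrt R) ^+ m.+2) * (fun y : R => expR (- y)).
  by apply/funext => y; rewrite /gden !fctE.
apply: (is_derive_eq (is_deriveM dX de)); rewrite /GRing.scale /= !fctE e !exprS /gden.
rewrite -!natr1; field; exact: lt0r_neq0.
Qed.

Lemma integral_halfexp : (\int[mu]_(x in `[0%R, +oo[) (halfexp x)%:E = 2%:E)%E.
Proof.
rewrite (@ge0_continuous_FTC2y _ halfexp (fun x => - 2 * halfexp x) 0 0).
- by rewrite /halfexp mul0r oppr0 expR0 mulr1 -EFinB sub0r opprK.
- by move=> x _; apply: expR_ge0.
- by apply: continuous_subspaceT => x; apply: continuous_halfexp.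
- rewrite -[X in _ --> X](mulr0 (- 2)); apply: cvgM; first exact: cvg_cst.
  exact: cvg_halfexp.
- by move=> x _; apply: derivableM => //; apply: derivable_halfexp.
- apply: cvg_at_right_filter; apply: cvgM; first exact: cvg_cst.
  exact: continuous_halfexp.
- move=> x _; rewrite derive1E; have := is_derive_halfexp x => h.
  by rewrite derive_val /GRing.scale /=; field.
Qed.

Lemma measurable_gden m (D : set R) : measurable_fun D (gden m).
Proof. by apply: measurable_funTS; apply: continuous_measurable_fun; apply: continuous_gden. Qed.

Lemma integrable_halfexp : mu.-integrable `[0%R, +oo[ (EFin \o halfexp).
Proof.
apply/integrableP; split.
  apply/measurable_EFinP; apply: measurable_funTS.
  by apply: continuous_measurable_fun; apply: continuous_halfexp.
under eq_integral do rewrite /= ger0_norm ?expR_ge0//.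
by rewrite integral_halfexp ltry.
Qed.

Lemma integrable_scale (f : R -> R) c : mu.-integrable `[0%R, +oo[ (EFin \o f) ->
  mu.-integrable `[0%R, +oo[ (EFin \o (fun x => c * f x)).
Proof.
move=> fi; rewrite (_ : _ \o _ = (fun x => c%:E * (EFin \o f) x)%E); last first.
  by apply/funext => x; rewrite /= EFinM.
exact: integrableZl.
Qed.

Lemma integrable_gden m : mu.-integrable `[0%R, +oo[ (EFin \o gden m).
Proof.
have mD : measurable (`[0%R, +oo[ : set R) by [].
apply: (@le_integrable _ _ _ mu _ mD (EFin \o gden m) (EFin \o (fun x => gden_bound m * halfexp x))).
- by apply/measurable_EFinP; apply: measurable_gden.
- move=> x; rewrite /= in_itv /= andbT => x0; rewrite lee_fin.
  rewrite !ger0_norm ?gden_ge0 ?gden_le // mulr_ge0 ?gden_bound_ge0 ?expR_ge0 //.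
- by apply: integrable_scale; exact: integrable_halfexp.
Qed.

Lemma half_factE m : half_fact m = \int[mu]_(x in `[0%R, +oo[) gden m x.
Proof.
rewrite /half_fact /real_fact /Gamma addrK -Rintegral_itv_obnd_cbnd; last first.
  apply: integrableS (integrable_gden m) => // x.
  by rewrite /= !in_itv /= !andbT => /ltW.
apply: eq_Rintegral => x; rewrite inE /= in_itv /= andbT => x0.
rewrite /gden; congr (_ * _).
by rewrite mulrC powRrM powR12_sqrt ?ltW // powR_mulrn ?sqrtr_ge0.
Qed.

Lemma RintegralZl_gden m c :
  \int[mu]_(x in `[0%R, +oo[) (c * gden m x) = c * half_fact m.
Proof. by rewrite RintegralZl ?half_factE //; exact: integrable_gden. Qed.

Lemma integrableZl_gden m c : mu.-integrable `[0%R, +oo[ (EFin \o (fun x => c * gden m x)).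
Proof. by apply: integrable_scale; exact: integrable_gden. Qed.

(** Integration by parts for Euler's integral. *)
Lemma half_factSS m : half_fact m.+2 = m.+2%:R / 2 * half_fact m.
Proof.
pose a : R := m.+2%:R / 2; have a0 : 0 <= a by rewrite divr_ge0.
(* The fundamental theorem on the half-line is applied to a nonnegative integrand. Adding [K]
   exp(-x/2), whose integral is 2 [K], makes the derivative of the boundary term nonnegative. *)
pose K := a * gden_bound m.
pose f x := (gden m.+2 x - a * gden m x) + K * halfexp x.
pose F x := - gden m.+2 x - 2 * K * halfexp x.
have iK : mu.-integrable `[0%R, +oo[ (EFin \o (fun x => K * halfexp x)).
  by apply: integrable_scale; exact: integrable_halfexp.
have cf : continuous f.
  move=> x; apply: (@continuousD _ _ _ (fun x => gden m.+2 x - a * gden m x)).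
    apply: (@continuousB _ _ _ (gden m.+2) (fun x => a * gden m x)).
      exact: continuous_gden.
    by apply: (@continuousM _ _ (cst a) (gden m)); [exact: cst_continuous|exact: continuous_gden].
  by apply: (@continuousM _ _ (cst K) halfexp); [exact: cst_continuous|exact: continuous_halfexp].
have cF : continuous F.
  move=> x; apply: (@continuousB _ _ _ (fun x => - gden m.+2 x) (fun x => 2 * K * halfexp x)).
    by apply: continuousN; exact: continuous_gden.
  by apply: (@continuousM _ _ (cst (2 * K)) halfexp); [exact: cst_continuous|exact: continuous_halfexp].
have dF x : 0 < x -> is_derive x 1 F (f x).
  move=> x0; have d1 := is_derive_gden m x0; have d2 := is_derive_halfexp x.
  by apply: is_derive_eq; rewrite /f /a /GRing.scale /=; field.
have : \int[mu]_(x in `[0%R, +oo[) f x = 0 - F 0.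
  apply: Rintegral_ge0_continuous_FTC2y.
  - move=> x x0; rewrite /f /K -addrA addr_ge0 ?gden_ge0 // addrC -mulrA -mulrBr.
    by rewrite mulr_ge0 // subr_ge0 gden_le.
  - by apply: continuous_subspaceT.
  - rewrite -[X in _ --> X](_ : - 0 - 2 * K * 0 = 0); last by rewrite mulr0 subr0 oppr0.
    apply: cvgB; first by apply: cvgN; exact: cvg_gden.
    by apply: cvgM; [exact: cvg_cst|exact: cvg_halfexp].
  - by move=> x x0; have [] := dF x x0.
  - by apply: cvg_at_right_filter; exact: cF.
  - move=> x; rewrite in_itv /= andbT => x0; rewrite derive1E; have [_ ->] := dF x x0; by [].
rewrite {1}/f RintegralD //=; last first.
  rewrite (_ : _ \o _ = (fun x => (gden m.+2 x)%:E - (a * gden m x)%:E)%E); last first.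
    by apply/funext => x /=; rewrite EFinB.
  by apply: integrableB => //; [exact: integrable_gden|exact: integrableZl_gden].
rewrite RintegralB //=; [|exact: integrable_gden|exact: integrableZl_gden].
rewrite RintegralZl_gden -half_factE RintegralZl //; last exact: integrable_halfexp.
have -> : F 0 = - 2 * K.
  by rewrite /F /gden /halfexp sqrtr0 expr0n /= !(mul0r, oppr0, expR0, mulr1); lra.
rewrite /Rintegral integral_halfexp /= -/a; lra.
Qed.

Lemma half_fact0 : half_fact 0 = 1.
Proof.
rewrite half_factE (_ : gden 0 = fun x => expR (- x)); last first.
  by apply/funext => x; rewrite /gden expr0 mul1r.
have ce : continuous (fun x : R => expR (- x)).
  by move=> x; apply: continuous_comp; [exact: continuousN|exact: continuous_expR].
have dF x : is_derive x 1 (fun x : R => - expR (- x)) (expR (- x)).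
  by apply: is_derive_eq; rewrite /GRing.scale /=; ring.
rewrite (@Rintegral_ge0_continuous_FTC2y _ _ (fun x : R => - expR (- x)) 0 0).
- by rewrite oppr0 expR0 sub0r opprK.
- by move=> x _; apply: expR_ge0.
- by apply: continuous_subspaceT.
- by rewrite -oppr0; apply: cvgN; exact: cvgr_expR.
- by move=> x _; have [] := dF x.
- by apply: cvg_at_right_filter; apply: cvgN; exact: ce.
- by move=> x _; rewrite derive1E; have [_ ->] := dF x.
Qed.

Lemma half_fact_ge0 m : 0 <= half_fact m.
Proof. by rewrite half_factE; apply: Rintegral_ge0 => x _; exact: gden_ge0. Qed.

(* The integral of x^(m/2) (l - x^(1/2))^2 exp(-x) is nonnegative for every l. *)
Lemma half_fact_log_convex m : half_fact m.+1 ^+ 2 <= half_fact m * half_fact m.+2.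
Proof.
have q l : 0 <= l ^+ 2 * half_fact m - 2 * l * half_fact m.+1 + half_fact m.+2.
  rewrite -!RintegralZl_gden [half_fact m.+2]half_factE -RintegralB //; [|exact: integrableZl_gden..].
  rewrite -RintegralD //; last 2 first.
  - rewrite (_ : _ \o _ = (fun x => (l ^+ 2 * gden m x)%:E - (2 * l * gden m.+1 x)%:E)%E); last first.
      by apply/funext => x /=; rewrite EFinB.
    by apply: integrableB => //; exact: integrableZl_gden.
  - exact: integrable_gden.
  apply: Rintegral_ge0 => x _.
  have -> : l ^+ 2 * gden m x - 2 * l * gden m.+1 x + gden m.+2 x = gden m x * (l - Num.sqrt x) ^+ 2.
    by rewrite /gden !exprS; ring.
  by rewrite mulr_ge0 ?gden_ge0 ?sqr_ge0.
move: (half_fact_ge0 m) (half_fact_ge0 m.+1) q.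
move: (half_fact m) (half_fact m.+1) (half_fact m.+2) => a b c a0 b0 q.
have [az|an] := eqVneq a 0.
  have [->|bn] := eqVneq b 0; first by rewrite az expr0n mul0r.
  have := q ((c + 1) / (2 * b)); rewrite az mulr0 add0r.
  have -> : 2 * ((c + 1) / (2 * b)) * b = c + 1 by field.
  lra.
have := q (b / a).
have -> : (b / a) ^+ 2 * a - 2 * (b / a) * b + c = c - b ^+ 2 / a by field.
by rewrite subr_ge0 ler_pdivrMr ?lt0r ?an // mulrC.
Qed.

(** Nonnegativity is clear, and (1/2)! cannot vanish, since log-convexity gives 1 = 1!^2 <= (1/2)!
    (3/2)!. The induction carries two consecutive values because the recursion goes by two. *)
Lemma half_fact_gt0 m : 0 < half_fact m.
Proof.
suff : 0 < half_fact m /\ 0 < half_fact m.+1 by case.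
have g2 : half_fact 2 = 1 by rewrite half_factSS half_fact0 mulr1 divff.
elim: m => [|m [IH1 IH2]].
  split; first by rewrite half_fact0.
  have := half_fact_log_convex 1; rewrite g2 expr1n; have := half_fact_ge0 1.
  by rewrite le_eqVlt => /predU1P [<-|//]; rewrite mul0r ler10.
by split => //; rewrite half_factSS mulr_gt0 // divr_gt0.
Qed.

End HalfIntegerFactorials.

(** * Asymptotics of the factorial moments *)

Section CentralBinomial.
Variable R : realType.
Implicit Types (n m k : nat).
Local Notation g1 := (half_fact R 1).

(** 4^n over the central binomial coefficient C(2n, n), asymptotic to the square root of pi n. *)
Definition wallis n : R := 4 ^+ n * n`!%:R ^+ 2 / n.*2`!%:R.

Lemma half_fact_even n : half_fact R n.*2 = n`!%:R.
Proof.
elim: n => [|n IH]; first by rewrite half_fact0.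
rewrite doubleS half_factSS IH factS natrM -doubleS -muln2 natrM.
by rewrite mulfK ?pnatr_eq0.
Qed.

Lemma half_fact_odd n : half_fact R n.*2.+1 = g1 * n.*2.+1`!%:R / (4 ^+ n * n`!%:R).
Proof.
elim: n => [|n IH]; first by rewrite expr0 !mul1r fact0 invr1 !mulr1.
have f0 : n`!%:R != 0 :> R by rewrite pnatr_eq0 -lt0n fact_gt0.
rewrite doubleS half_factSS IH exprS !(factS n.*2.+2) !(factS n.*2.+1) !(factS n) !natrM.
have e : n.*2.+2%:R = 2 * n.+1%:R :> R by rewrite -doubleS -muln2 natrM mulrC.
have p4 : 4 ^+ n != 0 :> R by rewrite expf_neq0 ?pnatr_eq0.
have n1 : n.+1%:R != 0 :> R by rewrite pnatr_eq0.
by rewrite e; field; rewrite ?f0 ?p4 addrC natr1 n1.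
Qed.

Lemma wallis_gt0 n : 0 < wallis n.
Proof. by rewrite divr_gt0 ?mulr_gt0 ?exprn_gt0 ?ltr0n ?fact_gt0. Qed.

Lemma wallisE n : wallis n * half_fact R n.*2.+1 = g1 * n.*2.+1%:R * n`!%:R.
Proof.
have f0 m : m`!%:R != 0 :> R by rewrite pnatr_eq0 -lt0n fact_gt0.
have p4 : 4 ^+ n != 0 :> R by rewrite expf_neq0 ?pnatr_eq0.
by rewrite half_fact_odd /wallis factS natrM; field; rewrite ?f0 ?p4.
Qed.

(** Log-convexity at n + 1/2 and at n + 1 compares (n + 1/2)! with the neighbouring factorials. The
    constant 4 (1/2)!^2 is pi. *)
Lemma wallis_bounds n :
  4 * g1 ^+ 2 * n%:R <= wallis n ^+ 2 <= 4 * g1 ^+ 2 * (n%:R + 2^-1).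
Proof.
have f0 : 0 < n`!%:R :> R by rewrite ltr0n fact_gt0.
have g0 := half_fact_gt0 R 1; have w0 := wallis_gt0 n.
have := half_fact_log_convex R n.*2; have := half_fact_log_convex R n.*2.+1.
have h0 := half_fact_gt0 R n.*2.+1; have := wallisE n.
rewrite !half_factSS -doubleS half_fact_even -[n.+1.*2]muln2 natrM.
have -> : n.*2.+1%:R = 2 * n%:R + 1 :> R by rewrite -natr1 -muln2 natrM mulrC.
have -> : (n.+1 * 2).+1%:R = 2 * n%:R + 3 :> R.
  by rewrite mulSn -natr1 natrD natrM; ring.
rewrite -[n.+1%:R]natr1; have n0 : 0 <= n%:R :> R by [].
move: f0 g0 w0 h0 n0.
move: (half_fact R n.*2.+1) (wallis n) (half_fact R 1) (n`!%:R : R) (n%:R : R) => h w g f x.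
move=> f0 g0 w0 h0 x0 wh I II.
have f2 : 0 < f ^+ 2 by rewrite exprn_gt0.
have wh2 : w ^+ 2 * h ^+ 2 = g ^+ 2 * (2 * x + 1) ^+ 2 * f ^+ 2 by rewrite -exprMn wh; ring.
have gg : 0 < g ^+ 2 by rewrite exprn_gt0.
have ww : 0 < w ^+ 2 by rewrite exprn_gt0.
apply/andP; split.
  rewrite -(ler_pM2r (_ : 0 < f ^+ 2 * (x + 1))); last by rewrite mulr_gt0 // ltr_wpDl.
  have := ler_wpM2l (ltW ww) II; rewrite wh2 => h1.
  have h2 : 0 <= g ^+ 2 * f ^+ 2 by rewrite ltW // mulr_gt0.
  suff : 4 * g ^+ 2 * x * (f ^+ 2 * (x + 1)) <= g ^+ 2 * (2 * x + 1) ^+ 2 * f ^+ 2.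
    move/le_trans; apply; apply: le_trans h1 _; rewrite le_eqVlt; apply/orP; left; apply/eqP; by field.
  by rewrite -subr_ge0; apply: le_trans h2 _; rewrite le_eqVlt; apply/orP; left; apply/eqP; ring.
rewrite -(ler_pM2r (_ : 0 < f ^+ 2 * (x + 1) ^+ 2)); last by rewrite mulr_gt0 // exprn_gt0 // ltr_wpDl.
have := ler_wpM2l (ltW ww) I.
have -> : w ^+ 2 * (h * ((2 * x + 3) / 2 * h)) = w ^+ 2 * h ^+ 2 * ((2 * x + 3) / 2) by ring.
rewrite wh2 => h1.
have h2 : 0 <= g ^+ 2 * f ^+ 2 * (x + 2^-1).
  by rewrite mulr_ge0 ?(ltW (mulr_gt0 _ _)) // addr_ge0 // invr_ge0.
suff : g ^+ 2 * (2 * x + 1) ^+ 2 * f ^+ 2 * ((2 * x + 3) / 2) <=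
    4 * g ^+ 2 * (x + 2^-1) * (f ^+ 2 * (x + 1) ^+ 2).
  apply: le_trans; apply: le_trans h1; rewrite le_eqVlt; apply/orP; left; apply/eqP; by field.
by rewrite -subr_ge0; apply: le_trans h2 _; rewrite le_eqVlt; apply/orP; left; apply/eqP; by field.
Qed.

End CentralBinomial.

(** * The first moment and its scale *)

Section FixAsymptotics.
Variable R : realType.
Implicit Types (n m k q : nat) (eps : R).
Local Notation g1 := (half_fact R 1).
Local Notation sq n := (Num.sqrt (n%:R : R)).

Definition fixmean q n k : R := fixbin R q n k / fixbin R 0 n k.
(** This is n t^3 / (1 - t) for t = k / n, cleared of inner fractions. *)
Definition fixscale n k : R := k%:R ^+ 3 / (n%:R * (n%:R - k%:R)).

Lemma bin_factR n m : 'C(n + m, n)%:R = (n + m)`!%:R / (n`!%:R * m`!%:R) :> R.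
Proof.
have f0 k : k`!%:R != 0 :> R by rewrite pnatr_eq0 -lt0n fact_gt0.
have := bin_fact (leq_addr m n); rewrite addKn => <-.
by rewrite !natrM mulfK // mulf_neq0.
Qed.

(** For k + 1 ones among n = k + 1 + m letters, splitting 2n as (2k + 1) + (2m + 1) turns the
    quotient C(2n, 2k + 1) / (2 C(n, k + 1)^2) into three Wallis ratios. *)
Lemma fixmean1 m k : fixmean 1 (k.+1 + m) k.+1 =
  k.+1%:R / (2 * m%:R + 1) * (wallis R k.+1 * wallis R m / wallis R (k.+1 + m)).
Proof.
have f0 i : i`!%:R != 0 :> R by rewrite pnatr_eq0 -lt0n fact_gt0.
have p0 i : 4 ^+ i != 0 :> R by rewrite expf_neq0 ?pnatr_eq0.
rewrite /fixmean fixbin1 fixbin0 /bin2 natrX bin_factR.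
have -> : ((k.+1 + m).*2 = k.*2.+1 + m.*2.+1)%N by lia.
rewrite bin_factR /wallis.
have -> : (k.*2.+1 + m.*2.+1)%N = (k.+1 + m).*2 by lia.
have e1 : k.+1.*2`!%:R = 2 * k.+1%:R * k.*2.+1`!%:R :> R.
  by rewrite doubleS factS natrM -doubleS -muln2 natrM mulrC [2 * _]mulrC mulrC.
have e2 : m.*2.+1`!%:R = (2 * m%:R + 1) * m.*2`!%:R :> R.
  by rewrite factS natrM -natr1 -muln2 natrM [2 * _]mulrC.
have n1 : k.+1%:R != 0 :> R by rewrite pnatr_eq0.
have n2 : 2 * m%:R + 1 != 0 :> R by rewrite gt_eqF // ltr_wpDl // mulr_ge0.
have n3 : 1 + k%:R != 0 :> R by rewrite addrC natr1.
by rewrite e1 e2 [4 ^+ (_ + _)]exprD; field; rewrite !f0 !p0 n2 n3.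
Qed.

Lemma sqr_dist_le (a b c d : R) : 0 <= a -> 0 < c -> c <= b ->
  `|a ^+ 2 - b ^+ 2| <= d -> `|a - b| <= d / c.
Proof.
move=> a0 c0 cb h; rewrite ler_pdivlMr //; apply: le_trans h.
rewrite subr_sqr normrM ler_wpM2l // ger0_norm; last by rewrite addr_ge0 // (le_trans (ltW c0)).
by rewrite (le_trans cb) // lerDr.
Qed.

Lemma powdiff_le (a b M : R) q : 0 <= a -> 0 <= b -> a <= M -> b <= M ->
  `|a ^+ q - b ^+ q| <= q%:R * M ^+ q.-1 * `|a - b|.
Proof.
move=> a0 b0 aM bM; case: q => [|q]; first by rewrite !expr0 subrr normr0 !mul0r.
rewrite subrXX normrM mulrC ler_wpM2r //.
apply: le_trans (ler_norm_sum _ _ _) _.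
have -> : q.+1%:R * M ^+ q = \sum_(i < q.+1) M ^+ q by rewrite sumr_const card_ord mulr_natl.
apply: ler_sum => i _; rewrite normrM !ger0_norm ?exprn_ge0 //.
have -> : M ^+ q = M ^+ (q - i) * M ^+ i by rewrite -exprD subnK // -ltnS.
by apply: ler_pM; rewrite ?exprn_ge0 // lerXn2r // nnegrE ?(le_trans a0) ?(le_trans b0).
Qed.

(** Here x = k, y = n - k, z = n, with Wallis ratios [A], [B], [C], and [G] = (1/2)!^2. The Wallis
    bounds have relative errors of order 1/x, 1/y and 1/z; multiplied by x^3 / (z y) these stay
    bounded, because x <= z and eps z <= y. *)
Lemma fixmean1_real_bound eps (A B C x y z G : R) : 0 < eps -> 0 < G -> 0 < z ->
  eps * z <= y -> z = x + y -> 0 < x -> 0 < y ->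
  4 * G * x <= A ^+ 2 -> A ^+ 2 <= 4 * G * (x + 2^-1) ->
  4 * G * y <= B ^+ 2 -> B ^+ 2 <= 4 * G * (y + 2^-1) ->
  4 * G * z <= C ^+ 2 -> C ^+ 2 <= 4 * G * (z + 2^-1) ->
  0 < A -> 0 < B -> 0 < C ->
  `|(x / (2 * y + 1) * (A * B / C)) ^+ 2 - G * (x ^+ 3 / (z * y))| <= G * (eps^-1 + eps^-1 ^+ 2).
Proof.
move=> e0 G0 z0 yl zxy x0 y0 a1 a2 b1 b2 c1 c2 A0 B0 C0.
have xz : x <= z by rewrite zxy lerDl ltW.
have u0 : 0 <= x / z <= 1 by rewrite divr_ge0 ?(ltW x0) ?(ltW z0) //= ler_pdivrMr // mul1r.
have v1 : z / y <= eps^-1 by rewrite ler_pdivrMr // ler_pdivlMl.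
have v0 : 0 <= z / y by rewrite divr_ge0 ?(ltW z0) ?(ltW y0).
have ui i : (x / z) ^+ i <= 1 by case/andP: u0 => *; rewrite exprn_ile1.
have ei : 0 <= eps^-1 by rewrite invr_ge0 ltW.
have t1 : x ^+ 2 / (y * z) <= eps^-1.
  have -> : x ^+ 2 / (y * z) = (x / z) ^+ 2 * (z / y) by field; rewrite !gt_eqF.
  by apply: le_trans v1; rewrite ler_piMl.
have t2 : x ^+ 3 / (z ^+ 2 * y) <= eps^-1.
  have -> : x ^+ 3 / (z ^+ 2 * y) = (x / z) ^+ 3 * (z / y) by field; rewrite !gt_eqF.
  by apply: le_trans v1; rewrite ler_piMl.
have t3 : x ^+ 3 / (z * y ^+ 2) <= eps^-1 ^+ 2.
  have -> : x ^+ 3 / (z * y ^+ 2) = (x / z) ^+ 3 * (z / y) ^+ 2 by field; rewrite !gt_eqF.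
  apply: (@le_trans _ _ ((z / y) ^+ 2)); first by rewrite ler_piMl ?sqr_ge0.
  by rewrite lerXn2r.
have e1 : (x / (2 * y + 1) * (A * B / C)) ^+ 2 = x ^+ 2 / (2 * y + 1) ^+ 2 * (A ^+ 2 * B ^+ 2 / C ^+ 2).
  by rewrite exprMn !expr_div_n exprMn.
have C2 : 0 < C ^+ 2 by rewrite exprn_gt0.
have h0 : 0 <= x ^+ 2 / (2 * y + 1) ^+ 2 by rewrite divr_ge0 ?sqr_ge0.
have A2 := sqr_ge0 A; have B2 := sqr_ge0 B.
have AB : 0 <= A ^+ 2 * B ^+ 2 by rewrite mulr_ge0.
have Ci : 0 <= (C ^+ 2)^-1 by rewrite invr_ge0 ltW.
have zh : 0 < z + 2^-1 by lra.
have yh : 0 < y + 2^-1 by lra.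
have Gz : 0 < 4 * G * (z + 2^-1) by rewrite !mulr_gt0.
have up : (x / (2 * y + 1) * (A * B / C)) ^+ 2 <= G * (x ^+ 2 * (x + 2^-1) / ((y + 2^-1) * z)).
  rewrite e1; apply: (@le_trans _ _ (x ^+ 2 / (2 * y + 1) ^+ 2 *
    (4 * G * (x + 2^-1) * (4 * G * (y + 2^-1)) / (4 * G * z)))).
    apply: ler_wpM2l => //; apply: ler_pM => //; first by apply: ler_pM.
    by rewrite lef_pV2 // ?posrE ?mulr_gt0.
  rewrite le_eqVlt; apply/orP; left; apply/eqP; field.
  by rewrite !gt_eqF //; lra.
have lo : G * (x ^+ 3 * y / ((y + 2^-1) ^+ 2 * (z + 2^-1))) <= (x / (2 * y + 1) * (A * B / C)) ^+ 2.
  rewrite e1; apply: (@le_trans _ _ (x ^+ 2 / (2 * y + 1) ^+ 2 *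
    (4 * G * x * (4 * G * y) / (4 * G * (z + 2^-1))))); last first.
    apply: ler_wpM2l => //; apply: ler_pM => //.
    - by rewrite !mulr_ge0 // ltW.
    - by rewrite invr_ge0 ltW.
    - by apply: ler_pM => //; rewrite !mulr_ge0 // ltW.
    - by rewrite lef_pV2 // ?posrE.
  rewrite le_eqVlt; apply/orP; left; apply/eqP; field.
  by rewrite !gt_eqF //; lra.
have u2 : G * (x ^+ 2 * (x + 2^-1) / ((y + 2^-1) * z)) <= G * (x ^+ 3 / (z * y) + x ^+ 2 / (y * z)).
  rewrite ler_pM2l //.
  have -> : x ^+ 3 / (z * y) + x ^+ 2 / (y * z) = x ^+ 2 * (x + 1) / (y * z) by field; rewrite !gt_eqF.
  apply: ler_pM.
  - by rewrite mulr_ge0 ?sqr_ge0 //; lra.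
  - by rewrite invr_ge0 mulr_ge0 ?(ltW z0) ?(ltW yh).
  - by rewrite ler_wpM2l ?sqr_ge0 // lerD2l; lra.
  rewrite lef_pV2 ?posrE ?mulr_gt0 // ler_wpM2r ?(ltW z0) //; lra.
have l2 : G * (x ^+ 3 / (z * y) - x ^+ 3 / (z ^+ 2 * y) - x ^+ 3 / (z * y ^+ 2)) <=
  G * (x ^+ 3 * y / ((y + 2^-1) ^+ 2 * (z + 2^-1))).
  rewrite ler_pM2l //.
  have -> : x ^+ 3 / (z * y) - x ^+ 3 / (z ^+ 2 * y) - x ^+ 3 / (z * y ^+ 2) =
     x ^+ 3 * ((z * y - z - y) / (z ^+ 2 * y ^+ 2)) by field; rewrite !gt_eqF.
  rewrite -mulrA ler_pM2l ?exprn_gt0 //.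
  rewrite ler_pdivrMr ?mulr_gt0 ?exprn_gt0 // mulrAC ler_pdivlMr ?mulr_gt0 ?exprn_gt0 //.
  rewrite -subr_ge0.
  have -> : y * (z ^+ 2 * y ^+ 2) - (z * y - z - y) * ((y + 2^-1) ^+ 2 * (z + 2^-1)) =
    (1 / 2) * y ^+ 3 * z ^+ 1 + (1 / 1) * y ^+ 2 * z ^+ 1 + (3 / 4) * y ^+ 1 * z ^+ 2 + (5 / 8) * y ^+ 1 * z ^+ 1 + (1 / 4) * y ^+ 0 * z ^+ 2 + (1 / 8) * y ^+ 0 * z ^+ 1 + (1 / 2) * y ^+ 3 * z ^+ 0 + (1 / 2) * y ^+ 2 * z ^+ 0 + (1 / 8) * y ^+ 1 * z ^+ 0.
    by field.
  have p a b : 0 <= y ^+ a * z ^+ b by rewrite mulr_ge0 ?exprn_ge0 ?(ltW y0) ?(ltW z0).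
  by rewrite !addr_ge0 //; rewrite -mulrA; apply: mulr_ge0; rewrite ?divr_ge0.
rewrite ler_norml; apply/andP; split.
  have : G * (x ^+ 3 / (z ^+ 2 * y) + x ^+ 3 / (z * y ^+ 2)) <= G * (eps^-1 + eps^-1 ^+ 2).
    by rewrite ler_pM2l // lerD.
  move: lo l2; lra.
have : G * (x ^+ 2 / (y * z)) <= G * (eps^-1 + eps^-1 ^+ 2).
  by rewrite ler_pM2l // (le_trans t1) // lerDl sqr_ge0.
move: up u2; lra.
Qed.

Lemma fixmean1_sqr eps n k : 0 < eps -> (0 < n)%N ->
  eps * n%:R <= k%:R -> k%:R <= (1 - eps) * n%:R ->
  `|fixmean 1 n k ^+ 2 - g1 ^+ 2 * fixscale n k| <= g1 ^+ 2 * (eps^-1 + eps^-1 ^+ 2).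
Proof.
move=> e0 n0 kl ku.
have N0 : 0 < n%:R :> R by rewrite ltr0n.
have en : 0 < eps * n%:R by rewrite mulr_gt0.
have k0 : (0 < k)%N by rewrite -(ltr0n R) (lt_le_trans en).
have kn : (k <= n)%N.
  by rewrite -(ler_nat R); apply: le_trans ku _; rewrite ler_piMl ?ltW //; lra.
pose m := (n - k)%N; have nE : n = (k + m)%N by rewrite /m subnKC.
have mE : m%:R = n%:R - k%:R :> R by rewrite /m natrB.
have ml : eps * n%:R <= m%:R by rewrite mE; lra.
rewrite /fixscale -mE; case: k k0 kl ku kn @m nE mE ml => // k k0 kl ku kn m nE mE ml.
rewrite {1}nE fixmean1 -nE.
have /andP[a1 a2] := wallis_bounds R k.+1.
have /andP[b1 b2] := wallis_bounds R m.
have /andP[c1 c2] := wallis_bounds R n.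
have G0 : 0 < g1 ^+ 2 by rewrite exprn_gt0 ?half_fact_gt0.
have wn := wallis_gt0 R n.
have nxy : n%:R = k.+1%:R + m%:R :> R by rewrite -natrD -nE.
have x0 : 0 < k.+1%:R :> R by rewrite ltr0n.
have y0 : 0 < m%:R :> R := lt_le_trans en ml.
move: a1 a2 b1 b2 c1 c2 (wallis_gt0 R k.+1) (wallis_gt0 R m) wn.
move: (wallis R k.+1) (wallis R m) (wallis R n) (k.+1%:R : R) (m%:R : R) (n%:R : R) (g1 ^+ 2)
  G0 N0 en kl ml nxy x0 y0 => A B C x y z G G0 z0 ez xl yl zxy x0 y0 a1 a2 b1 b2 c1 c2 A0 B0 C0.
exact: fixmean1_real_bound.
Qed.

Definition fixapprox q n k : R :=
  half_fact R q / q`!%:R * Num.sqrt (fixscale n k) ^+ q.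

(** The quantifier over [eps] is inside because the recursion visits neighbours of (n, k) that may
    leave the range of [eps] but stay in that of [eps / 2]. *)
Definition fix_asymptotic q := forall eps, 0 < eps -> exists C : R, exists n0 : nat,
  forall n k, (n0 < n)%N -> eps * n%:R <= k%:R -> k%:R <= (1 - eps) * n%:R ->
  `|fixmean q n k - fixapprox q n k| <= C * (sq n ^+ q / sq n).

Lemma fixscale_ge eps n k : 0 < eps -> (0 < n)%N ->
  eps * n%:R <= k%:R -> k%:R <= (1 - eps) * n%:R ->
  eps ^+ 3 * n%:R <= fixscale n k <= eps^-1 * n%:R.
Proof.
move=> e0 n0 kl ku.
have N0 : 0 < n%:R :> R by rewrite ltr0n.
have en : 0 < eps * n%:R by rewrite mulr_gt0.
have y0 : eps * n%:R <= n%:R - k%:R by lra.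
have y1 : 0 < n%:R - k%:R :> R := lt_le_trans en y0.
have k0 : 0 < k%:R :> R := lt_le_trans en kl.
have kn : k%:R <= n%:R :> R by lra.
rewrite /fixscale ler_pdivlMr ?mulr_gt0 // ler_pdivrMr ?mulr_gt0 //; apply/andP; split.
  apply: (@le_trans _ _ ((eps * n%:R) ^+ 3)); last by rewrite lerXn2r // nnegrE ltW.
  have -> : (eps * n%:R) ^+ 3 = eps ^+ 3 * n%:R * (n%:R * n%:R) by ring.
  rewrite ler_wpM2l ?mulr_ge0 ?exprn_ge0 ?(ltW e0) // ler_wpM2l //; lra.
apply: (@le_trans _ _ (n%:R ^+ 3)); first by rewrite lerXn2r ?nnegrE // ltW.
have -> : n%:R ^+ 3 = eps^-1 * n%:R * (n%:R * (eps * n%:R)) by field; rewrite gt_eqF.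
by rewrite ler_wpM2l ?mulr_ge0 ?invr_ge0 ?(ltW e0) // ler_wpM2l.
Qed.

Lemma fixmean_ge0 q n k : 0 <= fixmean q n k.
Proof.
rewrite divr_ge0 // /fixbin.
  by apply: wsum_ge0 => v _; apply: wsum_ge0 => w _.
by apply: wsum_ge0 => v _; apply: wsum_ge0 => w _.
Qed.

Lemma fix_asymptotic0 : fix_asymptotic 0.
Proof.
move=> eps e0; exists 1, 0%N => n k n0 kl ku.
have kn : (k <= n)%N.
  by rewrite -(ler_nat R); apply: le_trans ku _; rewrite ler_piMl //; lra.
rewrite /fixmean /fixapprox fixbin0 divff ?half_fact0 ?fact0 ?invr1 ?mulr1 ?expr0 ?mulr1.
  by rewrite subrr normr0 mulr_ge0 // mulr_ge0 ?invr_ge0 ?sqrtr_ge0 // exprn_ge0 ?sqrtr_ge0.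
by rewrite pnatr_eq0 expn_eq0 andbT -lt0n bin_gt0 kn.
Qed.

Lemma fix_asymptotic1 : fix_asymptotic 1.
Proof.
move=> eps e0; exists (g1 ^+ 2 * (eps^-1 + eps^-1 ^+ 2) / (g1 * Num.sqrt (eps ^+ 3))), 0%N => n k n0 kl ku.
have sn : 0 < sq n by rewrite sqrtr_gt0 ltr0n.
rewrite expr1 divff ?mulr1 ?gt_eqF // /fixapprox (_ : 1`! = 1)%N // expr1 divr1.
have g0 := half_fact_gt0 R 1; have e3 : 0 < Num.sqrt (eps ^+ 3) by rewrite sqrtr_gt0 exprn_gt0.
have /andP[h1 h2] := fixscale_ge e0 n0 kl ku.
have L0 : 0 <= fixscale n k.
  by apply: le_trans h1; rewrite mulr_ge0 // exprn_ge0 // ltW.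
apply: sqr_dist_le; rewrite ?fixmean_ge0 ?mulr_gt0 //.
  rewrite ler_wpM2l ?(ltW g0) // ler_wsqrtr //; apply: le_trans h1.
  by rewrite ler_peMr ?exprn_ge0 ?(ltW e0) // ler1n.
by rewrite (exprMn _ g1) sqr_sqrtr //; apply: fixmean1_sqr.
Qed.

(** The scale is homogeneous of degree 1 in (n, k), so the shifts by at most 1 in n and 2 in k that
    occur in the recursion move it by a bounded amount. *)
Lemma fixscale_shift eps n k n' k' (c := eps ^+ 3) : 0 < eps -> (0 < n)%N -> (0 < n')%N ->
  eps * n%:R <= k%:R -> k%:R <= (1 - eps) * n%:R ->
  eps * n'%:R <= k'%:R -> k'%:R <= (1 - eps) * n'%:R ->
  (n' <= n)%N -> (n <= n'.+1)%N -> (k' <= k)%N -> (k <= k'.+2)%N ->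
  `|fixscale n k - fixscale n' k'| <= 36 / eps ^+ 2.
Proof.
move=> e0 n0 n0' kl ku kl' ku' nn nn' kk kk'.
have N0 : 0 < n%:R :> R by rewrite ltr0n.
have N0' : 0 < n'%:R :> R by rewrite ltr0n.
have y0 : eps * n%:R <= n%:R - k%:R by lra.
have y0' : eps * n'%:R <= n'%:R - k'%:R by lra.
have y1 : 0 < n%:R - k%:R :> R by apply: lt_le_trans y0; rewrite mulr_gt0.
have y1' : 0 < n'%:R - k'%:R :> R by apply: lt_le_trans y0'; rewrite mulr_gt0.
have n2 : n%:R <= 2 * n'%:R :> R by rewrite -natrM ler_nat; lia.
have k0 : 0 <= k%:R :> R by []. have k0' : 0 <= k'%:R :> R by [].
have kn : k%:R <= n%:R :> R by lra.
move: nn nn' kk kk'; rewrite -!(ler_nat R) -[n'.+1%:R]natr1 -[k'.+2%:R]natr1 -[k'.+1%:R]natr1 /fixscale => nn nn' kk kk'.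
set x := k%:R : R; set x' := k'%:R : R; set z := n%:R : R; set z' := n'%:R : R.
set y := z - x; set y' := z' - x'.
have -> : x ^+ 3 / (z * y) - x' ^+ 3 / (z' * y') =
   ((x - x') * (x ^+ 2 + x * x' + x' ^+ 2) * (z * y) - x ^+ 3 * ((z - z') * y + z' * (y - y'))) / (z * y * (z' * y')).
  by field; rewrite !gt_eqF.
have xx : 0 <= x' <= x by rewrite k0'.
have yz : 0 <= y <= z by rewrite (ltW y1) /y; lra.
have dx : `|x - x'| <= 2 by rewrite ler_norml; lra.
have dz : `|z - z'| <= 1 by rewrite ler_norml; lra.
have dy : `|y - y'| <= 2 by rewrite ler_norml /y /y'; lra.
have z2 : x ^+ 2 + x * x' + x' ^+ 2 <= 3 * z ^+ 2 by nra.
have z20 : 0 <= x ^+ 2 + x * x' + x' ^+ 2 by nra.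
rewrite normrM normfV (ger0_norm (_ : 0 <= z * y * (z' * y'))); last first.
  by rewrite !mulr_ge0 // ltW.
rewrite ler_pdivrMr; last by rewrite !mulr_gt0.
apply: (@le_trans _ _ (9 * z ^+ 4)).
  apply: le_trans (ler_normB _ _) _.
  have -> : 9 * z ^+ 4 = 2 * (3 * z ^+ 2) * (z * z) + z ^+ 3 * (1 * z + z * 2) by ring.
  apply: lerD.
    rewrite normrM; apply: ler_pM => //.
      rewrite normrM; apply: ler_pM => //.
      by rewrite ger0_norm.
    rewrite ger0_norm; last by rewrite mulr_ge0 ?(ltW N0) // (ltW y1).
    by rewrite ler_wpM2l ?(ltW N0) //; case/andP: yz.
  rewrite normrM ger0_norm ?exprn_ge0 //; apply: ler_pM; rewrite ?exprn_ge0 //.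
    by rewrite lerXn2r // nnegrE ltW.
  apply: le_trans (ler_normD _ _) _; apply: lerD; rewrite normrM; apply: ler_pM => //.
    by rewrite ger0_norm ?(ltW y1) //; case/andP: yz.
  by rewrite ger0_norm // ltW.
have yy : eps * z * (eps * z') <= y * y'.
  by apply: ler_pM; rewrite ?mulr_ge0 // ltW.
have -> : 36 / eps ^+ 2 * (z * y * (z' * y')) = 36 / eps ^+ 2 * (z * z') * (y * y') by ring.
apply: (@le_trans _ _ (36 / eps ^+ 2 * (z * z') * (eps * z * (eps * z')))); last first.
  by rewrite ler_wpM2l // !mulr_ge0 ?invr_ge0 ?sqr_ge0 ?(ltW N0) ?(ltW N0').
have -> : 36 / eps ^+ 2 * (z * z') * (eps * z * (eps * z')) = 9 * (z ^+ 2 * (2 * z') ^+ 2).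
  by field; rewrite gt_eqF.
rewrite ler_pM2l //; have -> : z ^+ 4 = z ^+ 2 * z ^+ 2 by ring.
by rewrite ler_pM2l ?exprn_gt0 // lerXn2r // nnegrE ?(ltW N0) // mulr_ge0 // ltW.
Qed.

End FixAsymptotics.

(** * Induction on the order of the moments *)

Section FixAsymptoticStep.
Variable R : realType.
Implicit Types (n m k q : nat) (eps : R).
Local Notation sq n := (Num.sqrt (n%:R : R)).
Local Notation fmean := (fixmean R).

Lemma sq_ge1 n : (0 < n)%N -> 1 <= sq n.
Proof. by move=> n0; rewrite -[leLHS]sqrtr1 ler_wsqrtr // ler1n. Qed.

Lemma fixscale_pow_shift eps q : 0 < eps -> exists2 D : R, 0 <= D & forall n k n' k',
  (0 < n)%N -> (0 < n')%N ->
  eps * n%:R <= k%:R -> k%:R <= (1 - eps) * n%:R ->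
  eps * n'%:R <= k'%:R -> k'%:R <= (1 - eps) * n'%:R ->
  (n' <= n)%N -> (n <= n'.+1)%N -> (k' <= k)%N -> (k <= k'.+2)%N ->
  `|Num.sqrt (fixscale R n k) ^+ q - Num.sqrt (fixscale R n' k') ^+ q| <= D * (sq n ^+ q / sq n).
Proof.
move=> e0; pose A : R := Num.sqrt (eps^-1).
pose B : R := 36 / eps ^+ 2 / Num.sqrt (eps ^+ 3).
have A0 : 0 <= A by apply: sqrtr_ge0.
have B0 : 0 <= B by rewrite /B !divr_ge0 ?exprn_ge0 ?sqrtr_ge0 ?(ltW e0).
exists (q%:R * A ^+ q.-1 * B); first by apply: mulr_ge0 => //; apply: mulr_ge0 => //; exact: exprn_ge0.
move=> n k n' k' n0 n0' kl ku kl' ku' nn nn' kk kk'.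
have s1 := sq_ge1 n0; have s0 : 0 < sq n := lt_le_trans ltr01 s1.
have e3 : 0 < Num.sqrt (eps ^+ 3) by rewrite sqrtr_gt0 exprn_gt0.
have ei : 0 <= eps^-1 by rewrite invr_ge0 ltW.
have /andP[h1 h2] := fixscale_ge e0 n0 kl ku.
have /andP[h1' h2'] := fixscale_ge e0 n0' kl' ku'.
have L0 : 0 <= fixscale R n k by apply: le_trans h1; rewrite mulr_ge0 // exprn_ge0 // ltW.
have L0' : 0 <= fixscale R n' k' by apply: le_trans h1'; rewrite mulr_ge0 // exprn_ge0 // ltW.
have le1 : Num.sqrt (fixscale R n k) <= A * sq n.
  by rewrite -sqrtrM // ler_wsqrtr.
have le2 : Num.sqrt (fixscale R n' k') <= A * sq n.
  rewrite -sqrtrM // ler_wsqrtr //; apply: le_trans h2' _.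
  by rewrite ler_wpM2l // ler_nat.
have d : `|Num.sqrt (fixscale R n' k') - Num.sqrt (fixscale R n k)| <= B / sq n.
  have -> : B / sq n = 36 / eps ^+ 2 / (Num.sqrt (eps ^+ 3) * sq n) by rewrite /B -[LHS]mulrA -invfM.
  apply: sqr_dist_le.
  - exact: sqrtr_ge0.
  - by rewrite mulr_gt0.
  - by rewrite -sqrtrM ?exprn_ge0 ?(ltW e0) // ler_wsqrtr.
  by rewrite !sqr_sqrtr // distrC; apply: fixscale_shift.
rewrite distrC; apply: le_trans (powdiff_le _ _ _ le2 le1) _; rewrite ?sqrtr_ge0 //.
case: q => [|q]; first by rewrite !mul0r.
rewrite /= exprMn.
apply: (@le_trans _ _ (q.+1%:R * (A ^+ q * sq n ^+ q) * (B / sq n))).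
  by rewrite ler_wpM2l // !mulr_ge0 ?exprn_ge0 ?sqrtr_ge0.
have -> : q.+1%:R * (A ^+ q * sq n ^+ q) * (B / sq n) = q.+1%:R * A ^+ q * B * (sq n ^+ q / sq n) by ring.
apply: ler_wpM2l; first by apply: mulr_ge0 => //; apply: mulr_ge0 => //; exact: exprn_ge0.
by rewrite ler_wpM2r ?invr_ge0 ?sqrtr_ge0 // exprS ler_peMl ?exprn_ge0 ?sqrtr_ge0.
Qed.

(** Error propagation in one term of the recursion: a ratio known up to O(1/n) times a moment known
    up to O(S), whose main part is O(s S) with s <= n. Multiplied by n, the error is O(n S). *)
Lemma mul_approx_le (r rho E P S a b p C s nn : R) : 0 < nn -> 0 <= a -> 0 <= C -> 0 <= S -> 0 <= p ->
   1 <= nn -> s <= nn -> 0 <= s ->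
  `|r - rho| <= a / nn -> `|rho| <= b -> `|E - P| <= C * S -> `|P| <= p * (s * S) ->
  `|nn * (r * E) - nn * (rho * P)| <= (a * C + a * p + b * C) * (nn * S).
Proof.
move=> n0 a0 C0 S0 p0 n1 sn s0 hr hrho hE hP.
have -> : nn * (r * E) - nn * (rho * P) =
  nn * (r - rho) * (E - P) + nn * (r - rho) * P + nn * rho * (E - P) by ring.
have hr' : `|nn * (r - rho)| <= a.
  by rewrite normrM gtr0_norm // mulrC -ler_pdivlMr.
apply: le_trans (ler_normD _ _) _.
have t3 : `|nn * rho * (E - P)| <= nn * b * (C * S).
  by rewrite normrM ler_pM // normrM gtr0_norm // ler_wpM2l // ltW.
have t12 : `|nn * (r - rho) * (E - P) + nn * (r - rho) * P| <= a * (C * S) + a * (p * (s * S)).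
  by apply: le_trans (ler_normD _ _) _; apply: lerD; rewrite normrM ler_pM.
apply: le_trans (lerD t12 t3) _.
have q1 : a * (C * S) <= a * C * (nn * S).
  by rewrite mulrA ler_wpM2l ?mulr_ge0 // ler_peMl.
have q2 : a * (p * (s * S)) <= a * p * (nn * S).
  by rewrite mulrA ler_wpM2l ?mulr_ge0 // ler_wpM2r.
have q3 : nn * b * (C * S) = b * C * (nn * S) by ring.
by rewrite q3 !mulrDl lerD // lerD.
Qed.

(** The recursion divided by C(n + 1, k + 2)^2; neighbouring binomial coefficients supply the
    squared ratios. *)
Lemma fixmean_rec q n k : (k < n)%N ->
  4 * q.+1%:R * fmean q.+2 n.+1 k.+2 =
  (n.+1%:R - q%:R) * ((k.+2%:R / (n%:R - k%:R)) ^+ 2 * fmean q n.+1 k.+1) -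
  n.+1%:R * ((k.+2%:R / n.+1%:R) ^+ 2 * fmean q n k.+1) -
  n.+1%:R * ((k.+2%:R / n.+1%:R * (k.+1%:R / (n%:R - k%:R))) ^+ 2 * fmean q n k).
Proof.
move=> kn.
have b0 i j : (j <= i)%N -> 'C(i, j)%:R != 0 :> R by move=> ji; rewrite pnatr_eq0 -lt0n bin_gt0.
have nk : n%:R - k%:R != 0 :> R by rewrite subr_eq0 eqr_nat gtn_eqF.
have n1 : n.+1%:R != 0 :> R by rewrite pnatr_eq0.
have k2 : k.+2%:R != 0 :> R by rewrite pnatr_eq0.
have k1 : k.+1%:R != 0 :> R by rewrite pnatr_eq0.
have e1 : 'C(n.+1, k.+1)%:R = k.+2%:R / (n%:R - k%:R) * 'C(n.+1, k.+2)%:R :> R.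
  have := mulrn_bin_left R n.+1 k.+1; rewrite -[n.+1%:R]natr1 -[k.+1%:R]natr1 opprD addrACA subrr addr0 => e.
  by apply: (mulfI nk); rewrite -e; field.
have e2 : 'C(n, k.+1)%:R = k.+2%:R / n.+1%:R * 'C(n.+1, k.+2)%:R :> R.
  have /(congr1 (fun m => m%:R : R)) := mul_bin_diag n.+1 k.+1; rewrite !natrM /= => e.
  by apply: (mulfI n1); rewrite e; field.
have e3 : 'C(n, k)%:R = k.+1%:R / n.+1%:R * 'C(n.+1, k.+1)%:R :> R.
  have /(congr1 (fun m => m%:R : R)) := mul_bin_diag n.+1 k; rewrite !natrM /= => e.
  by apply: (mulfI n1); rewrite e; field.
rewrite /fixmean !fixbin0 !natrX.
rewrite mulrA fixbin_rec e3 e2 e1.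
have c0 := b0 n.+1 k.+2 kn.
move: nk n1 k2 k1 c0.
move: (n%:R - k%:R) (n.+1%:R : R) (k.+2%:R : R) (k.+1%:R : R) ('C(n.+1, k.+2)%:R : R) => d N a b c *.
by field; rewrite ?andbT; apply/and5P; split.
Qed.

Lemma sqr_diff_le (a b A d : R) : 0 <= a <= A -> 0 <= b <= A -> `|a - b| <= d ->
  `|a ^+ 2 - b ^+ 2| <= 2 * A * d.
Proof.
move=> /andP[a0 aA] /andP[b0 bA] h.
rewrite subr_sqr normrM mulrC; apply: ler_pM => //.
rewrite ger0_norm ?addr_ge0 //; lra.
Qed.

Lemma fix_ratio_bounds eps (x y z : R) : 0 < eps -> 0 < z -> eps * z <= y -> z = x + y -> 1 <= x ->
  [/\ `|(x / (y + 1)) ^+ 2 - (x / y) ^+ 2| <= 2 * eps^-1 ^+ 3 / z,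
     (x / (y + 1)) ^+ 2 <= eps^-1 ^+ 2, (x / y) ^+ 2 <= eps^-1 ^+ 2, (x / z) ^+ 2 <= 1 &
     (x / z * (x / y)) ^+ 2 <= eps^-1 ^+ 2 /\
     `|(x / z * ((x - 1) / (y + 1))) ^+ 2 - (x / z * (x / y)) ^+ 2| <= 2 * eps^-1 ^+ 3 / z].
Proof.
move=> e0 z0 ey zxy x1.
have ez : 0 < eps * z by rewrite mulr_gt0.
have y0 : 0 < y := lt_le_trans ez ey.
have x0 : 0 < x := lt_le_trans ltr01 x1.
have y1 : 0 < y + 1 by rewrite addr_gt0.
have xz : 0 <= x / z <= 1 by rewrite divr_ge0 ?(ltW x0) ?(ltW z0) //= ler_pdivrMr // mul1r; lra.
have ei0 : 0 <= eps^-1 by rewrite invr_ge0 ltW.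
have zy : z / y <= eps^-1 by rewrite ler_pdivrMr // ler_pdivlMl.
have xy : 0 <= x / y <= eps^-1.
  rewrite divr_ge0 ?(ltW x0) ?(ltW y0) //=; apply: le_trans zy.
  by rewrite ler_pM2r ?invr_gt0 //; lra.
have xy1 : 0 <= x / (y + 1) <= eps^-1.
  rewrite divr_ge0 ?(ltW x0) ?(ltW y1) //=; case/andP: xy => _; apply: le_trans.
  by rewrite ler_pM2l // lef_pV2 ?posrE //; lra.
have zyy : z / (y * (y + 1)) <= eps^-1 ^+ 2 / z.
  have -> : eps^-1 ^+ 2 / z = z / ((eps * z) * (eps * z)) by field; rewrite !gt_eqF.
  rewrite ler_pM2l // lef_pV2 ?posrE ?mulr_gt0 //.
  apply: ler_pM; rewrite ?(ltW ez) //; lra.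
have d1 : `|x / (y + 1) - x / y| <= eps^-1 ^+ 2 / z.
  have -> : x / (y + 1) - x / y = - (x / (y * (y + 1))) by field; rewrite !gt_eqF.
  rewrite normrN ger0_norm; last by rewrite divr_ge0 ?mulr_ge0 ?(ltW x0) ?(ltW y0) ?(ltW y1).
  apply: le_trans zyy; rewrite ler_pM2r ?invr_gt0 ?mulr_gt0 //; lra.
have d3 : `|(x - 1) / (y + 1) - x / y| <= eps^-1 ^+ 2 / z.
  have -> : (x - 1) / (y + 1) - x / y = - (z / (y * (y + 1))) by rewrite zxy; field; rewrite !gt_eqF.
  by rewrite normrN ger0_norm // divr_ge0 ?mulr_ge0 ?(ltW z0) ?(ltW y0) ?(ltW y1).
have sq1 (a A : R) : 0 <= a <= A -> a ^+ 2 <= A ^+ 2.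
  by case/andP => a0 aA; rewrite lerXn2r // nnegrE // (le_trans a0).
have eE : 2 * eps^-1 ^+ 3 / z = 2 * eps^-1 * (eps^-1 ^+ 2 / z) by ring.
have mz (a A : R) : 0 <= a <= A -> 0 <= x / z * a <= A.
  case/andP=> a0 aA; case/andP: xz => z0' z1; rewrite mulr_ge0 //=.
  by apply: le_trans aA; rewrite ler_piMl.
split.
- by rewrite eE; apply: sqr_diff_le.
- exact: sq1.
- exact: sq1.
- by rewrite -(expr1n _ 2); exact: sq1.
split; first by apply: sq1; apply: mz.
rewrite eE; apply: sqr_diff_le; [apply: mz | exact: mz | ].
  rewrite divr_ge0 ?subr_ge0 ?(ltW y1) //=; case/andP: xy1 => _; apply: le_trans.
  by rewrite ler_pM2r ?invr_gt0 //; lra.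
rewrite -mulrBr normrM ger0_norm; last by case/andP: xz.
by apply: le_trans d3; rewrite ler_piMl //; case/andP: xz.
Qed.

(** The leading terms solve the recursion exactly, since z^2 - x^2 - y^2 = 2 x y for z = x + y. The
    factor (q + 2)/2 is the one between (q/2)! and ((q + 2)/2)!. *)
Lemma fix_limit_identity (x y z h T f q : R) : z = x + y -> y != 0 -> z != 0 -> f != 0 ->
  q + 1 != 0 -> q + 1 + 1 != 0 ->
  (q + 1 + 1) / 2 * h / ((q + 1 + 1) * ((q + 1) * f)) * (x ^+ 3 / (z * y) * T) * (4 * (q + 1)) =
  z * ((x / y) ^+ 2 * (h / f * T)) - z * ((x / z) ^+ 2 * (h / f * T))
    - z * ((x / z * (x / y)) ^+ 2 * (h / f * T)).
Proof.
move=> -> y0 z0 f0 q1 q2; field.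
have q1' : 1 + q != 0 by rewrite addrC.
have q2' : 1 + 1 + q != 0 by rewrite addrC addrA.
by rewrite ?y0 ?z0 ?f0 ?q1 ?q2 ?q1' ?q2'.
Qed.

Lemma fix_asymptotic_step q : fix_asymptotic R q -> fix_asymptotic R q.+2.
Proof.
move=> IH eps e0; have e20 : 0 < eps / 2 by rewrite divr_gt0.
have [C0 [n0 hC]] := IH _ e20.
have [D D0 hD] := fixscale_pow_shift q e20.
pose kap : R := half_fact R q / q`!%:R.
have kap0 : 0 <= kap by rewrite divr_ge0 ?half_fact_ge0.
pose C : R := 2 * `|C0| + kap * D.
have Cge0 : 0 <= C by rewrite addr_ge0 // mulr_ge0.
pose p : R := kap * Num.sqrt (eps^-1) ^+ q.
have p0 : 0 <= p by rewrite mulr_ge0 ?exprn_ge0 ?sqrtr_ge0.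
pose ei : R := eps^-1; have ei0 : 0 <= ei by rewrite invr_ge0 ltW.
(* Error of the first ratio, plus the cost of replacing n + 1 - q by n + 1. *)
pose a1 : R := 2 * ei ^+ 3 + ei ^+ 2 * q%:R.
pose K (a b : R) := a * C + a * p + b * C.
exists (K a1 (ei ^+ 2) + K 0 1 + K (2 * ei ^+ 3) (ei ^+ 2)).
(* Then eps n > 4, so shifting k by at most 2 and n by 1 stays in the range of eps / 2, and n - 1 is
   still above [n0]. *)
exists (maxn (Num.truncn (4 / eps)).+1 n0.+1) => n k; rewrite gtn_max => /andP[nbig nn0] kl ku.
have nr : 4 / eps < n%:R.
  have /andP[_] := truncn_itv (ltW (divr_gt0 (ltr0Sn R 3) e0)).
  by move/lt_trans; apply; rewrite ltr_nat.
have en4 : 4 < eps * n%:R by rewrite -ltr_pdivrMl // mulrC.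
have k4 : (4 < k)%N by rewrite -(ltr_nat R); apply: lt_le_trans kl.
have z0 : 0 < n%:R :> R by rewrite ltr0n; lia.
have kn : (k < n)%N.
  by rewrite -(ltr_nat R); apply: le_lt_trans ku _; rewrite mulrBl mul1r gtrBl; lra.
clear nbig; case: n z0 nn0 kl ku nr en4 kn => [|n] z0 nn0 kl ku nr en4 kn; first by [].
case: k k4 kl ku kn => [|[|k]] k4 kl ku kn; [by []|by []|].
have s1 : 1 <= sq n.+1 by apply: sq_ge1.
have s0 : 0 < sq n.+1 := lt_le_trans ltr01 s1.
have ss : sq n.+1 * sq n.+1 = n.+1%:R by rewrite -expr2 sqr_sqrtr.
set S := sq n.+1 ^+ q / sq n.+1.
have S0 : 0 <= S by rewrite divr_ge0 ?exprn_ge0 ?sqrtr_ge0.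
set P := fixapprox R q n.+1 k.+2.
have PE : P = kap * Num.sqrt (fixscale R n.+1 k.+2) ^+ q by [].
have natk : k.+2%:R = k%:R + 2 :> R by rewrite -addn2 natrD.
have natk1 : k.+1%:R = k%:R + 1 :> R by rewrite -addn1 natrD.
have natn : n.+1%:R = n%:R + 1 :> R by rewrite -addn1 natrD.
have shift n' k' : (n' <= n.+1)%N -> (n <= n')%N -> (k' <= k.+2)%N -> (k <= k')%N ->
   k'%:R <= (1 - eps / 2) * n'%:R -> (n0 < n')%N -> `|fmean q n' k' - P| <= C * S.
  move=> nn nn' kk kk' ku' nn0'.
  have n0' : (0 < n')%N by apply: leq_ltn_trans nn0'.
  have rn : n%:R <= n'%:R :> R by rewrite ler_nat.
  have rn' : n'%:R <= n.+1%:R :> R by rewrite ler_nat.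
  have rk : k%:R <= k'%:R :> R by rewrite ler_nat.
  have kl' : eps / 2 * n'%:R <= k'%:R.
    have : eps / 2 * n'%:R <= eps / 2 * n.+1%:R by rewrite ler_wpM2l // ltW.
    lra.
  have h1 := hC _ _ nn0' kl' ku'.
  have h2 : `|Num.sqrt (fixscale R n.+1 k.+2) ^+ q - Num.sqrt (fixscale R n' k') ^+ q| <= D * S.
    by apply: hD => //; lra.
  have -> : fmean q n' k' - P = (fmean q n' k' - fixapprox R q n' k')
     + kap * (Num.sqrt (fixscale R n' k') ^+ q - Num.sqrt (fixscale R n.+1 k.+2) ^+ q).
    by rewrite PE /fixapprox -/kap; ring.
  apply: le_trans (ler_normD _ _) _; rewrite /C mulrDl; apply: lerD; last first.
    by rewrite normrM (ger0_norm kap0) -mulrA ler_wpM2l // distrC.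
  apply: le_trans h1 _; apply: (@le_trans _ _ (`|C0| * (sq n' ^+ q / sq n'))).
    by rewrite ler_wpM2r ?ler_norm // divr_ge0 ?exprn_ge0 ?sqrtr_ge0.
  have -> : 2 * `|C0| * S = `|C0| * (sq n.+1 ^+ q * (2 / sq n.+1)) by rewrite /S; ring.
  apply: ler_wpM2l => //.
  have n'0 : 0 < sq n' by rewrite sqrtr_gt0 ltr0n.
  apply: ler_pM; rewrite ?exprn_ge0 ?invr_ge0 ?sqrtr_ge0 //.
    by rewrite lerXn2r ?nnegrE ?sqrtr_ge0 // ler_wsqrtr.
  have : sq n.+1 <= 2 * sq n'.
    have -> : 2 * sq n' = Num.sqrt (4 * n'%:R).
      by rewrite sqrtrM // (_ : 4 = 2 ^+ 2) ?sqrtr_sqr ?ger0_norm //; ring.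
    rewrite ler_wsqrtr //; move: n0'; rewrite -(ler_nat R); lra.
  by move=> h; rewrite ler_pdivlMr // mulrC ler_pdivrMr.
pose z : R := n.+1%:R; pose x : R := k.+2%:R; pose y : R := z - x.
have zxy : z = x + y by rewrite /y; ring.
have ey : eps * z <= y by rewrite /y /z /x; lra.
have x1 : 1 <= x by rewrite ler1n.
have [b1 b2 b3 b4 [b5 b6]] := fix_ratio_bounds e0 z0 ey zxy x1.
have y0 : 0 < y by apply: lt_le_trans ey; rewrite mulr_gt0.
have nk : n%:R - k%:R = y + 1 by rewrite /y /z /x natk natn; ring.
have kn' : (k < n)%N by apply: ltnW.
have hrec := fixmean_rec q kn'.
rewrite nk -/x -/z in hrec.
have xm : k.+1%:R = x - 1 by rewrite /x natk natk1; ring.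
rewrite xm in hrec.
have sz : sq n.+1 <= z by have := ler_wpM2l (ltW s0) s1; rewrite mulr1 ss.
have z1 : 1 <= z by apply: le_trans s1 sz.
have Pp : `|P| <= p * (sq n.+1 * S).
  have -> : sq n.+1 * S = sq n.+1 ^+ q by rewrite /S; field; rewrite gt_eqF.
  rewrite PE normrM (ger0_norm kap0) /p -mulrA ler_wpM2l // ger0_norm ?exprn_ge0 ?sqrtr_ge0 //.
  rewrite -exprMn lerXn2r ?nnegrE ?mulr_ge0 ?sqrtr_ge0 // -sqrtrM // ler_wsqrtr //.
  have n00 : (0 < n.+1)%N by [].
  by have /andP[] := fixscale_ge e0 n00 kl ku.
have E1 : `|fmean q n.+1 k.+1 - P| <= C * S.
  apply: shift; rewrite ?leqnn ?leqnSn // 1?ltnW // -/z xm /x; lra.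
have nz : n%:R = z - 1 :> R by rewrite /z natn; ring.
have kx : k%:R = x - 2 :> R by rewrite /x natk; ring.
have ez4 : 4 < eps * z by [].
have kuz : x <= (1 - eps) * z by [].
have E2 : `|fmean q n k.+1 - P| <= C * S.
  by apply: shift; rewrite ?leqnn ?leqnSn // xm nz; lra.
have E3 : `|fmean q n k - P| <= C * S.
  by apply: shift; rewrite ?leqnn ?leqnSn ?(leqW (leqnSn k)) // kx nz; lra.
have q1 : 1 <= q.+1%:R :> R by rewrite ler1n.
set r1 := (x / (y + 1)) ^+ 2 in b1 b2 hrec *.
set r2 := (x / z) ^+ 2 in b4 hrec *.
set r3 := (x / z * ((x - 1) / (y + 1))) ^+ 2 in b6 hrec *.
have B1 : `|r1 * (1 - q%:R / z) - (x / y) ^+ 2| <= a1 / z.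
  have -> : r1 * (1 - q%:R / z) - (x / y) ^+ 2 = (r1 - (x / y) ^+ 2) - r1 * (q%:R / z) by ring.
  apply: le_trans (ler_normB _ _) _.
  have -> : a1 / z = 2 * ei ^+ 3 / z + ei ^+ 2 * (q%:R / z) by rewrite /a1; ring.
  have qz : 0 <= q%:R / z by rewrite divr_ge0 ?(ltW z0).
  apply: lerD => //; rewrite ger0_norm ?ler_wpM2r //.
  by apply: mulr_ge0 => //; exact: sqr_ge0.
have B2 : `|r2 - r2| <= 0 / z by rewrite subrr normr0 mul0r.
have n1 (a : R) : `|a ^+ 2| = a ^+ 2 by rewrite ger0_norm ?sqr_ge0.
have a10 : 0 <= a1 by rewrite addr_ge0 ?mulr_ge0 ?exprn_ge0.
have a30 : 0 <= 2 * ei ^+ 3 by rewrite mulr_ge0 ?exprn_ge0.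
have T1 := @mul_approx_le _ _ _ _ _ a1 (ei ^+ 2) p C _ z z0 a10 Cge0 S0 p0 z1 sz (ltW s0) B1 (eq_ind_r (fun u => u <= _) b3 (n1 _)) E1 Pp.
have T2 := @mul_approx_le _ _ _ _ _ 0 1 p C _ z z0 (lexx 0) Cge0 S0 p0 z1 sz (ltW s0) B2 (eq_ind_r (fun u => u <= _) b4 (n1 _)) E2 Pp.
have T3 := @mul_approx_le _ _ _ _ _ (2 * ei ^+ 3) (ei ^+ 2) p C _ z z0 a30 Cge0 S0 p0 z1 sz (ltW s0) b6 (eq_ind_r (fun u => u <= _) b5 (n1 _)) E3 Pp.
have fE : fixapprox R q.+2 n.+1 k.+2 * (4 * q.+1%:R) =
   z * ((x / y) ^+ 2 * P) - z * (r2 * P) - z * ((x / z * (x / y)) ^+ 2 * P).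
  have LE : Num.sqrt (fixscale R n.+1 k.+2) ^+ q.+2 = x ^+ 3 / (z * y) * Num.sqrt (fixscale R n.+1 k.+2) ^+ q.
    have L0 : 0 <= fixscale R n.+1 k.+2.
      have n00 : (0 < n.+1)%N by [].
      have /andP[h _] := fixscale_ge e0 n00 kl ku; apply: le_trans h.
      by rewrite mulr_ge0 ?exprn_ge0 // ltW.
    by rewrite 2!exprS mulrA -expr2 sqr_sqrtr.
  have f0 : q`!%:R != 0 :> R by rewrite pnatr_eq0 -lt0n fact_gt0.
  rewrite /fixapprox LE half_factSS !factS !natrM PE /kap /r2 -[q.+2%:R]natr1 -[q.+1%:R]natr1.
  by apply: fix_limit_identity; rewrite ?gt_eqF // ?natr1 ?ltr0n // natr1 ltr0n.
have SE : sq n.+1 ^+ q.+2 / sq n.+1 = z * S.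
  by rewrite -[z]ss /S 2!exprS; field; rewrite gt_eqF.
have tot : `|(fmean q.+2 n.+1 k.+2 - fixapprox R q.+2 n.+1 k.+2) * (4 * q.+1%:R)| <=
   (K a1 (ei ^+ 2) + K 0 1 + K (2 * ei ^+ 3) (ei ^+ 2)) * (z * S).
  rewrite mulrBl fE mulrC hrec.
  have -> : (z - q%:R) * (r1 * fmean q n.+1 k.+1) = z * (r1 * (1 - q%:R / z) * fmean q n.+1 k.+1).
    by field; rewrite gt_eqF.
  move: T1 T2 T3.
  set U1 := z * (_ * fmean q n.+1 _); set U2 := z * (_ * fmean q n k.+1); set U3 := z * (_ * fmean q n k).
  set V1 := z * (_ * P); set V2 := z * (r2 * P); set V3 := z * (_ * P) => T1 T2 T3.
  have -> : U1 - U2 - U3 - (V1 - V2 - V3) = (U1 - V1) - (U2 - V2) - (U3 - V3) by ring.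
  apply: le_trans (ler_normB _ _) _; rewrite [X in _ <= X]mulrDl; apply: lerD; last exact: T3.
  by apply: le_trans (ler_normB _ _) _; rewrite [X in _ <= X]mulrDl; apply: lerD.
rewrite SE; apply: le_trans tot; rewrite normrM ler_peMr // ger0_norm ?mulr_ge0 //; lra.
Qed.

Theorem fix_asymptotics q : fix_asymptotic R q.
Proof.
suff : fix_asymptotic R q /\ fix_asymptotic R q.+1 by case.
elim: q => [|q [IH1 IH2]]; first by split; [exact: fix_asymptotic0|exact: fix_asymptotic1].
by split => //; apply: fix_asymptotic_step.
Qed.

End FixAsymptoticStep.

(** * Increasing bijections and their iterates *)

Section WordsAndSets.
Variable R : realType.
Implicit Types (n k : nat).

Definition bits n (I : {set 'I_n}) : seq bool := [seq x \in I | x <- enum 'I_n].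
Definition rk n (I : {set 'I_n}) (x : nat) : nat := #|[set a in I | (a < x)%N]|.
(* The increasing bijection from I to J maps x to y. *)
Definition rank_match n (I J : {set 'I_n}) (x y : 'I_n) : bool :=
  [&& x \in I, y \in J & rk I x == rk J y].

Lemma size_bits n (I : {set 'I_n}) : size (bits I) = n.
Proof. by rewrite size_map size_enum_ord. Qed.

Lemma nth_bits n (I : {set 'I_n}) (x : 'I_n) : nth false (bits I) x = (x \in I).
Proof. by rewrite (nth_map x) ?size_enum_ord // nth_ord_enum. Qed.

Lemma count_take_sum (s : seq bool) x : (x <= size s)%N ->
  count id (take x s) = (\sum_(0 <= i < x) nth false s i)%N.
Proof.
elim: x => [|x IH] xs; first by rewrite take0 big_nil.
by rewrite (take_nth false) // -cats1 count_cat IH ?(ltnW xs) // big_nat_recr //= addn0.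
Qed.

Lemma count_take_bits n (I : {set 'I_n}) (x : nat) : (x <= n)%N ->
  count id (take x (bits I)) = rk I x.
Proof.
move=> xn; rewrite count_take_sum ?size_bits // (big_nat_widen _ _ _ _ _ xn) big_mkord.
rewrite /rk -sum1_card big_mkcond [RHS]big_mkcond /=; apply: eq_bigr => a _.
by rewrite inE nth_bits; case: (a \in I); case: (a < x)%N.
Qed.

Lemma count_bits n (I : {set 'I_n}) : count id (bits I) = #|I|.
Proof.
rewrite -[bits I]take_size size_bits count_take_bits //.
by apply: eq_card => x; rewrite inE ltn_ord andbT.
Qed.

Lemma fixes_bits n (I J : {set 'I_n}) :
  fixes (bits I) (bits J) = (\sum_x rank_match I J x x)%N.
Proof.
rewrite /fixes size_bits; apply: eq_bigr => x _.
by rewrite /fixat !nth_bits !count_take_bits // ltnW.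
Qed.

Lemma sum_tuple_cons (T : finType) n (F : seq T -> R) :
  \sum_(t : n.+1.-tuple T) F t = \sum_(b : T) \sum_(t : n.-tuple T) F (b :: t).
Proof.
rewrite pair_big /= (reindex (fun p : T * n.-tuple T => [tuple of p.1 :: p.2])) //=.
exists (fun t : n.+1.-tuple T => (thead t, [tuple of behead t])) => [[b t]|t] _ /=.
  by rewrite theadE; congr (_, _); apply: val_inj.
by rewrite -tuple_eta.
Qed.

Lemma sum_tuple0 (T : finType) (F : seq T -> R) : \sum_(t : 0.-tuple T) F t = F [::].
Proof.
rewrite (eq_bigr (fun=> F [::])) => [|t _]; last by rewrite tuple0.
by rewrite sumr_const card_tuple expn0 mulr1n.
Qed.

Lemma wsum_tuple n k (F : seq bool -> R) :
  \sum_(t : n.-tuple bool | count id t == k) F t = wsum n k F.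
Proof.
elim: n k F => [|n IH] k F.
  by rewrite big_mkcond (@sum_tuple0 _ (fun t => if count id t == k then F t else 0)) wsum0 /=; case: k.
rewrite big_mkcond (@sum_tuple_cons _ n (fun t => if count id t == k then F t else 0)) wsumS.
rewrite big_bool /= addrC; congr (_ + _).
  by rewrite -IH [RHS]big_mkcond.
case: k => [|k]; first by rewrite big1.
by rewrite -IH [RHS]big_mkcond.
Qed.

Lemma sum_bits n k (F : seq bool -> R) :
  \sum_(I : {set 'I_n} | #|I| == k) F (bits I) = wsum n k F.
Proof.
rewrite -wsum_tuple.
pose h (t : n.-tuple bool) : {set 'I_n} := [set x | tnth t x].
have bh t : bits (h t) = t.
  apply: (@eq_from_nth _ false); rewrite size_bits ?size_tuple // => i ni.
  by rewrite (nth_bits _ (Ordinal ni)) inE (tnth_nth false).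
rewrite (reindex h) /=; last first.
  exists (fun I => Tuple (introT eqP (size_bits I))) => [t|I] _.
    by apply: val_inj; rewrite /= bh.
  by apply/setP => x; rewrite inE (tnth_nth false) /= nth_bits.
by apply: eq_big => [t|t _]; rewrite ?bh // -count_bits bh.
Qed.

End WordsAndSets.

(** * Permutations extending an increasing bijection *)

Section IncreasingSubsets.
Implicit Types (n k : nat).

Definition extends n (I J : {set 'I_n}) (pi : 'S_n) : bool :=
  [forall x in I, rank_match I J x (pi x)].

Definition increasing_on n (I : {set 'I_n}) (pi : 'S_n) : bool :=
  [forall x in I, forall y in I, (x < y)%N ==> (pi x < pi y)%N].

Lemma rk_mono n (I : {set 'I_n}) (x y : nat) : (x <= y)%N -> (rk I x <= rk I y)%N.
Proof.
move=> xy; apply: subset_leq_card; apply/fintype.subsetP => a; rewrite !inE => /andP[-> ax].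
exact: leq_trans xy.
Qed.

Lemma rk_lt n (I : {set 'I_n}) (x y : 'I_n) : x \in I -> (rk I x < rk I y)%N = (x < y)%N.
Proof.
move=> xI; have [xy|yx] := ltnP x y; last first.
  by apply/negbTE; rewrite -leqNgt rk_mono.
apply: proper_card; apply/properP; split.
  by apply/fintype.subsetP => a; rewrite !inE => /andP[-> ax]; apply: ltn_trans xy.
by exists x; rewrite !inE ?xI ?xy ?ltnn ?andbF.
Qed.

Lemma rk_inj n (I : {set 'I_n}) (x y : 'I_n) : x \in I -> y \in I -> rk I x = rk I y -> x = y.
Proof.
move=> xI yI e; apply: val_inj => /=; have [lt|gt|//] := ltngtP x y.
  by move: lt; rewrite -(rk_lt _ xI) e ltnn.
by move: gt; rewrite -(rk_lt _ yI) e ltnn.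
Qed.

Lemma rank_match_lt n (I J : {set 'I_n}) (x y x' y' : 'I_n) :
  rank_match I J x y -> rank_match I J x' y' -> (x < x')%N = (y < y')%N.
Proof.
case/and3P=> xI yJ /eqP e /and3P[xI' yJ' /eqP e'].
by rewrite -(rk_lt _ xI) -(rk_lt _ yJ) e e'.
Qed.

Lemma extends_increasing n (I J : {set 'I_n}) pi : extends I J pi -> increasing_on I pi.
Proof.
move=> /forall_inP h; apply/forall_inP => x xI; apply/forall_inP => y yI; apply/implyP.
by rewrite (rank_match_lt (h x xI) (h y yI)).
Qed.

Lemma extends_imset n (I J : {set 'I_n}) pi : #|I| = #|J| -> extends I J pi -> J = pi @: I.
Proof.
move=> cIJ /forall_inP h; apply/eqP; rewrite eq_sym eqEcard card_imset ?cIJ ?leqnn ?andbT; last exact: perm_inj.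
by apply/fintype.subsetP => _ /imsetP[x xI ->]; case/and3P: (h x xI).
Qed.

Lemma increasing_extends n (I : {set 'I_n}) pi : increasing_on I pi -> extends I (pi @: I) pi.
Proof.
move=> /forall_inP h; apply/forall_inP => x xI; apply/and3P; split => //; first exact: imset_f.
apply/eqP; rewrite /rk -(card_imset _ (@perm_inj _ pi)); apply: eq_card => b.
rewrite !inE; apply/imsetP/andP => [[a]|[/imsetP[a aI ->] lt]].
  rewrite inE => /andP[aI ax] ->; split; first exact: imset_f.
  by have /forall_inP/(_ x xI)/implyP := h a aI; apply.
exists a => //; rewrite inE aI ltnNge /=; apply: contraL lt => xa.
rewrite -leqNgt; move: xa; rewrite leq_eqVlt => /predU1P[/val_inj -> //|xa].
by apply: ltnW; have /forall_inP/(_ a aI)/implyP := h x xI; apply.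
Qed.

(** A permutation that increases on I extends exactly one increasing bijection from I, the one onto
    the image of I; any other permutation extends none. *)
Lemma sum_extends n k (I : {set 'I_n}) pi : #|I| = k ->
  (\sum_(J : {set 'I_n} | #|J| == k) extends I J pi = increasing_on I pi)%N.
Proof.
move=> cI; have [inc|ninc] := boolP (increasing_on I pi).
  rewrite (bigD1 (pi @: I)) /= ?card_imset ?cI //; last exact: perm_inj.
  rewrite increasing_extends // big1 ?addn0 // => J /andP[/eqP cJ nJ].
  case e : (extends I J pi) => //; case/eqP: nJ; apply: extends_imset e; by rewrite cI.
rewrite big1 // => J _; case e : (extends I J pi) => //.
by rewrite (extends_increasing e) in ninc.
Qed.

Lemma sorted_enum_ord n (I : {set 'I_n}) : sorted (fun a b : 'I_n => (a < b)%N) (enum I).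
Proof.
rewrite {1}/enum_mem; apply: sorted_filter; first by move=> a b c; apply: ltn_trans.
rewrite -(@sorted_map _ _ val ltn) -enumT val_enum_ord; exact: iota_ltn_sorted.
Qed.

Lemma N_id_increasing n k (pi : 'S_n) :
  N_id k pi = #|[set I : {set 'I_n} | (#|I| == k) && increasing_on I pi]|.
Proof.
have ltT : transitive (fun a b : 'I_n => (a < b)%N) by move=> a b c; apply: ltn_trans.
have ltI : irreflexive (fun a b : 'I_n => (a < b)%N) by move=> a; apply: ltnn.
have piT : transitive (fun a b : 'I_n => (pi a < pi b)%N) by move=> a b c; apply: ltn_trans.
rewrite /N_id; set A := [set i : k.-tuple 'I_n | _].
have uA (i : k.-tuple 'I_n) : sorted (fun a b : 'I_n => (a < b)%N) i -> uniq i.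
  exact: sorted_uniq.
rewrite -(@card_in_imset _ _ (fun i : k.-tuple 'I_n => [set x in i]) A); last first.
  move=> i j; rewrite !inE => /andP[si _] /andP[sj _] e; apply: val_inj.
  apply: (irr_sorted_eq ltT ltI si sj) => x.
  by move/setP/(_ x): e; rewrite !inE.
apply: eq_card => I; rewrite inE; apply/imsetP/andP => [[i]|[/eqP cI inc]].
  rewrite inE => /andP[si sp] ->; split.
    by rewrite cardsE (card_uniqP (uA i si)) size_tuple.
  apply/forall_inP => x; rewrite inE => xi; apply/forall_inP => y; rewrite inE => yi.
  apply/implyP => xy.
  move: si sp; rewrite !sorted_pairwise // => si sp.
  have ix : (index x i < size i)%N by rewrite index_mem.
  have iy : (index y i < size i)%N by rewrite index_mem.
  have [lt|gt|eq] := ltngtP (index x i) (index y i).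
  - by have := (pairwiseP x sp) _ _ ix iy lt; rewrite !nth_index.
  - by have := (pairwiseP x si) _ _ iy ix gt; rewrite !nth_index // ltnNge (ltnW xy).
  - by move: xy; rewrite -(nth_index x xi) eq nth_index // ltnn.
have sI : size (enum I) == k by rewrite -cardE cI.
exists (Tuple sI); last by apply/setP => x; rewrite inE mem_enum.
rewrite inE /= sorted_enum_ord /=.
apply: (@sub_in_sorted _ (mem I) (fun a b : 'I_n => (a < b)%N)) (sorted_enum_ord I).
  by move=> x y xI yI xy; have /forall_inP/(_ x xI)/forall_inP/(_ y yI)/implyP := inc; apply.
by apply/allP => x; rewrite mem_enum.
Qed.

Lemma N_idE n k (pi : 'S_n) : N_id k pi =
  (\sum_(I : {set 'I_n} | #|I| == k) \sum_(J : {set 'I_n} | #|J| == k) extends I J pi)%N.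
Proof.
rewrite N_id_increasing -sum1_card big_mkcond [RHS]big_mkcond; apply: eq_bigr => I _.
rewrite inE; case: eqP => //= cI; rewrite sum_extends //; by case: increasing_on.
Qed.

End IncreasingSubsets.

(** * Upward chains of the bijection *)

Section UpChains.
Variable R : realType.
Implicit Types (n k l : nat).

Lemma rk_max n (J : {set 'I_n}) (y : 'I_n) : y \in J -> (rk J y < #|J|)%N.
Proof.
move=> yJ; apply: proper_card; apply/properP; split.
  by apply/fintype.subsetP => a; rewrite inE => /andP[].
by exists y => //; rewrite inE ltnn andbF.
Qed.

Lemma rk_surj n (J : {set 'I_n}) r : (r < #|J|)%N -> exists2 y, y \in J & rk J y = r.
Proof.
move=> rJ.
pose f (y : 'I_n) : 'I_#|J| := insubd (Ordinal rJ) (rk J y).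
have fE y : y \in J -> f y = rk J y :> nat by move=> yJ; rewrite /f val_insubd rk_max.
have finj : {in J &, injective f}.
  by move=> y z yJ zJ /(congr1 val) /=; rewrite !fE //; apply: rk_inj.
have : f @: J = [set: 'I_#|J|]%SET.
  by apply/eqP; rewrite eqEcard finset.subsetT cardsT card_ord card_in_imset ?leqnn.
move/setP/(_ (Ordinal rJ)); rewrite inE => /imsetP[y yJ e]; exists y => //.
by rewrite -fE // -e.
Qed.

Lemma rank_matchC n (I J : {set 'I_n}) (x y : 'I_n) : rank_match I J x y = rank_match J I y x.
Proof. by rewrite /rank_match eq_sym andbCA. Qed.

Lemma rank_match_inj n (I J : {set 'I_n}) (x y y' : 'I_n) :
  rank_match I J x y -> rank_match I J x y' -> y = y'.
Proof.
case/and3P=> _ yJ /eqP e /and3P[_ yJ' /eqP e']; apply: rk_inj yJ yJ' _; by rewrite -e -e'.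
Qed.

Lemma rank_match_ex n (I J : {set 'I_n}) (x : 'I_n) : #|I| = #|J| -> x \in I ->
  exists y, rank_match I J x y.
Proof.
move=> cIJ xI; have [|y yJ e] := @rk_surj n J (rk I x); first by rewrite -cIJ rk_max.
by exists y; apply/and3P; split => //; rewrite e.
Qed.

Lemma sum_rank_match n (I J : {set 'I_n}) (x : 'I_n) : #|I| = #|J| ->
  \sum_y (rank_match I J x y)%:R = (x \in I)%:R :> R.
Proof.
move=> cIJ; case: (boolP (x \in I)) => xI; last first.
  by apply: big1 => y _; rewrite /rank_match (negPf xI).
have [y xy] := rank_match_ex cIJ xI.
rewrite (bigD1 y) //= xy big1 ?addr0 // => z zy.
by case e: (rank_match I J x z) => //; rewrite (rank_match_inj xy e) eqxx in zy.
Qed.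

(** By injectivity the sum has at most one term, so the value is 1 if [y] has [l] iterated
    preimages, each strictly smaller than the one before, and 0 otherwise. *)
Fixpoint up n (I J : {set 'I_n}) l (y : 'I_n) : R :=
  if l is l'.+1 then \sum_(x : 'I_n | (x < y)%N && rank_match I J x y) up I J l' x else 1.

Definition upsum n (I J : {set 'I_n}) l : R := \sum_y up I J l y.

Lemma up_ge0 n (I J : {set 'I_n}) l y : 0 <= up I J l y.
Proof. by elim: l y => [|l IH] y //=; apply: sumr_ge0. Qed.

Lemma up_le1 n (I J : {set 'I_n}) l y : up I J l y <= 1.
Proof.
elim: l y => [|l IH] y //=.
have [x /andP[xy xm]|no] := pickP (fun x : 'I_n => (x < y)%N && rank_match I J x y); last first.
  by rewrite big_pred0.
rewrite (bigD1 x) ?xy //= big1 ?addr0 // => z /andP[/andP[_ zm]].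
by rewrite rank_matchC in zm; rewrite rank_matchC in xm; rewrite (rank_match_inj xm zm) eqxx.
Qed.

Definition below n (I : {set 'I_n}) (y : nat) : {set 'I_n} := [set a in I | (a < y)%N].

Lemma rk_below n (I : {set 'I_n}) (x y : nat) : (x <= y)%N -> rk (below I y) x = rk I x.
Proof.
move=> xy; apply: eq_card => a; rewrite !inE -andbA; congr (_ && _).
by case: (ltnP a x) => ax; rewrite ?andbF // andbT (leq_trans ax).
Qed.

Lemma below_below n (I : {set 'I_n}) (x y : nat) : (x <= y)%N -> below (below I y) x = below I x.
Proof.
move=> xy; apply/setP => a; rewrite !inE -andbA; congr (_ && _).
by case: (ltnP a x) => ax; rewrite ?andbF // andbT (leq_trans ax).
Qed.

(** The iterated preimages along an upward chain lie below [y], so the value depends only on the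
    part of I below [y]. With J fixed, this makes it predictable when I is read from left to
    right. *)
Lemma up_below n (I J : {set 'I_n}) l y : up I J l y = up (below I y) J l y.
Proof.
elim: l I y => [|l IH] I y //=; apply: eq_big => [x|x /andP[xy _]].
  have [xy|//] := ltnP x y; rewrite /= /rank_match rk_below ?(ltnW xy) //.
  by rewrite inE xy andbT.
by rewrite IH [RHS]IH below_below // ltnW.
Qed.

(** A chain ending in x continues exactly when x is in I. After at least one upward step the next
    step is upward as well, by monotonicity; this is why the lengths start at 1. *)
Lemma upsumS n (I J : {set 'I_n}) l t : #|I| = #|J| ->
  upsum I J l.+2 - t * upsum I J l.+1 = \sum_x up I J l.+1 x * ((x \in I)%:R - t).
Proof.
move=> cIJ; rewrite /upsum mulr_sumr.
under [RHS]eq_bigr do rewrite mulrBr [_ * t]mulrC; rewrite big_split /= sumrN; congr (_ - _).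
transitivity (\sum_(y : 'I_n) \sum_(x : 'I_n) up I J l.+1 x * ((x < y)%N && rank_match I J x y)%:R).
  apply: eq_bigr => y _; rewrite /= big_mkcond; apply: eq_bigr => x _.
  by case: (_ && _); rewrite ?mulr1 ?mulr0.
rewrite exchange_big /=; apply: eq_bigr => x _; rewrite -mulr_sumr.
rewrite -(sum_rank_match x cIJ) !mulr_sumr; apply: eq_bigr => y _.
case m: (rank_match I J x y); rewrite ?andbF ?andbT //.
case: (ltnP x y) => // yx; rewrite mulr0 mulr1; apply/esym.
apply: big1 => z /andP[zx zm]; exfalso.
by move: zx; rewrite (rank_match_lt zm m) ltnNge yx.
Qed.

Lemma sum_upsum_sqr n k (J : {set 'I_n}) l : #|J| = k ->
  \sum_(I : {set 'I_n} | #|I| == k)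
     (upsum I J l.+2 - k%:R / n%:R * upsum I J l.+1) ^+ 2 <= 18 * n%:R * 'C(n, k)%:R.
Proof.
move=> cJ; set t := k%:R / n%:R.
(* A prefix of length y determines the part of I below y, so [h] of it is the chain indicator at y.
   Words of length n or more get the value 0. *)
pose h (p : seq bool) : R := if insub (size p) is Some y then
   up [set a : 'I_n | nth false p a] J l.+1 y else 0.
have h1 p : `|h p| <= 1.
  rewrite /h; case: insubP => [y _ _|_]; last by rewrite normr0.
  by rewrite ger0_norm ?up_ge0 ?up_le1.
have := wsum_predictable_sqr n k h1; rewrite -sum_bits; apply: le_trans.
rewrite le_eqVlt; apply/orP; left; apply/eqP; apply: eq_bigr => I /eqP cI.
rewrite upsumS ?cI ?cJ //; congr (_ ^+ 2); apply: eq_bigr => x _.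
rewrite nth_bits; congr (_ * _).
rewrite /h size_take size_bits ltn_ord valK up_below; congr (up _ J l.+1 x).
apply/setP => a; rewrite !inE; have [ax|xa] := ltnP a x.
  by rewrite nth_take // nth_bits andbT.
by rewrite nth_default ?andbF // size_take size_bits ltn_ord.
Qed.

End UpChains.

(** * The matrix of the increasing bijection *)

Section MatchMatrix.
Variable R : realType.
Variable n : nat.
Implicit Types (k l : nat) (I J : {set 'I_n}) (A B : 'M[R]_n) (x y z : 'I_n).

Definition ones : 'cV[R]_n := const_mx 1.
Definition total A : R := (ones^T *m A *m ones) 0 0.

Definition match_mx (a : rel 'I_n) I J : 'M[R]_n :=
  \matrix_(x, y) (a x y && rank_match I J x y)%:R.

Definition lt_ord : rel 'I_n := fun x y => (x < y)%N.
Definition gt_ord : rel 'I_n := fun x y => (y < x)%N.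

Definition Phi I J := match_mx (fun _ _ => true) I J.
Definition Phi_up I J := match_mx lt_ord I J.
Definition Phi_dn I J := match_mx gt_ord I J.
Definition Phi_eq I J := match_mx (fun x y => x == y) I J.

Lemma totalE A : total A = \sum_x \sum_y A x y.
Proof.
rewrite /total -mulmxA mxE; apply: eq_bigr => x _; rewrite !mxE mul1r.
by apply: eq_bigr => y _; rewrite mxE mulr1.
Qed.

Lemma totalD A B : total (A + B) = total A + total B.
Proof. by rewrite /total mulmxDr mulmxDl mxE. Qed.

Lemma total_tr A : total A^T = total A.
Proof. by rewrite !totalE exchange_big; apply: eq_bigr => x _; apply: eq_bigr => y _; rewrite mxE. Qed.

Lemma trmx_expr A l : (A ^+ l)^T = A^T ^+ l.
Proof.
elim: l => [|l IH]; first by rewrite !expr0 trmx1.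
by rewrite exprS exprSr trmx_mul IH.
Qed.

Lemma match_mx_mul0 (a b : rel 'I_n) I J :
  (forall x y z, rank_match I J x y -> rank_match I J y z -> a x y -> b y z -> false) ->
  match_mx a I J * match_mx b I J = 0.
Proof.
move=> h; apply/matrixP => x z; rewrite !mxE big1 // => y _; rewrite !mxE.
case axy: (a x y); case bxy: (b y z); rewrite /= ?mul0r ?mulr0 //.
case m1: (rank_match I J x y); case m2: (rank_match I J y z); rewrite ?mul0r ?mulr0 //.
by have := h x y z m1 m2 axy bxy.
Qed.

Lemma Phi_split I J : Phi I J = Phi_up I J + Phi_dn I J + Phi_eq I J.
Proof.
apply/matrixP => x y; rewrite !mxE /lt_ord /gt_ord; case: (rank_match I J x y); rewrite ?andbF ?andbT ?addr0 //.
rewrite -val_eqE /=; by case: (ltngtP x y); rewrite /= ?addr0 ?add0r.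
Qed.

Lemma Phi_eq_idem I J l : Phi_eq I J ^+ l.+1 = Phi_eq I J.
Proof.
elim: l => [|l IH]; first by rewrite expr1.
rewrite exprS IH; apply/matrixP => x z; rewrite !mxE (bigD1 x) //= big1 ?addr0.
  by rewrite !mxE eqxx /=; case: eqVneq => [<-|] /=; case: (rank_match _ _ _ _); rewrite ?mulr1 ?mulr0 ?mul0r.
by move=> y yx; rewrite !mxE eq_sym (negPf yx) mul0r.
Qed.

Lemma expr_mul0 A B l : A * B = 0 -> A ^+ l.+1 * B = 0.
Proof. by move=> AB; rewrite exprSr -mulrA AB mulr0. Qed.

(** Under a monotone partial map an orbit always goes up, always goes down or stays, so all mixed
    products vanish. *)
Lemma Phi_expr I J l : Phi I J ^+ l.+1 = Phi_up I J ^+ l.+1 + Phi_dn I J ^+ l.+1 + Phi_eq I J.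
Proof.
have lt1 x y z (h1 : rank_match I J x y) (h2 : rank_match I J y z) : (x < y)%N = (y < z)%N.
  exact: rank_match_lt h1 h2.
have lt2 x y z (h1 : rank_match I J x y) (h2 : rank_match I J y z) : (y < x)%N = (z < y)%N.
  exact: rank_match_lt h2 h1.
have ud : Phi_up I J * Phi_dn I J = 0.
  apply: match_mx_mul0 => x y z h1 h2; rewrite /lt_ord /gt_ord (lt1 _ _ _ h1 h2) => a b.
  by rewrite ltnNge (ltnW a) in b.
have du : Phi_dn I J * Phi_up I J = 0.
  apply: match_mx_mul0 => x y z h1 h2; rewrite /lt_ord /gt_ord (lt2 _ _ _ h1 h2) => a b.
  by rewrite ltnNge (ltnW a) in b.
have ue : Phi_up I J * Phi_eq I J = 0.
  apply: match_mx_mul0 => x y z h1 h2; rewrite /lt_ord (lt1 _ _ _ h1 h2) => a /eqP b.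
  by rewrite b ltnn in a.
have de : Phi_dn I J * Phi_eq I J = 0.
  apply: match_mx_mul0 => x y z h1 h2; rewrite /gt_ord (lt2 _ _ _ h1 h2) => a /eqP b.
  by rewrite b ltnn in a.
have eu : Phi_eq I J * Phi_up I J = 0.
  apply: match_mx_mul0 => x y z h1 h2; rewrite /lt_ord -(lt1 _ _ _ h1 h2) => /eqP -> .
  by rewrite ltnn.
have ed : Phi_eq I J * Phi_dn I J = 0.
  apply: match_mx_mul0 => x y z h1 h2; rewrite /gt_ord -(lt2 _ _ _ h1 h2) => /eqP ->.
  by rewrite ltnn.
elim: l => [|l IH]; first by rewrite !expr1 Phi_split.
rewrite exprSr IH Phi_split !mulrDl !mulrDr.
have ee : Phi_eq I J * Phi_eq I J = Phi_eq I J by rewrite -expr2 Phi_eq_idem.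
by rewrite !(expr_mul0 _ ud, expr_mul0 _ du, expr_mul0 _ ue, expr_mul0 _ de) eu ed ee -!exprSr !(addr0, add0r).
Qed.

Lemma Phi_up_row I J l y : (ones^T *m Phi_up I J ^+ l) 0 y = up R I J l y.
Proof.
elim: l y => [|l IH] y; first by rewrite expr0 mulmx1 !mxE.
rewrite exprSr mulmxA mxE /= [RHS]big_mkcond; apply: eq_bigr => x _.
by rewrite IH mxE; case: (lt_ord x y && _); rewrite ?mulr1 ?mulr0.
Qed.

Lemma total_Phi_up I J l : total (Phi_up I J ^+ l) = upsum R I J l.
Proof. by rewrite /total mxE; apply: eq_bigr => y _; rewrite Phi_up_row mxE mulr1. Qed.

Lemma Phi_dnE I J : Phi_dn I J = (Phi_up J I)^T.
Proof. by apply/matrixP => x y; rewrite !mxE rank_matchC. Qed.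

Definition fixcount I J : R := \tr (Phi I J).

Lemma fixcountE I J : fixcount I J = (fixes (bits I) (bits J))%:R.
Proof. by rewrite fixes_bits natr_sum; apply: eq_bigr => x _; rewrite mxE. Qed.

Lemma total_Phi_eq I J : total (Phi_eq I J) = fixcount I J.
Proof.
rewrite totalE; apply: eq_bigr => x _; rewrite (bigD1 x) //= big1 ?addr0 => [|y yx].
  by rewrite !mxE eqxx.
by rewrite mxE eq_sym (negPf yx).
Qed.

(* The number of points on which the l-th iterate of the increasing bijection I -> J is defined. *)
Definition chain_total I J l : R := total (Phi I J ^+ l).

Lemma chain_totalS I J l :
  chain_total I J l.+1 = upsum R I J l.+1 + upsum R J I l.+1 + fixcount I J.
Proof.
by rewrite /chain_total Phi_expr !totalD total_Phi_up Phi_dnE -trmx_expr total_tr total_Phi_up total_Phi_eq.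
Qed.

Lemma chain_total0 I J : chain_total I J 0 = n%:R.
Proof.
rewrite /chain_total expr0 totalE (eq_bigr (fun=> 1)) ?sumr_const ?card_ord // => x _.
rewrite (bigD1 x) //= big1 ?addr0 ?mxE ?eqxx // => y yx.
by rewrite mxE eq_sym (negPf yx).
Qed.

Lemma chain_total1 I J : #|I| = #|J| -> chain_total I J 1 = #|I|%:R.
Proof.
move=> cIJ; rewrite /chain_total expr1 totalE -sum1_card natr_sum [RHS]big_mkcond; apply: eq_bigr => x _.
under eq_bigr do rewrite mxE; rewrite sum_rank_match //; by case: (x \in I).
Qed.

Lemma Phi_up_expr_lt I J l x y : (y <= x)%N -> (Phi_up I J ^+ l.+1) x y = 0.
Proof.
elim: l y => [|l IH] y yx.
  by rewrite expr1 mxE /lt_ord ltnNge yx.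
rewrite exprSr mxE big1 // => z _; have [zx|xz] := leqP z x; first by rewrite IH ?mul0r.
by rewrite [Phi_up I J z y]mxE /lt_ord ltnNge (leq_trans yx (ltnW xz)) mulr0.
Qed.

(** Upward and downward chains never close, so only fixed points return. *)
Lemma trace_Phi_expr I J l : \tr (Phi I J ^+ l.+1) = fixcount I J.
Proof.
rewrite Phi_expr !mxtraceD Phi_dnE -trmx_expr mxtrace_tr /mxtrace.
rewrite [X in X + _ + _]big1 => [|x _]; last by rewrite Phi_up_expr_lt.
rewrite [X in _ + X + _]big1 => [|x _]; last by rewrite Phi_up_expr_lt.
by rewrite !add0r; apply: eq_bigr => x _; rewrite !mxE eqxx.
Qed.

Lemma fixcount_ge0 I J : 0 <= fixcount I J.
Proof. by rewrite fixcountE. Qed.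

(** Upward chains, downward chains and fixed points are treated separately, the last leaving the
    drift (1 - t) f. For l = 0 the difference vanishes, as phi is defined on k = t n points. *)
Lemma chain_step_sqr I J l k : (0 < n)%N -> #|I| = k -> #|J| = k ->
  (chain_total I J l.+1 - k%:R / n%:R * chain_total I J l) ^+ 2 <=
  (if l is l'.+1 then
     3 * (upsum R I J l.+1 - k%:R / n%:R * upsum R I J l) ^+ 2 +
     3 * (upsum R J I l.+1 - k%:R / n%:R * upsum R J I l) ^+ 2 else 0) + 3 * fixcount I J ^+ 2.
Proof.
move=> n0 cI cJ; have cIJ : #|I| = #|J| by rewrite cI.
case: l => [|l].
  rewrite chain_total1 // chain_total0 cI divfK ?pnatr_eq0 -?lt0n // subrr expr0n /= add0r.
  by rewrite mulr_ge0 ?sqr_ge0.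
rewrite !chain_totalS.
have kn : (k <= n)%N by rewrite -cI -[X in (_ <= X)%N]card_ord max_card.
have : 0 <= (k%:R / n%:R : R) <= 1 by apply: cprob_range.
move: (k%:R / n%:R : R) (fixcount I J) => t f t01.
set a := upsum R I J l.+2; set a' := upsum R I J l.+1.
set b := upsum R J I l.+2; set b' := upsum R J I l.+1.
have -> : a + b + f - t * (a' + b' + f) = (a - t * a') + (b - t * b') + (1 - t) * f by ring.
move: (a - t * a') (b - t * b') => A B.
have h : ((1 - t) * f) ^+ 2 <= f ^+ 2.
  rewrite exprMn ler_piMl ?sqr_ge0 // exprn_ile1 //; lra.
move: ((1 - t) * f) h => D h.
have := sqr_ge0 (A - B); have := sqr_ge0 (A - D); have := sqr_ge0 (B - D).
rewrite !sqrrB => h1 h2 h3.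
have -> : (A + B + D) ^+ 2 = A ^+ 2 + B ^+ 2 + D ^+ 2 + A * B *+ 2 + A * D *+ 2 + B * D *+ 2 by ring.
lra.
Qed.

(** 108 = 3 (18 + 18): upward chains with J fixed and, exchanging I and J, downward chains with I
    fixed. *)
Lemma sum_chain_step_sqr k l (F : R) : (0 < n)%N ->
  \sum_(I : {set 'I_n} | #|I| == k) \sum_(J : {set 'I_n} | #|J| == k) fixcount I J ^+ 2
     <= F * 'C(n, k)%:R ^+ 2 ->
  \sum_(I : {set 'I_n} | #|I| == k) \sum_(J : {set 'I_n} | #|J| == k)
     (chain_total I J l.+1 - k%:R / n%:R * chain_total I J l) ^+ 2
     <= (108 * n%:R + 3 * F) * 'C(n, k)%:R ^+ 2.
Proof.
move=> n0 hF; set t := k%:R / n%:R.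
have cardC c : \sum_(J : {set 'I_n} | #|J| == k) c = c * 'C(n, k)%:R :> R.
  by rewrite (sum_bits n k (fun=> c)) wsum_cst.
pose A I J l' := (upsum R I J l'.+2 - t * upsum R I J l'.+1) ^+ 2.
have hA l' : \sum_(I : {set 'I_n} | #|I| == k) \sum_(J : {set 'I_n} | #|J| == k) A I J l'
    <= 18 * n%:R * 'C(n, k)%:R ^+ 2.
  rewrite exchange_big /= expr2 mulrA -cardC; apply: ler_sum => J /eqP cJ.
  exact: sum_upsum_sqr.
have hA' l' : \sum_(I : {set 'I_n} | #|I| == k) \sum_(J : {set 'I_n} | #|J| == k) A J I l'
    <= 18 * n%:R * 'C(n, k)%:R ^+ 2 by rewrite exchange_big.
have pos : 0 <= 108 * n%:R * 'C(n, k)%:R ^+ 2 :> R by rewrite !mulr_ge0 ?sqr_ge0.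
apply: (@le_trans _ _ (\sum_(I : {set 'I_n} | #|I| == k) \sum_(J : {set 'I_n} | #|J| == k)
   ((if l is l'.+1 then 3 * A I J l' + 3 * A J I l' else 0) + 3 * fixcount I J ^+ 2))).
  apply: ler_sum => I /eqP cI; apply: ler_sum => J /eqP cJ.
  by have := chain_step_sqr l n0 cI cJ; case: l.
under eq_bigr do rewrite big_split /= -mulr_sumr.
rewrite big_split /= -mulr_sumr.
set X := (X in X + _ <= _); set S := \sum_(I | _) _ in hF *.
have hX : X <= 108 * n%:R * 'C(n, k)%:R ^+ 2.
  rewrite /X; case: l {X} => [|l]; first by rewrite big1 // => I _; rewrite big1.
  under eq_bigr do rewrite big_split /= -!mulr_sumr.
  rewrite big_split /= -!mulr_sumr.
  have := hA l; have := hA' l; lra.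
move: ('C(n, k)%:R ^+ 2) hF hX => c hF hX; lra.
Qed.

End MatchMatrix.

(** * Closed walks and collisions *)

Section StepMatrix.
Variable R : realType.
Variables (n k : nat) (I J : {set 'I_n}).
Hypotheses (cI : #|I| = k) (cJ : #|J| = k) (kn : (k < n)%N).
Implicit Types (l m i j : nat) (A B : 'M[R]_n) (x y z : 'I_n).

Local Notation ones := (ones R n).
Local Notation Phi := (Phi R I J).
Let N : R := n%:R - k%:R.
Let t : R := k%:R / n%:R.

Definition unmarked (K : {set 'I_n}) : 'cV[R]_n := \col_x (x \notin K)%:R.
Local Notation u := (unmarked I).
Local Notation v := (unmarked J)^T.

(* The conditional expectation of the permutation matrix of a uniform permutation extending the
   increasing bijection from I to J. *)
Definition step_mx : 'M[R]_n := Phi + N^-1 *: (u *m v).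
Local Notation M := step_mx.

Lemma N_gt0 : 0 < N.
Proof. by rewrite subr_gt0 ltr_nat. Qed.

Definition mx_le A B := forall x y, A x y <= B x y.

Lemma mx_le_mul A B (C D : 'M[R]_n) : mx_le 0 A -> mx_le 0 C -> mx_le A B -> mx_le C D ->
  mx_le (A * C) (B * D).
Proof.
move=> A0 C0 AB CD x y; rewrite !mxE; apply: ler_sum => z _.
by apply: ler_pM => //; [have := A0 x z|have := C0 z y]; rewrite mxE.
Qed.

Lemma mx_ge0_mul A B : mx_le 0 A -> mx_le 0 B -> mx_le 0 (A * B).
Proof.
move=> A0 B0 x y; rewrite !mxE; apply: sumr_ge0 => z _.
by apply: mulr_ge0; [have := A0 x z|have := B0 z y]; rewrite mxE.
Qed.

Lemma mx_ge0_exp A l : mx_le 0 A -> mx_le 0 (A ^+ l).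
Proof.
move=> A0; elim: l => [|l IH]; last by rewrite exprS; apply: mx_ge0_mul.
by move=> x y; rewrite expr0 !mxE.
Qed.

Lemma mx_le_exp A B l : mx_le 0 A -> mx_le A B -> mx_le (A ^+ l) (B ^+ l).
Proof.
move=> A0 AB; elim: l => [|l IH]; first by rewrite !expr0 => x y.
by rewrite !exprS; apply: mx_le_mul => //; apply: mx_ge0_exp.
Qed.

Lemma Phi_ge0 : mx_le 0 Phi.
Proof. by move=> x y; rewrite !mxE. Qed.

Lemma Phi_le_M : mx_le Phi M.
Proof.
move=> x y; rewrite [M x y]mxE lerDl mxE mulr_ge0 ?invr_ge0 ?(ltW N_gt0) // mxE.
by apply: sumr_ge0 => i _; rewrite !mxE mulr_ge0.
Qed.

Lemma M_ge0 : mx_le 0 M.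
Proof. by move=> x y; apply: le_trans (Phi_le_M x y); apply: Phi_ge0. Qed.

Lemma Phi_ones : Phi *m ones = ones - u.
Proof.
apply/matrixP => x y; rewrite !mxE; under eq_bigr do rewrite !mxE mulr1.
rewrite sum_rank_match ?cI ?cJ //; by case: (x \in I); rewrite ?subr0 ?subrr.
Qed.

Lemma ones_Phi : ones^T *m Phi = ones^T - v.
Proof.
apply/matrixP => x y; rewrite !mxE; under eq_bigr do rewrite !mxE mul1r rank_matchC.
rewrite sum_rank_match ?cI ?cJ //; by case: (y \in J); rewrite ?subr0 ?subrr.
Qed.

Lemma sum_unmarked (K : {set 'I_n}) : #|K| = k -> \sum_(x : 'I_n) (x \notin K)%:R = N.
Proof.
move=> cK; rewrite -natr_sum /N -(natrB _ (ltnW kn)); congr (_%:R).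
have -> : (n - k = #|~: K|)%N by rewrite cardsCs finset.setCK cK card_ord.
by rewrite -sum1_card [RHS]big_mkcond; apply: eq_bigr => x _; rewrite inE; case: (x \in K).
Qed.

Lemma v_ones : v *m ones = N%:M.
Proof.
apply/matrixP => x y; rewrite !mxE !ord1 eqxx mulr1n -(sum_unmarked cJ).
by apply: eq_bigr => z _; rewrite !mxE mulr1.
Qed.

Lemma ones_u : ones^T *m u = N%:M.
Proof.
apply/matrixP => x y; rewrite !mxE !ord1 eqxx mulr1n -(sum_unmarked cI).
by apply: eq_bigr => z _; rewrite !mxE mul1r.
Qed.

Lemma M_ones : M *m ones = ones.
Proof.
rewrite mulmxDl Phi_ones -scalemxAl -mulmxA v_ones mul_mx_scalar scalerA mulVf ?gt_eqF ?N_gt0 //.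
by rewrite scale1r subrK.
Qed.

Lemma ones_M : ones^T *m M = ones^T.
Proof.
rewrite mulmxDr ones_Phi -scalemxAr mulmxA ones_u mul_scalar_mx scalerA mulVf ?gt_eqF ?N_gt0 //.
by rewrite scale1r subrK.
Qed.

Lemma Mexp_ones l : M ^+ l *m ones = ones.
Proof. by elim: l => [|l IH]; rewrite ?expr0 ?mul1mx // exprSr -mulmxA M_ones. Qed.

Lemma ones_Mexp l : ones^T *m M ^+ l = ones^T.
Proof. by elim: l => [|l IH]; rewrite ?expr0 ?mulmx1 // exprS mulmxA ones_M. Qed.

Lemma Mexp_col l y : \sum_x (M ^+ l) x y = 1.
Proof.
have := congr1 (fun A : 'rV[R]_n => A 0 y) (ones_Mexp l); rewrite !mxE => <-.
by apply: eq_bigr => x _; rewrite !mxE mul1r.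
Qed.

(** Total weight from the points without preimage under phi to the points without image. *)
Definition between A : R := (v *m A *m u) 0 0.

Lemma betweenE A : between A = \sum_x \sum_y (x \notin J)%:R * A x y * (y \notin I)%:R.
Proof.
rewrite /between mxE exchange_big; apply: eq_bigr => y _; rewrite !mxE mulr_suml.
by apply: eq_bigr => x _; rewrite !mxE.
Qed.

(** Among the N maximal chains that start outside J and stop outside I, the proportion of those with
    exactly [l] steps. *)
Definition chain_freq l : R := between (Phi ^+ l) / N.
(** Probability that a walk from a uniform point outside J, after [m] steps of [M], follows phi for
    [i] steps and ends outside I. *)
Definition renewal m i : R := between (M ^+ m * Phi ^+ i) / N.

(** The indicators of the complements of J and I are differences of the all-ones vector and its
    image under Phi, on the left and on the right; together they give a second difference. *)
Lemma chain_freqE l : chain_freq l =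
  (chain_total R I J l - 2 * chain_total R I J l.+1 + chain_total R I J l.+2) / N.
Proof.
congr (_ / N); rewrite /between.
have -> : v = ones^T - ones^T *m Phi by rewrite ones_Phi opprB addrC subrK.
have -> : u = ones - Phi *m ones by rewrite Phi_ones opprB addrC subrK.
rewrite mulmxBl mulmxBr mulmxBl mulmxBl !mulmxA.
rewrite -(mulmxA _ Phi (Phi ^+ l)) -[Phi *m Phi ^+ l]/(Phi * Phi ^+ l) -exprS.
rewrite -!(mulmxA _ (_ ^+ _) Phi) -![_ ^+ _ *m Phi]/(_ ^+ _ * Phi) -!exprSr.
rewrite /chain_total /total !mxE.
ring.
Qed.

Lemma M_sub_Phi : M - Phi = N^-1 *: (u *m v).
Proof. by rewrite /step_mx addrC addKr. Qed.

Lemma between_M_le A : mx_le 0 A -> (forall x, (A *m ones) x 0 <= 1) -> 0 <= between A <= N.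
Proof.
move=> A0 A1; rewrite betweenE; apply/andP; split.
  apply: sumr_ge0 => x _; apply: sumr_ge0 => y _; rewrite !mulr_ge0 //.
  by have := A0 x y; rewrite mxE.
rewrite -(sum_unmarked cJ); apply: ler_sum => x _.
apply: (@le_trans _ _ ((x \notin J)%:R * (A *m ones) x 0)); last by rewrite ler_piMr.
rewrite mxE mulr_sumr; apply: ler_sum => y _; rewrite -mulrA ler_wpM2l //.
have := A0 x y; rewrite !mxE => Axy; rewrite ler_wpM2l //; by case: (y \notin I).
Qed.

Lemma MPhi_le m i : mx_le (M ^+ m * Phi ^+ i) (M ^+ (m + i)).
Proof.
rewrite exprD; apply: mx_le_mul.
- exact: mx_ge0_exp M_ge0.
- exact: mx_ge0_exp Phi_ge0.
- by move=> x y.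
- exact: mx_le_exp Phi_ge0 Phi_le_M.
Qed.

Lemma renewal_range m i : 0 <= renewal m i <= 1.
Proof.
have /andP[h1 h2] : 0 <= between (M ^+ m * Phi ^+ i) <= N.
  apply: between_M_le.
    by apply: mx_ge0_mul; apply: mx_ge0_exp; [exact: M_ge0|exact: Phi_ge0].
  move=> x; have := congr1 (fun A : 'cV[R]_n => A x 0) (Mexp_ones (m + i)); rewrite [ones x 0]mxE => <-.
  rewrite [leLHS]mxE [leRHS]mxE; apply: ler_sum => y _; apply: ler_wpM2r; last exact: MPhi_le.
  by rewrite mxE.
by rewrite /renewal divr_ge0 ?(ltW N_gt0) //= ler_pdivrMr ?N_gt0 // mul1r.
Qed.

Lemma renewal0 i : renewal 0 i = chain_freq i.
Proof. by rewrite /renewal expr0 mul1r. Qed.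

(** The last of the [M] steps either follows phi or jumps from outside I to a uniform point outside
    J, where the walk starts afresh. *)
Lemma renewalS m i : renewal m.+1 i = renewal m i.+1 + renewal m 0 * chain_freq i.
Proof.
rewrite /renewal /chain_freq expr0 mulr1 exprSr -mulrA {1}/step_mx [_ * Phi ^+ i]mulrDl.
rewrite mulrDr -exprS /between mulmxDr mulmxDl mxE mulrDl; congr (_ + _).
have N0 : N != 0 by rewrite gt_eqF ?N_gt0.
have -> : v *m (M ^+ m * (N^-1 *: (u *m v) * Phi ^+ i)) *m u =
   N^-1 *: ((v *m M ^+ m *m u) *m (v *m Phi ^+ i *m u)).
  by rewrite -!mulmxE -scalemxAl -scalemxAr -scalemxAr -scalemxAl !mulmxA.
rewrite mxE; set X := v *m M ^+ m *m u. set Z := v *m Phi ^+ i *m u. rewrite [(X *m Z) 0 0]mxE big_ord1; by field.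
Qed.

Definition freq_dev l : R := chain_freq l - (1 - t) * t ^+ l.

Lemma t_range : 0 <= t <= 1.
Proof. by apply: cprob_range; apply: ltnW. Qed.

(** The law (1 - t) t^i solves the renewal recursion exactly: (1 - t) t^(i+1) + (1 - t) (1 - t) t^i
    = (1 - t) t^i. Each step adds up three errors, whence 3^m. *)
Lemma renewal_dev K m i : (m + i < K)%N ->
  `|renewal m i - (1 - t) * t ^+ i| <= 3 ^+ m * \sum_(l < K) `|freq_dev l|.
Proof.
set D := \sum_(l < K) _.
have D0 : 0 <= D by apply: sumr_ge0.
have dD i' : (i' < K)%N -> `|freq_dev i'| <= D.
  by move=> iK; rewrite /D (bigD1 (Ordinal iK)) //= lerDl sumr_ge0.
elim: m i => [|m IH] i miK; first by rewrite renewal0 expr0 mul1r dD.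
rewrite renewalS.
have -> : renewal m i.+1 + renewal m 0 * chain_freq i - (1 - t) * t ^+ i =
  (renewal m i.+1 - (1 - t) * t ^+ i.+1) + (renewal m 0 - (1 - t) * t ^+ 0) * chain_freq i
   + (1 - t) * freq_dev i by rewrite /freq_dev exprS expr0; ring.
have h1 := IH i.+1; rewrite addnS in h1; have {}h1 := h1 miK.
have h0 : `|renewal m 0 - (1 - t) * t ^+ 0| <= 3 ^+ m * D by apply: IH; lia.
have hi : `|freq_dev i| <= D by apply: dD; lia.
have /andP[c0 c1] : 0 <= chain_freq i <= 1 by rewrite -renewal0 renewal_range.
have /andP[t0 t1] := t_range.
have m3 : 1 <= 3 ^+ m :> R by rewrite exprn_ege1 // ler1n.
apply: le_trans (ler_normD _ _) _.
have -> : 3 ^+ m.+1 * D = (3 ^+ m * D + 3 ^+ m * D) + 3 ^+ m * D by rewrite exprS; ring.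
apply: lerD.
  apply: le_trans (ler_normD _ _) _; apply: lerD => //.
  by rewrite normrM -[leRHS]mulr1 ler_pM // ger0_norm.
rewrite normrM ler_pM // ger0_norm; lra.
Qed.

Definition closed_gap j : R := \tr (M ^+ j - Phi ^+ j).

(** The closed walk is cut at its first step outside phi, after l steps along it, and cyclicity of
    the trace moves those l steps to the end. The factor Phi^i generalizes the claim for the
    induction. *)
Lemma trace_Phi_gap i j : \tr (Phi ^+ i * (M ^+ j - Phi ^+ j)) =
  \sum_(l < j) renewal (j - l.+1) (i + l).
Proof.
elim: j i => [|j IH] i; first by rewrite big_ord0 !expr0 subrr mulr0 mxtrace0.
rewrite big_ord_recl /= subn1 /= addn0.
have -> : M ^+ j.+1 - Phi ^+ j.+1 = (M - Phi) * M ^+ j + Phi * (M ^+ j - Phi ^+ j).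
  by rewrite !exprS mulrBl mulrBr addrA subrK.
rewrite mulrDr mxtraceD; congr (_ + _); last first.
  by rewrite mulrA -exprSr IH; apply: eq_bigr => l _; rewrite /bump /= !add1n !subSS addSnnS.
rewrite M_sub_Phi /renewal -!mulmxE -!scalemxAl -scalemxAr linearZ /= mulrC; congr (_ * _).
have -> : Phi ^+ i *m (u *m v *m M ^+ j) = (Phi ^+ i *m u) *m (v *m M ^+ j) by rewrite !mulmxA.
by rewrite mxtrace_mulC /mxtrace big_ord1 /between !mulmxA.
Qed.

Lemma closed_gapE j : closed_gap j = \sum_(l < j) renewal (j - l.+1) l.
Proof.
by have := trace_Phi_gap 0 j; rewrite expr0 mul1r /closed_gap => ->; apply: eq_bigr.
Qed.

Lemma closed_gap_range j : 0 <= closed_gap j <= j%:R.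
Proof.
rewrite closed_gapE; apply/andP; split.
  by apply: sumr_ge0 => l _; case/andP: (renewal_range (j - l.+1) l).
rewrite -[leRHS]mulr1 -[j in j%:R]card_ord -sumr_const mulr_suml; apply: ler_sum => l _.
by rewrite mul1r; case/andP: (renewal_range (j - l.+1) l).
Qed.

(** The limits (1 - t) t^l of the terms, for l < j, add up to 1 - t^j. *)
Lemma closed_gap_dev j :
  `|closed_gap j - (1 - t ^+ j)| <= j%:R * 3 ^+ j * \sum_(l < j) `|freq_dev l|.
Proof.
have -> : 1 - t ^+ j = \sum_(l < j) (1 - t) * t ^+ l.
  by rewrite -mulr_sumr -opprB subrX1 -mulNr opprB.
rewrite closed_gapE -sumrB; apply: le_trans (ler_norm_sum _ _ _) _.
rewrite -mulrA; set D := \sum_(l < j) `|_|.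
have D0 : 0 <= D by apply: sumr_ge0.
have -> : j%:R * (3 ^+ j * D) = \sum_(l < j) 3 ^+ j * D by rewrite sumr_const card_ord mulr_natl.
apply: ler_sum => l _; have lj : (j - l.+1 + l < j)%N by case: l => l /= lj; lia.
apply: le_trans (renewal_dev lj) _; rewrite ler_wpM2r // ler_weXn2l ?ler1n //.
by rewrite leq_subr.
Qed.

Lemma Mexp_row l x : \sum_y (M ^+ l) x y = 1.
Proof.
have := congr1 (fun A : 'cV[R]_n => A x 0) (Mexp_ones l); rewrite !mxE => <-.
by apply: eq_bigr => y _; rewrite !mxE mulr1.
Qed.

(** The first step outside phi is one of j. It leads to a uniform point outside J, from which the
    doubly stochastic [M] reaches a given point with probability at most 1/N. *)
Lemma gap_range j x y : 0 <= (M ^+ j - Phi ^+ j) x y <= j%:R / N.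
Proof.
have N0 := N_gt0.
elim: j x y => [|j IH] x y; first by rewrite !expr0 subrr mxE mul0r lexx.
have -> : M ^+ j.+1 - Phi ^+ j.+1 = (M - Phi) * M ^+ j + Phi * (M ^+ j - Phi ^+ j).
  by rewrite !exprS mulrBl mulrBr addrA subrK.
have h1 : 0 <= ((M - Phi) * M ^+ j) x y <= N^-1.
  rewrite M_sub_Phi -mulmxE -scalemxAl mxE -mulmxA mxE big_ord1 [u x 0]mxE.
  have /andP[v0 v1] : 0 <= (v *m M ^+ j) 0 y <= 1.
    rewrite mxE -(Mexp_col j y); apply/andP; split.
      by apply: sumr_ge0 => z _; rewrite !mxE mulr_ge0 //; have := mx_ge0_exp j M_ge0 z y; rewrite mxE.
    apply: ler_sum => z _; rewrite !mxE ler_piMl //; last by case: (z \notin J).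
    by have := mx_ge0_exp j M_ge0 z y; rewrite mxE.
  rewrite mulr_ge0 ?invr_ge0 ?(ltW N0) ?mulr_ge0 //=.
  rewrite ler_piMr ?invr_ge0 ?(ltW N0) //; by case: (x \notin I); rewrite ?mul1r ?mul0r.
have h2 : 0 <= (Phi * (M ^+ j - Phi ^+ j)) x y <= j%:R / N.
  rewrite mxE; apply/andP; split.
    apply: sumr_ge0 => z _; rewrite mulr_ge0 //; first by rewrite mxE.
    by case/andP: (IH z y).
  apply: (@le_trans _ _ (\sum_z M x z * (j%:R / N))).
    apply: ler_sum => z _; case/andP: (IH z y) => a b; apply: ler_pM => //; first by rewrite mxE.
    exact: Phi_le_M.
  by rewrite -mulr_suml; have := Mexp_row 1 x; rewrite expr1 => ->; rewrite mul1r.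
have -> : j.+1%:R / N = N^-1 + j%:R / N by rewrite -natr1; ring.
rewrite mxE.
by case/andP: h1 => a b; case/andP: h2 => c d; rewrite addr_ge0 //= lerD.
Qed.

Lemma trace_M : \tr M = fixcount R I J + chain_freq 0.
Proof.
rewrite /step_mx mxtraceD; congr (_ + _).
rewrite linearZ /= mxtrace_mulC /chain_freq /between expr0 mulmx1 mulrC; congr (_ * _).
by rewrite /mxtrace big_ord1.
Qed.

Lemma trace_Mexp j : \tr (M ^+ j.+1) <= fixcount R I J + j.+1%:R.
Proof.
have /andP[_] := closed_gap_range j.+1; rewrite /closed_gap raddfB /= trace_Phi_expr; lra.
Qed.

Lemma M_diag x : 0 <= M x x <= 1.
Proof.
apply/andP; split; first by have := M_ge0 x x; rewrite mxE.
have := Mexp_row 1 x; rewrite expr1 => <-; rewrite (bigD1 x) //= lerDl.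
by apply: sumr_ge0 => y _; have := M_ge0 x y; rewrite mxE.
Qed.

(* Closed walks of length i + j that return after i steps, other than those staying on fixed points. *)
Lemma return_gap i j : \sum_x ((M ^+ i.+1) x x * (M ^+ j.+1) x x
    - (Phi ^+ i.+1) x x * (Phi ^+ j.+1) x x) <=
  (i.+1 + j.+1)%:R / N * (fixcount R I J + (i.+1 + j.+1)%:R).
Proof.
have N0 := N_gt0.
have gap l x : (M ^+ l) x x - (Phi ^+ l) x x <= l%:R / N.
  by have /andP[_] := gap_range l x x; rewrite !mxE.
have f0 := fixcount_ge0 R I J.
apply: (@le_trans _ _ (\sum_x (i.+1%:R / N * (M ^+ j.+1) x x + j.+1%:R / N * (Phi ^+ i.+1) x x))).
  apply: ler_sum => x _.
  have M0 := mx_ge0_exp j.+1 M_ge0 x x; have P0 := mx_ge0_exp i.+1 Phi_ge0 x x.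
  rewrite !mxE in M0 P0; move: (gap i.+1 x) (gap j.+1 x) M0 P0.
  move: ((M ^+ i.+1) x x) ((M ^+ j.+1) x x) ((Phi ^+ i.+1) x x) ((Phi ^+ j.+1) x x).
  move: (i.+1%:R / N) (j.+1%:R / N) => p q a b c d h1 h2 b0 c0.
  have -> : a * b - c * d = (a - c) * b + (b - d) * c by ring.
  by apply: lerD; apply: ler_wpM2r.
rewrite big_split /= -!mulr_sumr.
have tM : \sum_x (M ^+ j.+1) x x <= fixcount R I J + (i.+1 + j.+1)%:R.
  by apply: le_trans (trace_Mexp j) _; rewrite lerD2l ler_nat leq_addl.
have tP : \sum_x (Phi ^+ i.+1) x x <= fixcount R I J + (i.+1 + j.+1)%:R.
  by rewrite -/(\tr (Phi ^+ i.+1)) trace_Phi_expr lerDl.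
move: (fixcount R I J + (i.+1 + j.+1)%:R) tM tP => X tM tP.
have -> : (i.+1 + j.+1)%:R / N * X = i.+1%:R / N * X + j.+1%:R / N * X by rewrite natrD; ring.
have p0 l : 0 <= l%:R / N by rewrite divr_ge0 ?(ltW N0).
by apply: lerD; apply: ler_wpM2l.
Qed.

End StepMatrix.

(** * Weights of cyclic words *)

Section CyclicWeights.
Variable R : realType.
Variable n : nat.
Implicit Types (l : nat) (A : 'M[R]_n) (x y z : 'I_n) (c s : seq 'I_n).

Definition cycw A c : R := \prod_(p <- zip c (rot 1 c)) A p.1 p.2.

Fixpoint pathw A x s y : R := if s is z :: s' then A x z * pathw A z s' y else A x y.

Lemma cycw_path A x s : cycw A (x :: s) = pathw A x s x.
Proof.
rewrite /cycw rot1_cons; move: {2 4}x => y.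
elim: s x => [|z s IH] x /=; first by rewrite big_seq1.
by rewrite big_cons -IH.
Qed.

Lemma sum_pathw A l x y : \sum_(s : l.-tuple 'I_n) pathw A x s y = (A ^+ l.+1) x y.
Proof.
elim: l x => [|l IH] x; first by rewrite (@sum_tuple0 _ _ (fun s => pathw A x s y)) expr1.
rewrite (@sum_tuple_cons _ _ l (fun s => pathw A x s y)) exprS mxE; apply: eq_bigr => z _ /=.
by rewrite -mulr_sumr IH.
Qed.

Lemma sum_pathw_through A a b x y z x0 :
  \sum_(s : (a + b.+1).-tuple 'I_n) pathw A x s y * (nth x0 s a == z)%:R =
  (A ^+ a.+1) x z * (A ^+ b.+1) z y.
Proof.
elim: a x => [|a IH] x.
  rewrite (@sum_tuple_cons _ _ b (fun s => pathw A x s y * (nth x0 s 0 == z)%:R)) /=.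
  rewrite (bigD1 z) //= [X in _ + X]big1 ?addr0 => [|x' xz]; last first.
    by rewrite big1 // => s _; rewrite (negPf xz) mulr0.
  rewrite eqxx expr1 -(sum_pathw A b) mulr_sumr; apply: eq_bigr => s _; by rewrite mulr1.
rewrite (@sum_tuple_cons _ _ (a + b.+1) (fun s => pathw A x s y * (nth x0 s a.+1 == z)%:R)) /=.
rewrite (exprS _ a.+1) mxE mulr_suml; apply: eq_bigr => x' _.
by rewrite -mulrA -IH mulr_sumr; apply: eq_bigr => s _; rewrite mulrA.
Qed.

Lemma zip_rot (S T : Type) (s1 : seq S) (s2 : seq T) i : size s1 = size s2 ->
  zip (rot i s1) (rot i s2) = rot i (zip s1 s2).
Proof.
move=> e; rewrite /rot zip_cat ?size_drop ?e //; congr (_ ++ _).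
  elim: i s1 s2 e => [|i IH] [|a s1] [|b s2] //= [e]; exact: IH.
elim: i s1 s2 e => [|i IH] [|a s1] [|b s2] //= [e]; by rewrite IH.
Qed.

Lemma cycw_rot A c i : cycw A (rot i c) = cycw A c.
Proof. by rewrite /cycw -rot_rot zip_rot ?size_rot //; apply: perm_big; rewrite perm_rot. Qed.

Lemma sum_tuple_rot (T : finType) l i (F : seq T -> R) :
  \sum_(c : l.-tuple T) F (rot i c) = \sum_(c : l.-tuple T) F c.
Proof.
rewrite [RHS](reindex_inj (h := fun c : l.-tuple T => [tuple of rot i c])) //.
by move=> a b /(congr1 val) /= /rot_inj /val_inj.
Qed.

Lemma nth_rot0 (T : Type) (x0 : T) (c : seq T) i e : (i + e < size c)%N ->
  nth x0 (rot i c) e = nth x0 c (i + e).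
Proof. by move=> h; rewrite /rot nth_cat size_drop ltn_subRL h nth_drop. Qed.

(** If a letter repeats, a rotation brings one occurrence to the front. Summing over rotations
    reduces repetitions to returns to the first letter. *)
Lemma nonuniq_le (x0 : 'I_n) l c : size c = l.+1 ->
  (~~ uniq c <= \sum_(i < l.+1) \sum_(e < l) (nth x0 (rot i c) 0 == nth x0 (rot i c) e.+1))%N.
Proof.
move=> sc; case uc: (uniq c) => //=.
have /uniqPn : ~~ uniq c by rewrite uc.
move=> /(_ x0) [i [j [ij js e]]].
have il : (i < l.+1)%N by rewrite -sc (ltn_trans ij).
have jl : (j < l.+1)%N by rewrite -sc.
have el : (j - i.+1 < l)%N by clear - jl ij; lia.
rewrite (bigD1 (Ordinal il)) //= (bigD1 (Ordinal el)) //=.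
have -> : ((j - i.+1).+1 = j - i)%N by clear - ij; lia.
rewrite nth_rot0 ?addn0 ?sc // nth_rot0; last by rewrite subnKC // ltnW.
by rewrite subnKC ?(ltnW ij) // e eqxx.
Qed.

End CyclicWeights.

(** * Lists with repeated points *)

Section Collisions.
Variable R : realType.
Variables (n k : nat) (I J : {set 'I_n}).
Hypotheses (cI : #|I| = k) (cJ : #|J| = k) (kn : (k < n)%N).
Implicit Types (l j : nat) (x y z : 'I_n) (c s : seq 'I_n) (rho : seq nat).

Local Notation Phi := (Phi R I J).
Local Notation M := (step_mx R k I J).
Let N : R := n%:R - k%:R.
Let x0 : 'I_n := Ordinal kn.

(* Walks along the bijection itself are discarded, except at a single point. *)
Definition kap c : R := cycw M c - (size c != 1)%:R * cycw Phi c.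

Definition cycle_sum j : R := if j == 1%N then \tr M else closed_gap R k I J j.
Definition cycle_at j z : R := if j == 1%N then M z z else (M ^+ j - Phi ^+ j) z z.

Lemma cycw_ge0 (A : 'M[R]_n) c : mx_le 0 A -> 0 <= cycw A c.
Proof. by move=> A0; apply: prodr_ge0 => p _; have := A0 p.1 p.2; rewrite mxE. Qed.

Lemma kap_ge0 c : 0 <= kap c.
Proof.
have h : cycw Phi c <= cycw M c.
  apply: ler_prod => p _; have := @Phi_ge0 R n I J p.1 p.2; rewrite mxE => ->.
  exact: Phi_le_M.
have p0 : 0 <= cycw Phi c by apply: cycw_ge0; exact: Phi_ge0.
rewrite /kap subr_ge0; apply: le_trans h; by rewrite ler_piMl //; case: (_ != _).
Qed.

Lemma kap_rot c i : kap (rot i c) = kap c.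
Proof. by rewrite /kap !cycw_rot size_rot. Qed.

Lemma sum_kap_head l z :
  \sum_(c : l.+1.-tuple 'I_n) kap c * (nth x0 c 0 == z)%:R = cycle_at l.+1 z.
Proof.
rewrite (@sum_tuple_cons _ _ l (fun c => kap c * (nth x0 c 0 == z)%:R)) /=.
rewrite (bigD1 z) //= [X in _ + X]big1 ?addr0 => [|x xz]; last first.
  by rewrite big1 // => s _; rewrite (negPf xz) mulr0.
under eq_bigr do rewrite eqxx mulr1 /kap /= size_tuple eqSS !cycw_path.
rewrite sumrB -mulr_sumr !sum_pathw /cycle_at eqSS; case: l => [|l] /=.
  by rewrite expr1 mul0r subr0.
by rewrite mul1r !mxE.
Qed.

Lemma sum_kap_nth l i z : (i < l.+1)%N ->
  \sum_(c : l.+1.-tuple 'I_n) kap c * (nth x0 c i == z)%:R = cycle_at l.+1 z.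
Proof.
move=> il; rewrite -sum_kap_head -(sum_tuple_rot l.+1 i (fun c => kap c * (nth x0 c 0 == z)%:R)).
by apply: eq_bigr => c _; rewrite kap_rot nth_rot0 ?addn0 // size_tuple.
Qed.

Lemma sum_kap l : \sum_(c : l.+1.-tuple 'I_n) kap c = cycle_sum l.+1.
Proof.
transitivity (\sum_z cycle_at l.+1 z).
  under [RHS]eq_bigr do rewrite -sum_kap_head.
  rewrite exchange_big; apply: eq_bigr => c _; rewrite -mulr_sumr (bigD1 (nth x0 c 0)) //= eqxx.
  by rewrite big1 ?addr0 ?mulr1 // => z; rewrite eq_sym => /negPf ->.
by rewrite /cycle_at /cycle_sum /closed_gap /mxtrace; case: eqP.
Qed.

Lemma count_mem_sum c z : count_mem z c = (\sum_(i < size c) (nth x0 c i == z))%N.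
Proof. by rewrite -sum1_count (big_nth x0) big_mkord big_mkcond; apply: eq_bigr => i _ /=; case: eqP. Qed.

Lemma sum_kap_count l z :
  \sum_(c : l.+1.-tuple 'I_n) kap c * (count_mem z c)%:R = l.+1%:R * cycle_at l.+1 z.
Proof.
transitivity (\sum_(i < l.+1) \sum_(c : l.+1.-tuple 'I_n) kap c * (nth x0 c i == z)%:R).
  rewrite exchange_big; apply: eq_bigr => c _; rewrite -mulr_sumr count_mem_sum size_tuple.
  by rewrite natr_sum.
by rewrite (eq_bigr (fun=> cycle_at l.+1 z)) ?sumr_const ?card_ord ?mulr_natl // => i _; apply: sum_kap_nth.
Qed.

(** There are at most (l + 1)^2 pairs of a rotation and a return time; each splits the word into two
    closed walks, to which [return_gap] applies. *)
Lemma sum_kap_nonuniq l :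
  \sum_(c : l.+1.-tuple 'I_n) kap c * (~~ uniq c)%:R <=
  l.+1%:R ^+ 3 / N * (fixcount R I J + l.+1%:R).
Proof.
pose F e c := kap c * (nth x0 c 0 == nth x0 c e.+1)%:R.
have N0 : 0 < N := N_gt0 R kn.
have hF e : (e < l)%N -> \sum_(c : l.+1.-tuple 'I_n) F e c <=
   l.+1%:R / N * (fixcount R I J + l.+1%:R).
  move=> el; have lE : l = (e + (l - e.+1).+1)%N by lia.
  rewrite (@sum_tuple_cons _ _ l (F e)).
  apply: (@le_trans _ _ (\sum_x ((M ^+ e.+1) x x * (M ^+ (l - e.+1).+1) x x
    - (Phi ^+ e.+1) x x * (Phi ^+ (l - e.+1).+1) x x))); last first.
    have -> : l.+1 = (e.+1 + (l - e.+1).+1)%N by lia.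
    exact: return_gap.
  rewrite le_eqVlt; apply/orP; left; apply/eqP; apply: eq_bigr => x _.
  rewrite -!(@sum_pathw_through R n _ e (l - e.+1) x x x x0) -sumrB -lE; apply: eq_bigr => s _.
  rewrite /F /kap /= size_tuple eqSS !cycw_path [x == _]eq_sym (_ : l != 0%N) ?mul1r ?mulrBl //.
  by rewrite -lt0n (leq_ltn_trans _ el).
apply: (@le_trans _ _ (\sum_(i < l.+1) \sum_(e < l) \sum_(c : l.+1.-tuple 'I_n) F e (rot i c))).
  under [leRHS]eq_bigr do rewrite exchange_big.
  rewrite exchange_big; apply: ler_sum => c _; rewrite /F.
  under [leRHS]eq_bigr do under eq_bigr do rewrite kap_rot.
  under [leRHS]eq_bigr do rewrite -mulr_sumr -natr_sum.
  rewrite -mulr_sumr -natr_sum ler_wpM2l ?kap_ge0 // ler_nat.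
  by apply: nonuniq_le; rewrite size_tuple.
apply: (@le_trans _ _ (\sum_(i < l.+1) \sum_(e < l) l.+1%:R / N * (fixcount R I J + l.+1%:R))).
  by apply: ler_sum => i _; apply: ler_sum => e _; rewrite (sum_tuple_rot l.+1 i (F e)) hF.
have sumc m (X : R) : \sum_(i < m) X = m%:R * X by rewrite sumr_const card_ord mulr_natl.
rewrite !sumc.
have -> : l.+1%:R ^+ 3 / N * (fixcount R I J + l.+1%:R) =
   l.+1%:R * (l.+1%:R * (l.+1%:R / N * (fixcount R I J + l.+1%:R))) by ring.
rewrite ler_wpM2l // ler_wpM2r ?ler_nat // mulr_ge0 ?divr_ge0 ?(ltW N0) // addr_ge0 //.
exact: fixcount_ge0.
Qed.

(** Lists of words with lengths [rho] are summed over by nested sums over tuples, which keeps the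
    summand a function on untyped lists. *)
Fixpoint sumw rho (F : seq (seq 'I_n) -> R) : R :=
  if rho is j :: rho' then \sum_(c : j.-tuple 'I_n) sumw rho' (fun cs => F (tval c :: cs))
  else F [::].

Lemma sumwD rho F G : sumw rho (fun cs => F cs + G cs) = sumw rho F + sumw rho G.
Proof.
elim: rho F G => [|j rho IH] F G //=; rewrite -big_split; apply: eq_bigr => c _; exact: IH.
Qed.

Lemma sumwZ rho a F : sumw rho (fun cs => a * F cs) = a * sumw rho F.
Proof.
elim: rho F => [|j rho IH] F //=; rewrite mulr_sumr; apply: eq_bigr => c _; exact: IH.
Qed.

Lemma sumw_sum (T : finType) rho (F : T -> seq (seq 'I_n) -> R) :
  sumw rho (fun cs => \sum_i F i cs) = \sum_i sumw rho (F i).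
Proof.
elim: rho F => [|j rho IH] F //=; rewrite exchange_big; apply: eq_bigr => c _; exact: IH.
Qed.

Lemma sumw_le rho F G : (forall cs, map size cs = rho -> F cs <= G cs) -> sumw rho F <= sumw rho G.
Proof.
elim: rho F G => [|j rho IH] F G h /=; first exact: h.
by apply: ler_sum => c _; apply: IH => cs hcs; apply: h; rewrite /= size_tuple hcs.
Qed.

Lemma eq_sumw rho F G : (forall cs, map size cs = rho -> F cs = G cs) -> sumw rho F = sumw rho G.
Proof.
by move=> h; apply/eqP; rewrite eq_le; apply/andP; split; apply: sumw_le => cs /h ->.
Qed.

Definition kapw (cs : seq (seq 'I_n)) : R := \prod_(c <- cs) kap c.

Lemma kapw_ge0 cs : 0 <= kapw cs.
Proof. by apply: prodr_ge0 => c _; apply: kap_ge0. Qed.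

Lemma sumw_kapw rho : 0%N \notin rho -> sumw rho kapw = \prod_(j <- rho) cycle_sum j.
Proof.
elim: rho => [|[//|l] rho IH]; first by rewrite /kapw /= !big_nil.
rewrite inE /= => rho0; rewrite big_cons -IH // -sum_kap mulr_suml; apply: eq_bigr => c _.
by rewrite -sumwZ; apply: eq_sumw => cs _; rewrite /kapw big_cons.
Qed.

(** The added 1 makes powers monotone in the exponent and lets this bound the trace of [M]. *)
Definition fix1 : R := fixcount R I J + 1.
(* The value 0 at m = 0 matters: there is no error of order 1 when rho has no part equal to 1. *)
Definition fixpred m : R := if m is m'.+1 then fix1 ^+ m' else 0.
Local Notation g := fix1.
Local Notation e := fixpred.
Local Notation m1 := (count_mem 1%N).

Lemma fix1_ge1 : 1 <= g.
Proof. by rewrite lerDr fixcount_ge0. Qed.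

Lemma fixpred_ge0 m : 0 <= e m.
Proof. by case: m => [|m] //=; rewrite exprn_ge0 // (le_trans ler01 fix1_ge1). Qed.

Lemma fixpred_mul m : g * e m <= e m.+1.
Proof.
case: m => [|m] /=; first by rewrite mulr0 exprn_ge0 // (le_trans ler01 fix1_ge1).
by rewrite exprS.
Qed.

Lemma cycle_sum_range j : 0 <= cycle_sum j <= (if j == 1%N then g else j%:R).
Proof.
rewrite /cycle_sum; case: eqP => _; last exact: closed_gap_range.
rewrite trace_M // -renewal0 /g.
have /andP[a b] := renewal_range R cI cJ kn 0 0; have := fixcount_ge0 R I J; lra.
Qed.

Lemma cycle_at_range j z : 0 <= cycle_at j z <= (if j == 1%N then M z z else j%:R / N).
Proof.
rewrite /cycle_at; case: eqP => _; last exact: gap_range.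
by rewrite lexx andbT; case/andP: (M_diag R cI cJ kn z).
Qed.

Lemma sum_cycle_at j : \sum_z cycle_at j z = cycle_sum j.
Proof. by rewrite /cycle_at /cycle_sum /closed_gap /mxtrace; case: eqP. Qed.

Definition walk_const rho : R := \prod_(j <- rho) j%:R.

Lemma walk_const_ge0 rho : 0 <= walk_const rho.
Proof. exact: prodr_ge0. Qed.

Lemma prod_cycle_sum rho : 0 <= \prod_(j <- rho) cycle_sum j <= walk_const rho * g ^+ m1 rho.
Proof.
have g0 := le_trans ler01 fix1_ge1.
elim: rho => [|j rho /andP[IH0 IH]]; first by rewrite /walk_const !big_nil mulr1 ler01 lexx.
have /andP[h0 h] := cycle_sum_range j.
rewrite /walk_const !big_cons -/(walk_const rho) mulr_ge0 //=; move: h0 h; case: (eqVneq j 1%N) => [->|j1] h0 h /=.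
  rewrite add1n exprS mul1r mulrCA; exact: ler_pM.
by rewrite add0n -mulrA; apply: ler_pM.
Qed.

Fixpoint visit_const rho : R := if rho is j :: rho' then j%:R ^+ 2 * walk_const rho' + j%:R * visit_const rho' else 0.
Fixpoint overlap_const rho : R := if rho is j :: rho' then
  j%:R ^+ 4 * walk_const rho' + j%:R * overlap_const rho' + 2 * j%:R ^+ 2 * visit_const rho' else 0.

Lemma visit_const_ge0 rho : 0 <= visit_const rho.
Proof.
elim: rho => //= j rho IH; rewrite addr_ge0 // ?mulr_ge0 ?exprn_ge0 //; exact: walk_const_ge0.
Qed.

Lemma overlap_const_ge0 rho : 0 <= overlap_const rho.
Proof.
elim: rho => //= j rho IH.
by rewrite !addr_ge0 // ?mulr_ge0 ?exprn_ge0 ?visit_const_ge0 ?walk_const_ge0 // mulr_ge0.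
Qed.

Definition visit_sum rho z : R := sumw rho (fun cs => kapw cs * (count_mem z (flatten cs))%:R).

Lemma visit_sumS l rho z : 0%N \notin rho -> visit_sum (l.+1 :: rho) z =
  l.+1%:R * cycle_at l.+1 z * \prod_(j <- rho) cycle_sum j + cycle_sum l.+1 * visit_sum rho z.
Proof.
move=> rho0; rewrite -sum_kap_count -sum_kap !mulr_suml -big_split; apply: eq_bigr => c _ /=.
rewrite -sumw_kapw // -!sumwZ -sumwD; apply: eq_sumw => cs _.
by rewrite /kapw big_cons count_cat natrD; ring.
Qed.

(** One word of the list passes through [z]: a word of length 1 does so with weight M z z, a longer
    one with weight O(1/N); the other words contribute their total weights. *)
Lemma visit_sum_le rho z : 0%N \notin rho ->
  0 <= visit_sum rho z <= visit_const rho * (M z z * e (m1 rho) + g ^+ m1 rho / N).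
Proof.
have g1 := fix1_ge1; have g0 : 0 <= g := le_trans ler01 g1.
have N0 : 0 < N := N_gt0 R kn.
have /andP[M0 M1] := M_diag R cI cJ kn z.
elim: rho => [|[//|l] rho IH]; first by rewrite /visit_sum /= mulr0 mul0r lexx.
rewrite inE /= => rho0; have /andP[V0 V1] := IH rho0.
rewrite visit_sumS //.
have /andP[h0 h] := cycle_sum_range l.+1; have /andP[p0 p] := cycle_at_range l.+1 z.
have /andP[P0 P] := prod_cycle_sum rho.
have e0 := fixpred_ge0 (m1 rho); have e1 := fixpred_mul (m1 rho).
have C10 := walk_const_ge0 rho; have C20 := visit_const_ge0 rho.
have gm0 : 0 <= g ^+ m1 rho by rewrite exprn_ge0.
have gN : 0 <= g ^+ m1 rho / N by rewrite divr_ge0 // ltW.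
rewrite addr_ge0 ?mulr_ge0 //=.
set j := l.+1 in h p *; set m := m1 rho in e0 e1 gm0 gN V1 P *.
move: h0 h p0 p; rewrite -/j; case: (eqVneq j 1%N) => [->|j1] h0 h p0 p /=.
  rewrite add1n expr1n !mul1r mulrDl; apply: lerD.
    apply: (@le_trans _ _ (M z z * (walk_const rho * g ^+ m))); first exact: ler_pM.
    rewrite mulrCA ler_wpM2l // /e lerDl mulr_ge0 ?invr_ge0 ?(ltW N0) //.
    by rewrite exprn_ge0.
  apply: (@le_trans _ _ (g * (visit_const rho * (M z z * e m + g ^+ m / N)))); first exact: ler_pM.
  rewrite mulrCA ler_wpM2l // mulrDr; apply: lerD.
    by rewrite mulrCA ler_wpM2l.
  by rewrite mulrA -exprS.
rewrite add0n mulrDl; apply: lerD.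
  apply: (@le_trans _ _ (j%:R * (j%:R / N) * (walk_const rho * g ^+ m))).
    by apply: ler_pM => //; rewrite ?mulr_ge0 // ler_wpM2l.
  have -> : j%:R * (j%:R / N) * (walk_const rho * g ^+ m) = j%:R ^+ 2 * walk_const rho * (g ^+ m / N) by ring.
  rewrite ler_wpM2l ?mulr_ge0 ?exprn_ge0 // lerDr mulr_ge0 //.
by rewrite -mulrA; apply: ler_pM.
Qed.

Definition overlap_sum rho : R := sumw rho (fun cs => kapw cs * (~~ uniq (flatten cs))%:R).

Lemma nonuniq_cat_le c s : (~~ uniq (c ++ s) <= ~~ uniq c + ~~ uniq s +
  \sum_(z : 'I_n) count_mem z c * count_mem z s)%N.
Proof.
rewrite cat_uniq; case: (uniq c) => //=; case: (uniq s); rewrite ?andbT ?andbF ?addn0 ?add0n //=.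
case: hasP => [[z zs zc]|] //=.
rewrite (bigD1 z) //= (leq_trans _ (leq_addr _ _)) // muln_gt0 -!has_count !has_pred1.
by rewrite zs andbT.
Qed.

(** A repetition occurs inside the first word, which needs length at least 2, or inside the rest, or
    at a point z shared by the first word and the rest. *)
Lemma overlap_sumS l rho : 0%N \notin rho ->
  overlap_sum (l.+1 :: rho) <=
    l.+1%:R ^+ 3 / N * (fixcount R I J + l.+1%:R) * (l != 0%N)%:R * \prod_(j <- rho) cycle_sum j
    + cycle_sum l.+1 * overlap_sum rho
    + \sum_z l.+1%:R * cycle_at l.+1 z * visit_sum rho z.
Proof.
move=> rho0.
have h1 : \sum_(c : l.+1.-tuple 'I_n) kap c * (~~ uniq c)%:R <=
   l.+1%:R ^+ 3 / N * (fixcount R I J + l.+1%:R) * (l != 0%N)%:R.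
  case: (eqVneq l 0%N) => [->|_]; last by rewrite mulr1 sum_kap_nonuniq.
  rewrite mulr0 big1 // => c _; case: c => [[|a [|b c]] sc] //=.
  by rewrite mulr0.
apply: (@le_trans _ _ ((\sum_(c : l.+1.-tuple 'I_n) kap c * (~~ uniq c)%:R) * sumw rho kapw
    + (\sum_(c : l.+1.-tuple 'I_n) kap c) * overlap_sum rho
    + \sum_z (\sum_(c : l.+1.-tuple 'I_n) kap c * (count_mem z c)%:R) * visit_sum rho z)).
  rewrite !mulr_suml -big_split /=.
  under [X in _ <= _ + X]eq_bigr do rewrite mulr_suml.
  rewrite exchange_big -big_split; apply: ler_sum => c _ /=.
  under [X in _ <= _ + X]eq_bigr do rewrite -sumwZ.
  rewrite -sumw_sum -!sumwZ -!sumwD; apply: sumw_le => cs _.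
  rewrite /kapw big_cons; set a := kap c; set b := \prod_(_ <- _) _.
  have ab : 0 <= a * b by rewrite mulr_ge0 ?kap_ge0 ?kapw_ge0.
  have := nonuniq_cat_le c (flatten cs); rewrite -(ler_nat R) !natrD natr_sum => /(ler_wpM2l ab) /le_trans; apply.
  rewrite !mulrDr mulr_sumr le_eqVlt; apply/orP; left; apply/eqP.
  congr (_ + _ + _); [ring|ring|apply: eq_bigr => z _; rewrite natrM; ring].
rewrite sumw_kapw // sum_kap; apply: lerD; last by apply: ler_sum => z _; rewrite sum_kap_count.
by rewrite lerD2r ler_wpM2r //; case/andP: (prod_cycle_sum rho).
Qed.

(** Relative to the total weight, of order g^m, a collision of two words of length 1 loses a factor
    g, and any other repetition brings a factor of order at most g / N. *)
Lemma overlap_sum_le rho : 0%N \notin rho ->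
  overlap_sum rho <= overlap_const rho * (e (m1 rho) + g ^+ (m1 rho).+1 / N).
Proof.
have g1 := fix1_ge1; have g0 : 0 <= g := le_trans ler01 g1.
have N0 : 0 < N := N_gt0 R kn.
elim: rho => [|[//|l] rho IH]; first by rewrite /overlap_sum /= mulr0 mul0r.
rewrite inE /= => rho0; have {}IH := IH rho0.
apply: le_trans (overlap_sumS l rho0) _.
set j := l.+1.
have /andP[h0 h] := cycle_sum_range j.
have /andP[P0 P] := prod_cycle_sum rho.
have e0 := fixpred_ge0 (m1 rho); have e1 := fixpred_mul (m1 rho).
have C10 := walk_const_ge0 rho; have C20 := visit_const_ge0 rho; have C30 := overlap_const_ge0 rho.
have Ni : 0 <= N^-1 by rewrite invr_ge0 ltW.
set m := m1 rho in e0 e1 P IH *.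
have gm0 : 0 <= g ^+ m by rewrite exprn_ge0.
have gS : g ^+ m <= g ^+ m.+1 by rewrite exprS ler_peMl.
have f0 := fixcount_ge0 R I J.
have gS0 : 0 <= g ^+ m.+1 by rewrite exprn_ge0.
have V z := visit_sum_le z rho0.
have Mz z : 0 <= M z z <= 1 by apply: M_diag.
rewrite [leRHS]mulrDl [X in _ <= X + _]mulrDl; apply: lerD; first apply: lerD.
- have jl : (j == 1%N) = (l == 0%N) by [].
  rewrite jl; case: (eqVneq l 0%N) => l0 /=.
    rewrite mulr0 mul0r !mulr_ge0 ?exprn_ge0 ?addr_ge0 ?fixpred_ge0 ?mulr_ge0 ?exprn_ge0 //.
  rewrite mulr1 add0n -/m.
  have j1 : 1 <= j%:R :> R by rewrite ler1n.
  have fj : fixcount R I J + j%:R <= j%:R * g.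
    rewrite /g mulrDr mulr1 lerD2r ler_peMl //.
  apply: (@le_trans _ _ (j%:R ^+ 3 / N * (j%:R * g) * (walk_const rho * g ^+ m))).
    apply: ler_pM => //; first by rewrite !mulr_ge0 ?exprn_ge0 ?addr_ge0.
    by rewrite ler_wpM2l // mulr_ge0 ?exprn_ge0.
  have -> : j%:R ^+ 3 / N * (j%:R * g) * (walk_const rho * g ^+ m) = j%:R ^+ 4 * walk_const rho * (g ^+ m.+1 / N).
    by rewrite (exprS g m); ring.
  by rewrite ler_wpM2l ?mulr_ge0 ?exprn_ge0 // lerDr.
- apply: (@le_trans _ _ (cycle_sum j * (overlap_const rho * (e m + g ^+ m.+1 / N)))).
    by rewrite ler_wpM2l.
  move: h; case: (eqVneq j 1%N) => [->|j1] h /=; last first.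
    rewrite add0n -mulrA ler_wpM2r // mulr_ge0 // addr_ge0 // mulr_ge0 //.
  rewrite add1n mul1r mulrCA ler_wpM2l //.
  apply: (@le_trans _ _ (g * (e m + g ^+ m.+1 / N))).
    by rewrite ler_wpM2r // addr_ge0 // mulr_ge0.
  by rewrite mulrDr mulrA -exprS lerD2r.
- apply: (@le_trans _ _ (\sum_z j%:R * cycle_at j z * (visit_const rho * (M z z * e m + g ^+ m / N)))).
    apply: ler_sum => z _; case/andP: (V z) => v0 v1; apply: ler_wpM2l => //.
    by rewrite mulr_ge0 //; case/andP: (cycle_at_range j z).
  have -> : \sum_z j%:R * cycle_at j z * (visit_const rho * (M z z * e m + g ^+ m / N)) =
     j%:R * visit_const rho * (e m * (\sum_z cycle_at j z * M z z) + g ^+ m / N * cycle_sum j).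
    rewrite -sum_cycle_at !mulr_sumr -big_split mulr_sumr; apply: eq_bigr => z _ /=; ring.
  have cat0 z : 0 <= cycle_at j z by case/andP: (cycle_at_range j z).
  case: (eqVneq j 1%N) h (cycle_at_range j) => [j1|j1] h cr /=.
    rewrite j1 in h cr cat0 *.
    have s1 : \sum_z cycle_at 1 z * M z z <= g.
      apply: le_trans h; rewrite -sum_cycle_at; apply: ler_sum => z _.
      by rewrite ler_piMr //; case/andP: (Mz z).
    rewrite add1n mul1r expr1n mulr1.
    have q1 : e m * (\sum_z cycle_at 1 z * M z z) <= e m.+1.
      by apply: le_trans e1; rewrite mulrC ler_wpM2r.
    have q2 : g ^+ m / N * cycle_sum 1 <= g ^+ m.+2 / N.
      apply: (@le_trans _ _ (g ^+ m / N * g)); first by rewrite ler_wpM2l // mulr_ge0.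
      have -> : g ^+ m / N * g = g ^+ m.+1 / N by rewrite exprS; ring.
      by rewrite ler_wpM2r // [leRHS]exprS ler_peMl.
    apply: (@le_trans _ _ (visit_const rho * (e m.+1 + g ^+ m.+2 / N))).
      by apply: ler_wpM2l => //; apply: lerD.
    rewrite -mulrA mulr_natl mulr2n lerDl mulr_ge0 // addr_ge0 ?fixpred_ge0 // mulr_ge0 // exprn_ge0 //.
  rewrite add0n -/m.
  have s1 : \sum_z cycle_at j z * M z z <= j%:R / N * g.
    have trg : \sum_z M z z <= g.
      rewrite -/(\tr M) trace_M // -renewal0 /g.
      have /andP[a b] := renewal_range R cI cJ kn 0 0; lra.
    apply: (@le_trans _ _ (\sum_z j%:R / N * M z z)).
      apply: ler_sum => z _; rewrite ler_wpM2r //; first by case/andP: (Mz z).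
      by case/andP: (cr z).
    by rewrite -mulr_sumr ler_wpM2l // mulr_ge0.
  have q1 : e m * (\sum_z cycle_at j z * M z z) <= j%:R * (g ^+ m.+1 / N).
    apply: (@le_trans _ _ (e m * (j%:R / N * g))); first by rewrite ler_wpM2l.
    have -> : e m * (j%:R / N * g) = j%:R / N * (g * e m) by ring.
    have -> : j%:R * (g ^+ m.+1 / N) = j%:R / N * g ^+ m.+1 by ring.
    rewrite ler_wpM2l ?mulr_ge0 //; apply: le_trans gS.
    by apply: le_trans e1 _; rewrite /e.
  have q2 : g ^+ m / N * cycle_sum j <= j%:R * (g ^+ m.+1 / N).
    rewrite mulrC; apply: ler_pM => //; first by rewrite mulr_ge0.
    by rewrite ler_wpM2r.
  apply: (@le_trans _ _ (j%:R * visit_const rho * (j%:R * (g ^+ m.+1 / N) + j%:R * (g ^+ m.+1 / N)))).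
    by apply: ler_wpM2l; [rewrite mulr_ge0|apply: lerD].
  have -> : j%:R * visit_const rho * (j%:R * (g ^+ m.+1 / N) + j%:R * (g ^+ m.+1 / N)) =
     2 * j%:R ^+ 2 * visit_const rho * (g ^+ m.+1 / N) by ring.
  by rewrite ler_wpM2l ?mulr_ge0 ?exprn_ge0 // lerDr.
Qed.

End Collisions.

(** * The main term for a fixed pair of subsets *)

Section MainTerm.
Variable R : realType.
Variables (n k : nat) (I J : {set 'I_n}).
Hypotheses (cI : #|I| = k) (cJ : #|J| = k) (kn : (k < n)%N).
Implicit Types (l j : nat) (x y z a : 'I_n) (c s : seq 'I_n) (rho : seq nat).

Local Notation Phi := (Phi R I J).
Local Notation M := (step_mx R k I J).
Local Notation kapp := (kapw R k I J).
Local Notation cyc_sum := (cycle_sum R k I J).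
Local Notation sumw := (@sumw R n).
Local Notation g := (fix1 R I J).
Local Notation e := (fixpred R I J).
Local Notation m1 := (count_mem 1%N).
Local Notation f := (fixcount R I J).
Let N : R := n%:R - k%:R.
Let t : R := k%:R / n%:R.

Lemma pathw_Phi_up a x s y : rank_match I J a x -> (a < x)%N -> pathw Phi x s y != 0 -> (a < y)%N.
Proof.
elim: s a x => [|z s IH] a x ax lt /=.
  rewrite mxE /=; case m: (rank_match I J x y); rewrite ?eqxx // => _.
  by rewrite (ltn_trans lt) // -(rank_match_lt ax m).
rewrite mulf_eq0 negb_or mxE /=; case m: (rank_match I J x z); rewrite ?eqxx //= => /andP[_ p].
by apply: (ltn_trans lt); apply: (IH _ _ m _ p); rewrite -(rank_match_lt ax m).
Qed.

Lemma pathw_Phi_dn a x s y : rank_match I J a x -> (x < a)%N -> pathw Phi x s y != 0 -> (y < a)%N.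
Proof.
elim: s a x => [|z s IH] a x ax lt /=.
  rewrite mxE /=; case m: (rank_match I J x y); rewrite ?eqxx // => _.
  by rewrite (ltn_trans _ lt) // -(rank_match_lt m ax).
rewrite mulf_eq0 negb_or mxE /=; case m: (rank_match I J x z); rewrite ?eqxx //= => /andP[_ p].
by apply: (ltn_trans _ lt); apply: (IH _ _ m _ p); rewrite -(rank_match_lt m ax).
Qed.

(** By monotonicity a walk along phi whose first step goes up stays above its start, and likewise
    downward, so it cannot close. *)
Lemma cycw_Phi_uniq c : uniq c -> (1 < size c)%N -> cycw Phi c = 0.
Proof.
case: c => [|x [|y s]] //= /andP[]; rewrite inE negb_or => /andP[xy _] _ _.
rewrite cycw_path /=; apply/eqP/negPn/negP; rewrite mulf_eq0 negb_or mxE /=.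
case m: (rank_match I J x y); rewrite ?eqxx //= => /andP[_ p].
have [lt|gt|eq] := ltngtP x y.
- by have := pathw_Phi_up m lt p; rewrite ltnn.
- by have := pathw_Phi_dn m gt p; rewrite ltnn.
- by move: xy; rewrite (val_inj eq) eqxx.
Qed.

(** On a word without repetition the walk along phi that [kap] subtracts has weight 0; the
    subtraction thus affects only degenerate lists. *)
Lemma kapw_uniq cs : uniq (flatten cs) -> 0%N \notin map size cs ->
  kapp cs = \prod_(c <- cs) cycw M c.
Proof.
elim: cs => [|c cs IH] /=; first by rewrite /kapw !big_nil.
rewrite cat_uniq => /and3P[uc _ us]; rewrite inE negb_or => /andP[c0 cs0].
rewrite /kapw !big_cons -IH // /kap; congr (_ * _).
have [s1|s1] := eqVneq (size c) 1%N; first by rewrite mul0r subr0.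
by rewrite cycw_Phi_uniq ?mulr0 ?subr0 // ltn_neqAle eq_sym s1 lt0n eq_sym.
Qed.

Definition uniq_sum rho : R :=
  sumw rho (fun cs => (uniq (flatten cs))%:R * \prod_(c <- cs) cycw M c).

Lemma uniq_sumE rho : 0%N \notin rho ->
  uniq_sum rho = \prod_(j <- rho) cyc_sum j - overlap_sum R k I J rho.
Proof.
move=> rho0; rewrite -(@sumw_kapw R n k I J kn) // /overlap_sum.
rewrite -[X in _ - X]mul1r -mulNr -sumwZ -sumwD; apply: eq_sumw => cs hcs.
case: (boolP (uniq (flatten cs))) => u.
  by rewrite kapw_uniq ?hcs // mul1r mulr0 mulr0 addr0.
by rewrite mul0r mulr1 mulN1r subrr.
Qed.

Definition dev_sum K : R := \sum_(l < K) `|freq_dev R k I J l|.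

Definition main_factor j : R := if j == 1%N then f else 1 - t ^+ j.

Fixpoint main_const rho : R := if rho is j :: rho' then
  walk_const R rho' + j%:R * main_const rho' + j%:R * 3 ^+ j else 0.

Lemma main_const_ge0 rho : 0 <= main_const rho.
Proof. by elim: rho => //= j rho IH; rewrite !addr_ge0 ?walk_const_ge0 ?mulr_ge0 ?exprn_ge0. Qed.

Lemma dev_sum_ge0 K : 0 <= dev_sum K.
Proof. exact: sumr_ge0. Qed.

Lemma dev_sum_le K K' : (K <= K')%N -> dev_sum K <= dev_sum K'.
Proof.
by move=> KK; rewrite /dev_sum -(subnKC KK) big_split_ord /= lerDl sumr_ge0.
Qed.

Lemma main_prod_range rho : 0%N \notin rho ->
  0 <= \prod_(j <- rho) main_factor j <= g ^+ m1 rho.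
Proof.
have /andP[t0 t1] := t_range R kn.
have f0 := fixcount_ge0 R I J; have g1 := fix1_ge1 R I J.
elim: rho => [|j rho IH] /=; first by rewrite big_nil ler01 lexx.
rewrite inE negb_or => /andP[_ /IH/andP[h0 h]]; rewrite big_cons /main_factor.
case: (eqVneq j 1%N) => [j1|j1] /=.
  rewrite mulr_ge0 //= add1n exprS; apply: ler_pM => //; by rewrite /fix1 lerDl.
have tj : 0 <= t ^+ j <= 1 by rewrite exprn_ge0 // exprn_ile1.
rewrite mulr_ge0 //=; last by lra.
by rewrite add0n -[leRHS]mul1r; apply: ler_pM => //; lra.
Qed.

(** Factors are replaced one at a time. At j = 1 the error is at most 1 and takes the place of a
    factor g; at j >= 2 it is at most a multiple of [dev_sum]. *)
Lemma main_prod_dev K rho : 0%N \notin rho -> all (fun j => j <= K)%N rho ->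
  `|\prod_(j <- rho) cyc_sum j - \prod_(j <- rho) main_factor j| <=
  main_const rho * (e (m1 rho) + g ^+ m1 rho * dev_sum K).
Proof.
have g1 := fix1_ge1 R I J; have g0 : 0 <= g := le_trans ler01 g1.
have D0 := dev_sum_ge0 K.
elim: rho => [|j rho IH] /=; first by rewrite !big_nil subrr normr0 mul0r.
rewrite inE negb_or => /andP[j0 rho0] /andP[jK rhoK]; have {}IH := IH rho0 rhoK.
have /andP[P0 P] := prod_cycle_sum R cI cJ kn rho.
have /andP[Q0 Q] := main_prod_range rho0.
have e0 := fixpred_ge0 R I J (m1 rho); have e1 := fixpred_mul R I J (m1 rho).
have C10 := walk_const_ge0 R rho; have C40 := main_const_ge0 rho.
set m := m1 rho in P Q e0 e1 IH *.
have gm0 : 0 <= g ^+ m by rewrite exprn_ge0.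
rewrite !big_cons.
set p := \prod_(j <- rho) cyc_sum j in P0 P IH *.
set q := \prod_(j <- rho) main_factor j in Q0 Q IH *.
have -> : cyc_sum j * p - main_factor j * q =
   cyc_sum j * (p - q) + (cyc_sum j - main_factor j) * q by ring.
have /andP[s0 s1] := cycle_sum_range R cI cJ kn j.
apply: le_trans (ler_normD _ _) _; rewrite !normrM (ger0_norm s0) (ger0_norm Q0).
set D := dev_sum K in D0 IH *.
have m0 : 0 <= e m + g ^+ m * D by rewrite addr_ge0 // mulr_ge0.
rewrite /main_factor; case: (eqVneq j 1%N) s0 s1 => [->|j1] s0 s1 /=.
  rewrite add1n !mul1r expr1.
  have mS : g * (e m + g ^+ m * D) <= g ^+ m + g ^+ m.+1 * D.
    by rewrite mulrDr mulrA -exprS lerD2r.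
  have s2 : `|cyc_sum 1 - f| <= 1.
    rewrite /cycle_sum /= trace_M // addrC addKr -renewal0 ger0_norm.
      by case/andP: (renewal_range R cI cJ kn 0 0).
    by case/andP: (renewal_range R cI cJ kn 0 0).
  set X := g ^+ m + g ^+ m.+1 * D in mS *.
  have X0 : 0 <= X by rewrite addr_ge0 // mulr_ge0 // exprn_ge0.
  have a1 : cyc_sum 1 * `|p - q| <= main_const rho * X.
    apply: (@le_trans _ _ (g * (main_const rho * (e m + g ^+ m * D)))); first exact: ler_pM.
    by rewrite mulrCA ler_wpM2l.
  have a2 : `|cyc_sum 1 - f| * q <= X.
    apply: (@le_trans _ _ (1 * g ^+ m)); first exact: ler_pM.
    by rewrite mul1r lerDl mulr_ge0 // exprn_ge0.
  have a3 : 0 <= walk_const R rho * X by rewrite mulr_ge0.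
  lra.
rewrite add0n -/m.
set X := e m + g ^+ m * D in m0 IH *.
have a1 : cyc_sum j * `|p - q| <= j%:R * main_const rho * X.
  by rewrite -mulrA; apply: ler_pM.
have a2 : `|cyc_sum j - (1 - t ^+ j)| * q <= j%:R * 3 ^+ j * X.
  apply: (@le_trans _ _ (j%:R * 3 ^+ j * D * g ^+ m)).
    apply: ler_pM => //; rewrite /cycle_sum (negPf j1).
    apply: le_trans (closed_gap_dev R cI cJ kn j) _.
    by rewrite ler_wpM2l ?mulr_ge0 ?exprn_ge0 //; apply: dev_sum_le.
  rewrite -mulrA ler_wpM2l ?mulr_ge0 ?exprn_ge0 // /X [D * _]mulrC lerDr //.
have a3 : 0 <= walk_const R rho * X by rewrite mulr_ge0.
lra.
Qed.

Lemma uniq_sum_dev K rho : 0%N \notin rho -> all (fun j => j <= K)%N rho ->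
  `|uniq_sum rho - \prod_(j <- rho) main_factor j| <=
  (overlap_const R rho + main_const rho) * (e (m1 rho) + g ^+ (m1 rho).+1 / N + g ^+ m1 rho * dev_sum K).
Proof.
move=> rho0 rhoK; rewrite uniq_sumE //.
have h1 := overlap_sum_le R cI cJ kn rho0; have h2 := main_prod_dev rho0 rhoK.
have g1 := fix1_ge1 R I J; have g0 : 0 <= g := le_trans ler01 g1.
have N0 : 0 < N := N_gt0 R kn.
have o0 : 0 <= overlap_sum R k I J rho.
  have -> : 0 = sumw rho (fun=> 0 * 0) by rewrite sumwZ mul0r.
  by apply: sumw_le => cs _; rewrite mul0r mulr_ge0 ?kapw_ge0.
have e0 := fixpred_ge0 R I J (m1 rho).
have C30 := overlap_const_ge0 R rho; have C40 := main_const_ge0 rho.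
rewrite addrAC; apply: le_trans (ler_normB _ _) _.
rewrite (ger0_norm o0); rewrite -/N in h1.
have a0 : 0 <= g ^+ (m1 rho).+1 / N by rewrite mulr_ge0 ?exprn_ge0 // invr_ge0 ltW.
have b0 : 0 <= g ^+ m1 rho * dev_sum K by rewrite mulr_ge0 ?exprn_ge0 ?dev_sum_ge0.
move: h1 h2 e0 a0 b0 C30 C40.
move: (e (m1 rho)) (g ^+ (m1 rho).+1 / N) (g ^+ m1 rho * dev_sum K) (overlap_const R rho) (main_const rho) => a b c p q.
move=> h1 h2 a0 b0 c0 p0 q0.
have pc : 0 <= p * c by rewrite mulr_ge0.
have qb : 0 <= q * b by rewrite mulr_ge0.
lra.
Qed.

End MainTerm.

(** * Counting permutations with prescribed cycles *)

Section ArcCount.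
Variable T : finType.
Implicit Types (D : {set T}) (pi sg : {perm T}) (L : seq (T * T)).

Definition agree D sg pi := [forall x in D, pi x == sg x].

(** Multiplication by the inverse of [sg] turns the condition into fixing D pointwise, that is, into
    a permutation of the complement of D. *)
Lemma card_agree D sg : #|[set pi | agree D sg pi]| = (#|T| - #|D|)`!.
Proof.
have -> : (#|T| - #|D|)%N = #|~: D| by rewrite [RHS]cardsCs finset.setCK.
rewrite -card_perm.
rewrite -(card_imset _ (@mulIg _ sg^-1%g)); apply: eq_card => p.
apply/imsetP/idP => [[q]|].
  rewrite inE => /forall_inP h ->; apply/fintype.subsetP => x; rewrite inE permM => xn.
  rewrite inE; apply: contra xn => xD; by rewrite (eqP (h x xD)) permK.
move=> pon; exists (p * sg)%g; last by rewrite mulgK.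
rewrite inE; apply/forall_inP => x xD; rewrite permM (out_perm pon) // inE negbK //.
Qed.

Definition arc_ok D sg (p : T * T) := if p.1 \in D then p.2 == sg p.1 else p.2 \notin sg @: D.

(** An arc starting in D is a condition on [sg] alone. Any other arc from x to y, with y outside the
    image of D, enlarges D by x after [sg] is corrected by a transposition so as to map x to y. *)
Lemma card_agree_arcs D sg L : uniq (unzip1 L) -> uniq (unzip2 L) ->
  #|[set pi | agree D sg pi && all (fun p => pi p.1 == p.2) L]| =
  (all (arc_ok D sg) L * (#|T| - #|D| - count (fun p => p.1 \notin D) L)`!)%N.
Proof.
elim: L D sg => [|[x y] L IH] D sg /=.
  by move=> _ _; rewrite mul1n subn0 -(card_agree D sg); apply: eq_card => p; rewrite !inE andbT.
move=> /andP[xL uL] /andP[yL uL2].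
rewrite /arc_ok /= -/(arc_ok D sg); case: (boolP (x \in D)) => xD /=.
  rewrite add0n; case: (eqVneq y (sg x)) => [yE|yN] /=.
    rewrite -IH //; apply: eq_card => p; rewrite !inE.
    case a: (agree D sg p) => //=; have /forall_inP/(_ x xD)/eqP -> := a.
    by rewrite yE eqxx.
  rewrite mul0n; apply: eq_card0 => p; rewrite !inE; apply/negP => /and3P[/forall_inP/(_ x xD)/eqP -> /eqP e _].
  by rewrite e eqxx in yN.
case: (boolP (y \in sg @: D)) => yD /=.
  rewrite mul0n; apply: eq_card0 => p; rewrite !inE; apply/negP => /and3P[/forall_inP a /eqP e _].
  case/imsetP: yD => z zD yz; move: xD; rewrite (_ : x = z) ?zD //.
  by apply: (@perm_inj _ p); rewrite e yz; apply/esym/eqP; exact: a.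
pose sg' := (sg * tperm (sg x) y)%g.
have sgD z : z \in D -> sg' z = sg z.
  move=> zD; rewrite permM tpermD //.
    by apply: contraNneq xD => /perm_inj ->.
  by apply: contraNneq yD => ->; apply: imset_f.
have sgx : sg' x = y by rewrite permM tpermL.
have im' : sg' @: (x |: D) = y |: sg @: D.
  rewrite imsetU1 sgx; congr (_ |: _); exact: eq_in_imset.
rewrite (_ : all (arc_ok D sg) L = all (arc_ok (x |: D) sg') L); last first.
  apply: eq_in_all => -[a b] abL; rewrite /arc_ok /=.
  have ax : a != x by apply: contraNneq xL => <-; apply/mapP; exists (a, b).
  have by' : b != y by apply: contraNneq yL => <-; apply/mapP; exists (a, b).
  by rewrite im' !inE (negPf ax) (negPf by') /=; case: ifP => // aD; rewrite sgD.
rewrite (_ : (#|T| - #|D| - (1 + _))%N = (#|T| - #|x |: D| - count (fun p => p.1 \notin x |: D) L)%N); last first.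
  rewrite cardsU1 xD subnDA -!subnDA; congr (_ - _)%N; rewrite addnCA addnA; congr (_ + _)%N.
  apply: eq_in_count => -[a b] abL /=.
  have ax : a != x by apply: contraNneq xL => <-; apply/mapP; exists (a, b).
  by rewrite !inE (negPf ax).
rewrite -IH //; apply: eq_card => p; rewrite !inE andbA; congr (_ && _).
apply/andP/forall_inP => [[/forall_inP h /eqP px] z|h].
  by rewrite !inE => /predU1P[->|zD]; rewrite ?px ?sgx // sgD // h.
split; last by rewrite -sgx; apply: h; rewrite !inE eqxx.
by apply/forall_inP => z zD; rewrite -(sgD z zD); apply: h; rewrite !inE zD orbT.
Qed.

Lemma card_agree_maps D sg (cs : seq (seq T)) : uniq (flatten cs) ->
  let L := flatten [seq zip c (rot 1 c) | c <- cs] in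
  #|[set pi | agree D sg pi && all (fun c => map pi c == rot 1 c) cs]| =
  (all (arc_ok D sg) L * (#|T| - #|D| - count (fun x => x \notin D) (flatten cs))`!)%N.
Proof.
move=> ucs L.
have L1 : unzip1 L = flatten cs.
  rewrite /L {ucs L}; elim: cs => //= c cs IH; rewrite /unzip1 map_cat; congr (_ ++ _) => //.
  by apply: unzip1_zip; rewrite size_rot.
have L2 : perm_eq (unzip2 L) (flatten cs).
  rewrite /L {ucs L L1}; elim: cs => //= c cs IH; rewrite /unzip2 map_cat; apply: perm_cat => //.
  by rewrite -/(unzip2 _) unzip2_zip ?size_rot // perm_rot.
rewrite -L1 count_map -(@card_agree_arcs D sg L) ?(perm_uniq L2) ?L1 //.
apply: eq_card => p; rewrite !inE; congr (_ && _).
rewrite /L {ucs L L1 L2}; elim: cs => //= c cs IH; rewrite all_cat IH; congr (_ && _).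
move: (rot 1 c) (size_rot 1 c) => d e.
by elim: c d e {IH} => [|a c IH] [|b d] //= [e]; rewrite eqseq_cons IH.
Qed.

End ArcCount.

Section ExtensionCount.
Variables (n k : nat) (I J : {set 'I_n}).
Hypotheses (cI : #|I| = k) (cJ : #|J| = k).

(** The arcs of the increasing bijection have distinct sources and distinct targets, so the number
    of permutations containing them is a factorial, hence positive. *)
Lemma extension_ex : exists sg : 'S_n, extends I J sg.
Proof.
pose m x : 'I_n := odflt x [pick y | rank_match I J x y].
have mE x : x \in I -> rank_match I J x (m x).
  move=> xI; rewrite /m; case: pickP => // h.
  have cIJ : #|I| = #|J| by rewrite cI cJ.
  by have [y xy] := rank_match_ex cIJ xI; rewrite h in xy.
pose L := [seq (x, m x) | x <- enum I].
have u1 : uniq (unzip1 L) by rewrite /unzip1 -map_comp map_id enum_uniq.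
have u2 : uniq (unzip2 L).
  rewrite /unzip2 -map_comp map_inj_in_uniq ?enum_uniq // => x y.
  rewrite !mem_enum => xI yI /= e; have h := mE x xI; have h' := mE y yI.
  by rewrite rank_matchC in h; rewrite rank_matchC -e in h'; apply: rank_match_inj h h'.
have := card_agree_arcs finset.set0 1%g u1 u2.
rewrite (_ : all _ L = true); last first.
  by apply/allP => p _; rewrite /arc_ok inE imset0 inE.
move=> h; have : (0 < #|[set pi : 'S_n | agree finset.set0 1%g pi && all (fun p => pi p.1 == p.2) L]|)%N.
  by rewrite h mul1n fact_gt0.
case/card_gt0P => sg; rewrite inE => /andP[_ /allP hsg]; exists sg.
apply/forall_inP => x xI; have /eqP -> : sg x == m x.
  by apply: (hsg (x, m x)); apply/mapP; exists x; rewrite ?mem_enum.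
exact: mE.
Qed.

Lemma extends_agree sg pi : extends I J sg -> extends I J pi = agree I sg pi.
Proof.
move=> hs; apply/forall_inP/forall_inP => h x xI; have hx := (forall_inP hs) x xI.
  by apply/eqP; apply: rank_match_inj (h x xI) hx.
by rewrite (eqP (h x xI)).
Qed.

Definition step_ok (p : 'I_n * 'I_n) := if p.1 \in I then rank_match I J p.1 p.2 else p.2 \notin J.

Lemma card_extends_maps (cs : seq (seq 'I_n)) : uniq (flatten cs) ->
  #|[set pi : 'S_n | extends I J pi && all (fun c => map pi c == rot 1 c) cs]| =
  (all step_ok (flatten [seq zip c (rot 1 c) | c <- cs]) *
    (n - k - count (fun x => x \notin I) (flatten cs))`!)%N.
Proof.
move=> ucs; have [sg hs] := extension_ex.
have := card_agree_maps I sg ucs; rewrite card_ord cI /= => h.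
rewrite (eq_all (a2 := arc_ok I sg)) -?h.
  by apply: eq_card => p; rewrite !inE (extends_agree _ hs).
move=> [x y]; rewrite /step_ok /arc_ok /=; case: ifP => xI.
  have hx := (forall_inP hs) x xI; apply/idP/eqP => [h'|->] //.
  exact: rank_match_inj h' hx.
by rewrite -(extends_imset _ hs) // cI cJ.
Qed.

End ExtensionCount.

(** * Cycles of a permutation on a stable set *)

Section Orbits.
Variable T : finType.
Implicit Types (pi : {perm T}) (c s : seq T) (S : {set T}) (x y : T).

Lemma map_rcons_traject pi x s y : map pi (x :: s) = rcons s y ->
  x :: s = traject pi x (size s).+1.
Proof.
elim: s x => [|z s IH] x //= [e h].
by congr (_ :: _); rewrite (IH z h) /= e.
Qed.

Lemma cyc_traject pi c x0 : map pi c = rot 1 c -> c = traject pi (head x0 c) (size c).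
Proof. by case: c => // x s; rewrite rot1_cons => /map_rcons_traject. Qed.

Lemma cyc_porbit pi c x : map pi c = rot 1 c -> x \in c -> porbit pi x = [set y in c].
Proof.
move=> e xc; have step y : y \in c -> pi y \in c.
  by move=> yc; rewrite -(mem_rot 1) -e map_f.
have stepi i y : y \in c -> (pi ^+ i)%g y \in c.
  by move=> yc; elim: i => [|i IH]; rewrite ?expg0 ?perm1 // expgSr permM step.
case: c e xc step stepi => // x0 s e xc step stepi; have tr : x0 :: s = traject pi x0 (size s).+1 := cyc_traject x0 e.
have in0 y : y \in x0 :: s -> y \in porbit pi x0.
  rewrite tr => /trajectP[i _ ->]; apply/porbitP; exists i; by rewrite permX.
have -> : porbit pi x = porbit pi x0 by apply/eqP; rewrite eq_porbit_mem; apply: in0.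
apply/setP => y; rewrite [RHS]inE; apply/idP/idP; last exact: in0.
by case/porbitP => i ->; apply: stepi; rewrite inE eqxx.
Qed.

Definition stable pi S := pi @: S == S.

Lemma stable_mem pi S x : stable pi S -> (pi x \in S) = (x \in S).
Proof.
move=> /eqP st; apply/idP/idP => [|xS]; last by rewrite -st imset_f.
by rewrite -{1}st => /imsetP[y yS /perm_inj ->].
Qed.

Lemma stable_porbit pi S x y : stable pi S -> y \in porbit pi x -> (y \in S) = (x \in S).
Proof.
move=> st /porbitP[i ->]; elim: i => [|i IH]; first by rewrite expg0 perm1.
by rewrite expgSr permM stable_mem.
Qed.

Definition orbit_size_set pi S j := [set x in S | #|porbit pi x| == j].

(** The cycle type is encoded by numbers of points rather than of cycles, so that removing one cycle
    is a set difference. *)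
Definition orbit_type pi S (rho : seq nat) :=
  forall j, #|orbit_size_set pi S j| = (j * count_mem j rho)%N.

Lemma traject_cyc pi x l : #|porbit pi x| = l.+1 ->
  uniq (traject pi x l.+1) /\ map pi (traject pi x l.+1) = rot 1 (traject pi x l.+1).
Proof.
move=> cl; split; first by rewrite -cl uniq_traject_porbit.
rewrite [in RHS]trajectS rot1_cons.
have -> : map pi (traject pi x l.+1) = traject pi (pi x) l.+1.
  by elim: l.+1 (x) => //= m IH y; rewrite IH.
rewrite trajectSr; congr (rcons _ _).
by rewrite -iterSr -{2}(iter_porbit pi x) cl.
Qed.

(** A cyclic word is determined by its head, as the orbit read from there; the heads are the points
    of S in orbits of the given size. *)
Lemma card_cycles pi S l : stable pi S ->
  #|[set c : l.+1.-tuple T | [&& uniq c, map pi c == rot 1 c & all (mem S) c]]| =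
  #|orbit_size_set pi S l.+1|.
Proof.
move=> st; set A := [set c : _ | _].
have tr (c : l.+1.-tuple T) : c \in A -> tval c = traject pi (thead c) l.+1.
  rewrite inE => /and3P[_ /eqP e _]; rewrite {1}(cyc_traject (thead c) e) size_tuple.
  by congr traject; rewrite [RHS]/thead (tnth_nth (thead c)) /= nth0.
rewrite -(card_in_imset (f := fun c : l.+1.-tuple T => thead c) (D := mem A)); last first.
  by move=> c d cA dA e; apply: val_inj; rewrite /= (tr c cA) (tr d dA) e.
apply: eq_card => x; rewrite inE; apply/imsetP/andP => [[c cA ->]|[xS /eqP cx]].
  have := cA; rewrite inE => /and3P[uc /eqP e cS].
  have hc : thead c \in tval c by rewrite [in X in _ \in X](tuple_eta c) inE eqxx.
  split; first exact: (allP cS).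
  by rewrite (cyc_porbit e hc) cardsE (card_uniqP uc) size_tuple.
have [ut mt] := traject_cyc cx.
have sz : size (traject pi x l.+1) == l.+1 by rewrite size_traject.
exists (Tuple sz); last by rewrite /thead (tnth_nth x).
rewrite inE; apply/and3P; split; [exact: ut|by apply/eqP|apply/allP => y].
case/(@trajectP _ pi x l.+1) => i _ ->; rewrite inE -permX (stable_porbit st (x := x)) //.
by apply/porbitP; exists i.
Qed.

Lemma valid_orbit_type pi (cs : seq (seq T)) : uniq (flatten cs) ->
  all (fun c => map pi c == rot 1 c) cs ->
  let S := [set x in flatten cs] in
  stable pi S /\ orbit_type pi S (map size cs).
Proof.
move=> ucs ccs S; split.
  have sub : pi @: S \subset S.
    apply/fintype.subsetP => _ /imsetP[x xS ->]; move: xS; rewrite !inE.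
    case/flattenP => c cin xc; apply/flattenP; exists c => //.
    by rewrite -(mem_rot 1) -(eqP (allP ccs c cin)) map_f.
  by rewrite /stable eqEcard sub card_imset ?leqnn //; exact: perm_inj.
move=> j; rewrite /orbit_size_set.
elim: cs ucs ccs @S => [|c cs IH] /=; first by move=> _ _; rewrite muln0; apply: eq_card0 => x; rewrite !inE.
rewrite cat_uniq => /and3P[uc disj ucs] /andP[/eqP ec ccs].
have {}IH := IH ucs ccs.
rewrite mulnDr -IH.
have -> : [set x in [set x0 in c ++ flatten cs] | #|porbit pi x| == j] =
   (if size c == j then [set x in c] else finset.set0) :|:
   [set x in [set x0 in flatten cs] | #|porbit pi x| == j].
  apply/setP => x; rewrite !inE mem_cat; case: (boolP (x \in c)) => xc /=.
    rewrite (cyc_porbit ec xc) cardsE (card_uniqP uc); case: eqP => _; rewrite !inE ?xc //.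
    by rewrite andbF.
  by case: (size c == j); rewrite !inE ?(negPf xc).
rewrite cardsU (_ : _ :&: _ = finset.set0) ?cards0 ?subn0.
  congr (_ + _)%N; case: eqP => [<-|]; last by rewrite cards0 muln0.
  by rewrite cardsE (card_uniqP uc) muln1.
apply/setP => x; rewrite !inE; case: eqP => _; rewrite !inE //.
apply/negP => /and3P[xc xf _]; case/hasP: disj; by exists x.
Qed.

Lemma orbit_type_nil pi S : orbit_type pi S [::] -> S = finset.set0.
Proof.
move=> h; apply/setP => x; rewrite inE; apply/negP => xS.
have := h #|porbit pi x|; rewrite muln0 => /eqP; rewrite cards_eq0 => /eqP/setP/(_ x).
by rewrite !inE xS eqxx.
Qed.

Lemma orbit_type_setD pi S c j rho : stable pi S -> uniq c -> map pi c = rot 1 c ->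
  all (mem S) c -> size c = j -> orbit_type pi S (j :: rho) ->
  stable pi (S :\: [set x in c]) /\ orbit_type pi (S :\: [set x in c]) rho.
Proof.
move=> st uc ec cS sc h.
have cpi x : (pi x \in c) = (x \in c).
  apply/idP/idP => [|xc]; last by rewrite -(mem_rot 1) -ec map_f.
  by rewrite -(mem_rot 1) -ec => /mapP[y yc /perm_inj ->].
split.
  rewrite /stable eqEcard card_imset ?leqnn ?andbT; last exact: perm_inj.
  apply/fintype.subsetP => _ /imsetP[x xS ->]; move: xS; rewrite !inE => /andP[xc xS].
  by rewrite cpi xc stable_mem.
move=> i; have := h i; rewrite /= mulnDr /orbit_size_set.
have -> : [set x in S :\: [set x in c] | #|porbit pi x| == i] =
   [set x in S | #|porbit pi x| == i] :\: [set x in c].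
  by apply/setP => x; rewrite !inE andbA.
rewrite cardsD => ->.
have -> : [set x in S | #|porbit pi x| == i] :&: [set x in c] = if j == i then [set x in c] else finset.set0.
  apply/setP => x; rewrite !inE; case: (boolP (x \in c)) => xc; last by rewrite andbF; case: ifP; rewrite !inE ?(negPf xc).
  rewrite (cyc_porbit ec xc) cardsE (card_uniqP uc) sc andbT; have /= -> := allP cS x xc.
  by case: ifP => _; rewrite !inE.
case: eqP => [ji|_]; last by rewrite cards0 muln0 subn0.
by rewrite cardsE (card_uniqP uc) sc -ji muln1 addKn.
Qed.

End Orbits.

(** * Listing the cycles of a permutation *)

Section CycleLists.
Variable R : realType.
Variable n : nat.
Implicit Types (pi : 'S_n) (S : {set 'I_n}) (rho : seq nat) (cs : seq (seq 'I_n)).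

Definition valid pi cs := uniq (flatten cs) && all (fun c => map pi c == rot 1 c) cs.

(* The number of ways to write the cycles of a permutation of type rho as words, in an order in
   which their lengths read rho. *)
Fixpoint cycle_lists rho : nat :=
  if rho is j :: rho' then (j * (count_mem j rho').+1 * cycle_lists rho')%N else 1%N.

Lemma cycle_lists_gt0 rho : 0%N \notin rho -> (0 < cycle_lists rho)%N.
Proof.
by elim: rho => //= j rho IH; rewrite inE negb_or eq_sym -lt0n => /andP[j0 /IH h]; rewrite !muln_gt0 j0 h.
Qed.

(** By [card_cycles] the first word has j (m + 1) choices, m being the number of further parts j;
    removing its points leaves a stable set whose type is the rest of [rho]. *)
Lemma sumw_valid_on pi S rho : 0%N \notin rho -> stable pi S -> orbit_type pi S rho ->
  sumw rho (fun cs => (valid pi cs && ([set x in flatten cs] == S))%:R) = (cycle_lists rho)%:R :> R.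
Proof.
elim: rho S => [|j rho IH] S /=.
  move=> _ _ /orbit_type_nil ->; rewrite /valid /=.
  by rewrite (_ : _ == _) //; apply/eqP/setP => x; rewrite !inE.
rewrite inE negb_or => /andP[j0 rho0] st tS.
case: j j0 tS => // l _ tS.
pose P (c : l.+1.-tuple 'I_n) := [&& uniq c, map pi c == rot 1 c & all (mem S) c].
transitivity (\sum_(c : l.+1.-tuple 'I_n) (P c)%:R * (cycle_lists rho)%:R : R).
  apply: eq_bigr => c _; case: (boolP (P c)) => [/and3P[uc /eqP ec cS]|nP].
    have [st' t'] := orbit_type_setD st uc ec cS (size_tuple c) tS.
    rewrite mul1r -(IH _ rho0 st' t'); apply: eq_sumw => cs _; congr ((nat_of_bool _)%:R).
    rewrite /valid /= cat_uniq uc ec eqxx /=.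
    apply/idP/idP => [/andP[/andP[/andP[hn uf] av] /eqP es]|/andP[/andP[uf av] /eqP es]].
      rewrite uf av /=; apply/eqP/setP => x; rewrite -es !inE mem_cat.
      case: (boolP (x \in flatten cs)) => xf; last by case: (x \in c).
      by rewrite orbT andbT; apply/esym; apply: contra hn => xc; apply/hasP; exists x.
    rewrite uf av !andbT; apply/andP; split.
      apply/hasPn => x xf; have : x \in [set x in flatten cs] by rewrite inE.
      by rewrite es !inE => /andP[].
    apply/eqP/setP => x; rewrite inE mem_cat.
    have -> : (x \in flatten cs) = (x \in S :\: [set x in c]) by rewrite -es inE.
    rewrite !inE; case: (boolP (x \in c)) => xc //=.
    by apply/esym; exact: (allP cS).
  rewrite mul0r; have -> : 0 = sumw (R := R) (n := n) rho (fun=> 0 * 0) by rewrite sumwZ mul0r.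
  apply: eq_sumw => cs _; rewrite mul0r; case: (boolP (_ && _)) => // /andP[/andP[]].
  rewrite /= cat_uniq => /and3P[uc _ _] /andP[ec _] /eqP es.
  case/negP: nP; rewrite /P uc ec /=; apply/allP => x xc.
  by rewrite inE -es inE mem_cat xc.
rewrite -mulr_suml -natr_sum -natrM; congr (_%:R); congr (_ * _)%N.
rewrite -[RHS]/(l.+1 * (1 + count_mem l.+1 rho))%N.
have := tS l.+1; rewrite /= eqxx => <-; rewrite -(card_cycles l st) -sum1_card [RHS]big_mkcond.
by apply: eq_bigr => c _; rewrite inE -/(P c); case: (P c).
Qed.

Lemma sumw_valid_off pi S rho :
  ~ (stable pi S /\ orbit_type pi S rho) \/ #|S| != sumn rho ->
  sumw rho (fun cs => (valid pi cs && ([set x in flatten cs] == S))%:R) = 0 :> R.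
Proof.
move=> h; have -> : 0 = sumw (R := R) (n := n) rho (fun=> 0 * 0) by rewrite sumwZ mul0r.
apply: eq_sumw => cs hcs; rewrite mul0r; case: (boolP (_ && _)) => // /andP[/andP[uc ac] /eqP es].
case: h => h; exfalso.
  by apply: h; rewrite -hcs -es; exact: valid_orbit_type.
by move/eqP: h; apply; rewrite -es cardsE (card_uniqP uc) size_flatten -hcs.
Qed.

End CycleLists.

Section CycleType.
Variable n : nat.
Implicit Types (pi : 'S_n) (S : {set 'I_n}) (rho : seq nat).

Lemma card_orbit_size_set pi S j : stable pi S ->
  #|orbit_size_set pi S j| = (j * count_mem j [seq #|C| | C : {set _} <- enum (porbit pi @: S)])%N.
Proof.
move=> st; rewrite count_map -sum1_count big_enum_cond /= -sum1_card.
rewrite (partition_big (porbit pi) (fun C => (C \in porbit pi @: S) && (#|C| == j))) /=; last first.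
  by move=> x; rewrite inE => /andP[xS ->]; rewrite imset_f.
rewrite mulnC big_distrl /=; apply: eq_bigr => _ /andP[/imsetP[y yS ->] /eqP cy].
rewrite mul1n -[RHS]cy -sum1_card; apply: eq_bigl => x.
rewrite inE -eq_porbit_mem; case: (eqVneq (porbit pi x) (porbit pi y)) => e; last by rewrite andbF.
rewrite e cy eqxx !andbT (stable_porbit st (x := y)) //.
by rewrite -eq_porbit_mem e.
Qed.

Lemma porbit_restr pi S x : stable pi S -> x \in S -> porbit (restr_perm S pi) x = porbit pi x.
Proof.
move=> st xS.
have np : pi \in 'N(S | 'P)%g.
  by apply/astabsP => y; rewrite /= apermE stable_mem.
have e i : ((restr_perm S pi) ^+ i)%g x = (pi ^+ i)%g x.
  elim: i => [|i IH]; first by rewrite !expg0 !perm1.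
  rewrite !expgSr !permM IH restr_permE // (stable_porbit st (x := x)) //.
  by apply/porbitP; exists i.
by apply/setP => y; apply/porbitP/porbitP => -[i ->]; exists i; rewrite e.
Qed.

(** Division by j > 0 recovers multiplicities from numbers of points, and sorted lists with equal
    multiplicities are equal. *)
Lemma cycle_type_onP pi S rho : is_partition rho -> stable pi S ->
  reflect (orbit_type pi S rho) (cycle_type_on S pi == rho).
Proof.
move=> /andP[srt rho0] st; rewrite /cycle_type_on.
rewrite (eq_in_imset (g := porbit pi)) => [|x xS]; last exact: porbit_restr.
set L := [seq _ | C : {set _} <- _].
have gtr : transitive geq by move=> a b c /= h1 h2; exact: leq_trans h2 h1.
have gto : ssrbool.total geq by move=> a b /=; exact: leq_total.
have gan : antisymmetric geq by move=> a b /= h; apply: anti_leq; rewrite andbC.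
have L0 : 0%N \notin L.
  apply/mapP => -[C]; rewrite mem_enum => /imsetP[x _ ->] /eqP; rewrite eq_sym cards_eq0.
  by move/eqP/setP/(_ x); rewrite porbit_id inE.
have -> : (sort geq L == rho) = perm_eq L rho.
  apply/eqP/idP => [<-|pe]; first by rewrite perm_sym perm_sort.
  apply: (sorted_eq gtr gan) => //; first exact: sort_sorted.
  by apply: perm_trans pe; rewrite perm_sort.
apply: (iffP idP) => [/seq.permP pe j|h]; first by rewrite (card_orbit_size_set _ st) -pe.
rewrite /perm_eq; apply/allP => j; rewrite mem_cat => jL.
have j0 : (0 < j)%N by rewrite lt0n; apply: contraTneq jL => ->; rewrite (negPf L0) (negPf rho0).
by apply/eqP/eqP; rewrite /= -(eqn_pmul2l j0) -h (card_orbit_size_set _ st).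
Qed.

End CycleType.

(** The valid lists are grouped by the set of their points; each admissible set has the same number
    of them. *)
Lemma sumw_valid (R : realType) n (pi : 'S_n) (rho : seq nat) : is_partition rho ->
  sumw rho (fun cs => (valid pi cs)%:R) =
  \sum_(S : {set 'I_n} | #|S| == sumn rho)
    ((pi, S) \in restricts_with_type n rho)%:R * (cycle_lists rho)%:R :> R.
Proof.
move=> rp; have rho0 : 0%N \notin rho by case/andP: rp.
transitivity (\sum_(S : {set 'I_n}) sumw rho (fun cs => (valid pi cs && ([set x in flatten cs] == S))%:R) : R).
  rewrite -sumw_sum; apply: eq_sumw => cs _.
  rewrite (bigD1 [set x in flatten cs]) //= eqxx andbT big1 ?addr0 // => S hS.
  by rewrite eq_sym (negPf hS) andbF.
rewrite [RHS]big_mkcond /=; apply: eq_bigr => S _; rewrite inE /=.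
case: ifP => cS; last by rewrite sumw_valid_off // cS; right.
case: (boolP (_ && _)) => [/andP[st ty]|nB].
  by rewrite mul1r sumw_valid_on //; apply/(cycle_type_onP rp st).
rewrite mul0r sumw_valid_off //; left => -[st ty]; case/negP: nB; rewrite -/(stable pi S) st /=.
by apply/(cycle_type_onP rp st).
Qed.

(** * The conditioned ratio as a mean over pairs of subsets *)

Section Conditioning.
Variable R : realType.
Implicit Types (n k r : nat) (rho : seq nat).

Lemma sum_tuple_cat (T : finType) i j (F : seq T -> R) :
  \sum_(t : (i + j).-tuple T) F t = \sum_(s : i.-tuple T) \sum_(t : j.-tuple T) F (s ++ t).
Proof.
elim: i F => [|i IH] F; first by rewrite (sum_tuple0 (fun s : seq T => \sum_(t : j.-tuple T) F (s ++ t)%SEQ)).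
rewrite addSn sum_tuple_cons (sum_tuple_cons _ (fun s : seq T => \sum_(t : j.-tuple T) F (s ++ t)%SEQ)).
by apply: eq_bigr => b _; rewrite (IH (fun s => F (b :: s))).
Qed.

Lemma sumw_flatten n rho (F : seq 'I_n -> R) :
  sumw rho (fun cs => F (flatten cs)) = \sum_(t : (sumn rho).-tuple 'I_n) F t.
Proof.
elim: rho F => [|j rho IH] F /=; first by rewrite (sum_tuple0 F).
by rewrite sum_tuple_cat; apply: eq_bigr => c _; rewrite (IH (fun s => F (c ++ s))).
Qed.

Lemma sumw_uniq n rho :
  sumw rho (fun cs : seq (seq 'I_n) => (uniq (flatten cs))%:R) = (n ^_ (sumn rho))%:R :> R.
Proof.
rewrite (sumw_flatten rho (fun s : seq 'I_n => (uniq s)%:R)) -natr_sum.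
have := card_uniq_tuples (T := 'I_n) (sumn rho) predT; rewrite cardT size_enum_ord => <-.
congr (_%:R); rewrite -sum1_card [RHS]big_mkcond; apply: eq_bigr => t _.
rewrite inE /= (_ : all _ _ = true) //=; last exact/allP.
Qed.

(** The expected number of valid lists for a uniform permutation extending the bijection: the
    quotient of factorials is the probability of the prescribed arcs that start outside I. *)
Definition ext_mean n k (I J : {set 'I_n}) rho : R :=
  sumw rho (fun cs => (uniq (flatten cs) &&
      all (step_ok I J) (flatten [seq zip c (rot 1 c) | c <- cs]))%:R *
    ((n - k - count (fun x => x \notin I) (flatten cs))`!%:R / (n - k)`!%:R)).

Lemma sum_extends_valid n k (I J : {set 'I_n}) rho : #|I| = k -> #|J| = k ->
  \sum_(pi : 'S_n) (extends I J pi)%:R * sumw rho (fun cs => (valid pi cs)%:R) =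
  (n - k)`!%:R * ext_mean k I J rho :> R.
Proof.
move=> cI cJ; under eq_bigr do rewrite -sumwZ.
rewrite -sumw_sum /ext_mean -sumwZ; apply: eq_sumw => cs _; rewrite /valid.
have fK (a : R) : (n - k)`!%:R * (a / (n - k)`!%:R) = a.
  by rewrite mulrCA divff ?mulr1 // pnatr_eq0 -lt0n fact_gt0.
rewrite [RHS]mulrCA fK.
case: (boolP (uniq _)) => u /=; last first.
  by rewrite mul0r big1 // => pi _; rewrite mulr0.
rewrite -natrM -(card_extends_maps cI cJ u) -sum1_card natr_sum [RHS]big_mkcond.
by apply: eq_bigr => pi _; rewrite inE -natrM mulnb; case: (_ && _).
Qed.

Lemma sum_extends_fact n k (I J : {set 'I_n}) : #|I| = k -> #|J| = k ->
  (\sum_(pi : 'S_n) extends I J pi)%N = (n - k)`!.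
Proof.
move=> cI cJ; have := card_extends_maps cI cJ (cs := [::]) isT.
rewrite /= mul1n subn0 => <-; rewrite -sum1_card [RHS]big_mkcond; apply: eq_bigr => pi _.
by rewrite inE andbT; case: extends.
Qed.

(** This is the case of empty I and J: with r = |rho|, there are n! / (n - r)! lists without
    repetition, each valid for (n - r)! permutations. *)
Lemma sum_valid n rho : (sumn rho <= n)%N ->
  \sum_(pi : 'S_n) sumw rho (fun cs => (valid pi cs)%:R) = n`!%:R :> R.
Proof.
move=> rn; have c0 : #|@finset.set0 'I_n| = 0%N by rewrite cards0.
have := sum_extends_valid rho c0 c0; rewrite subn0.
have e0 (pi : 'S_n) : extends finset.set0 finset.set0 pi.
  by apply/forall_inP => x; rewrite inE.
under eq_bigr do rewrite e0 mul1r; move=> ->.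
have nf : n`!%:R != 0 :> R by rewrite pnatr_eq0 -lt0n fact_gt0.
rewrite -[RHS]mulr1; congr (_ * _).
transitivity (((n - sumn rho)`!%:R / n`!%:R) * sumw rho (fun cs : seq (seq 'I_n) => (uniq (flatten cs))%:R) : R).
  rewrite -sumwZ; apply: eq_sumw => cs hcs; rewrite [RHS]mulrC !subn0.
  have -> : count (fun x : 'I_n => x \notin finset.set0) (flatten cs) = sumn rho.
    rewrite (eq_count (a2 := predT)) => [|x]; last by rewrite inE.
    by rewrite count_predT size_flatten -hcs.
  congr (_%:R * _); case: uniq => //=.
  by have -> : all (step_ok finset.set0 finset.set0) (flatten [seq zip c (rot 1 c) | c <- cs]) = true
    by apply/allP => p _; rewrite /step_ok !inE.
rewrite sumw_uniq -mulrA mulrCA -natrM mulnC ffact_fact //.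
by rewrite mulVf.
Qed.

Lemma sum_perm_subsets n r (F : 'S_n * {set 'I_n} -> R) :
  \sum_(x in perm_subsets n r) F x = \sum_(pi : 'S_n) \sum_(S : {set 'I_n} | #|S| == r) F (pi, S).
Proof.
by rewrite pair_big /=; apply: eq_big => [x|x _]; rewrite ?inE //; case: x.
Qed.

Lemma sum_restricts n rho (f : 'S_n -> R) : is_partition rho ->
  (\sum_(x in perm_subsets n (sumn rho)) f x.1 * (x \in restricts_with_type n rho)%:R) *
    (cycle_lists rho)%:R =
  \sum_(pi : 'S_n) f pi * sumw rho (fun cs => (valid pi cs)%:R).
Proof.
move=> rp; rewrite sum_perm_subsets mulr_suml; apply: eq_bigr => pi _.
by rewrite sumw_valid // -!mulr_suml mulrA mulr_sumr.
Qed.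

(** [cycle_lists] and the numbers of permutations and of sets R occur in both expectations and
    cancel. The factor (n - k)! from the extensions of each bijection cancels too, which leaves a
    mean over I and J. *)
Lemma cond_ratio n k rho : is_partition rho -> (sumn rho <= n)%N -> (k <= n)%N ->
  let Omega := perm_subsets n (sumn rho) in
  let N (x : 'S_n * {set 'I_n}) : R := (N_id k x.1)%:R in
  E_unif_cond Omega (restricts_with_type n rho) N / E_unif Omega N =
  (\sum_(I : {set 'I_n} | #|I| == k) \sum_(J : {set 'I_n} | #|J| == k) ext_mean k I J rho) /
    'C(n, k)%:R ^+ 2.
Proof.
move=> rp rn kn Omega N; have rho0 : 0%N \notin rho by case/andP: rp.
set B := restricts_with_type n rho.
have z0 : (cycle_lists rho)%:R != 0 :> R by rewrite pnatr_eq0 -lt0n cycle_lists_gt0.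
have f0 m : m`!%:R != 0 :> R by rewrite pnatr_eq0 -lt0n fact_gt0.
have c0 m : (m <= n)%N -> 'C(n, m)%:R != 0 :> R by rewrite pnatr_eq0 -lt0n bin_gt0.
have NE (pi : 'S_n) : (N_id k pi)%:R = \sum_(I : {set 'I_n} | #|I| == k)
   \sum_(J : {set 'I_n} | #|J| == k) (extends I J pi)%:R :> R.
  by rewrite N_idE natr_sum; apply: eq_bigr => I _; rewrite natr_sum.
have cB : #|Omega :&: B|%:R = n`!%:R / (cycle_lists rho)%:R :> R.
  rewrite -(sum_valid rn) -sum1_card natr_sum; apply: (canRL (mulfK z0)).
  under [RHS]eq_bigr do rewrite -[sumw _ _]mul1r.
  rewrite -(sum_restricts (fun=> 1)) //; congr (_ * _).
  rewrite big_mkcond [RHS]big_mkcond; apply: eq_bigr => x _ /=.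
  by rewrite inE mul1r; case: (x \in Omega) => //=; case: (x \in B).
have dr m : #|[set S : {set 'I_n} | #|S| == m]| = 'C(n, m) by rewrite card_draws card_ord.
have sc m (a : R) : \sum_(S : {set 'I_n} | #|S| == m) a = 'C(n, m)%:R * a.
  by rewrite sumr_const -(dr m) cardsE mulr_natl.
have cO : #|Omega|%:R = n`!%:R * 'C(n, sumn rho)%:R :> R.
  rewrite -sum1_card natr_sum (sum_perm_subsets _ (fun=> 1)).
  under eq_bigr do rewrite sc mulr1.
  by rewrite sumr_const mulr_natl -card_Sn.
have num : \sum_(x in Omega) N x * (x \in B)%:R =
   (n - k)`!%:R * (\sum_(I : {set 'I_n} | #|I| == k) \sum_(J : {set 'I_n} | #|J| == k) ext_mean k I J rho)
     / (cycle_lists rho)%:R.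
  apply: (canRL (mulfK z0)); rewrite /N (sum_restricts (fun pi => (N_id k pi)%:R)) //.
  under eq_bigr do rewrite NE mulr_suml.
  rewrite exchange_big mulr_sumr; apply: eq_bigr => I /eqP cI.
  under eq_bigr do rewrite mulr_suml.
  rewrite exchange_big mulr_sumr; apply: eq_bigr => J /eqP cJ.
  exact: sum_extends_valid.
have den : \sum_(x in Omega) N x = 'C(n, sumn rho)%:R * ((n - k)`!%:R * 'C(n, k)%:R ^+ 2).
  rewrite (sum_perm_subsets _ N) /N /=.
  under eq_bigr do rewrite sc NE.
  rewrite -mulr_sumr; congr (_ * _); rewrite exchange_big /=.
  transitivity (\sum_(I : {set 'I_n} | #|I| == k) \sum_(J : {set 'I_n} | #|J| == k) (n - k)`!%:R : R).
    apply: eq_bigr => I /eqP cI; rewrite exchange_big; apply: eq_bigr => J /eqP cJ.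
    by rewrite -(sum_extends_fact cI cJ) natr_sum.
  by under eq_bigr do rewrite sc; rewrite sc mulrA mulrC expr2.
rewrite /E_unif_cond /Prob_unif /E_unif -/B num den cB cO.
move: z0 (f0 n) (f0 (n - k)%N) (c0 _ kn) (c0 _ rn).
move: (cycle_lists rho)%:R n`!%:R (n - k)`!%:R 'C(n, k)%:R 'C(n, sumn rho)%:R => z a b c d z0 a0 b0 c0' d0.
by field; rewrite z0 a0 b0 c0' d0.
Qed.

End Conditioning.

(** * Expectations and the limit *)

Section ExtensionWeights.
Variable R : realType.

(** Convexity: the right side is the chord of (1 + y)^m over [0, 1]. *)
Lemma exprn_le_lin (y : R) m : 0 <= y <= 1 -> (1 + y) ^+ m <= 1 + (2 ^+ m - 1) * y.
Proof.
move=> /andP[y0 y1]; elim: m => [|m IH]; first by rewrite !expr0 subrr mul0r addr0.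
have p : 1 <= 2 ^+ m :> R by rewrite exprn_ege1 // ler1n.
rewrite exprS; apply: le_trans (ler_wpM2l _ IH) _; first lra.
rewrite [2 ^+ m.+1]exprS.
have : 0 <= (2 ^+ m - 1) * y * (1 - y) by rewrite !mulr_ge0 ?subr_ge0.
lra.
Qed.

(** The quotient is a product of d factors N / (N - i), each at most 1 + 2 r / N because i < r <= N
    / 2. *)
Lemma falling_weight (N d r : nat) : (d <= r)%N -> (2 * r <= N)%N -> (0 < N)%N ->
  1 <= (N%:R : R) ^+ d * (N - d)`!%:R / N`!%:R <= 1 + 2 ^+ r.+1 * r%:R / N%:R.
Proof.
move=> dr rN N0; have N0R : 0 < N%:R :> R by rewrite ltr0n.
pose y : R := (2 * r)%:R / N%:R.
have y0 : 0 <= y by rewrite divr_ge0.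
have y1 : y <= 1 by rewrite ler_pdivrMr // mul1r ler_nat.
have h : 1 <= (N%:R : R) ^+ d * (N - d)`!%:R / N`!%:R <= (1 + y) ^+ d.
  elim: d dr => [|d IH].
    by move=> _; rewrite !expr0 subn0 mul1r mulfV ?lexx // pnatr_eq0 -lt0n fact_gt0.
  move=> dr; have /andP[a b] := IH (ltnW dr).
  have dN : (0 < N - d)%N by lia.
  have dNR : 0 < (N - d)%:R :> R by rewrite ltr0n.
  have -> : N%:R ^+ d.+1 * (N - d.+1)`!%:R / N`!%:R =
    (N%:R / (N - d)%:R) * (N%:R ^+ d * (N - d)`!%:R / N`!%:R) :> R.
    have -> : (N - d)`! = ((N - d) * (N - d.+1)`!)%N by rewrite -[(N - d.+1)%N]/(N - (1 + d))%N addnC subnDA subn1; case: (N - d)%N dN => // m _; rewrite factS.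
    rewrite natrM exprS.
    have f0 m : m`!%:R != 0 :> R by rewrite pnatr_eq0 -lt0n fact_gt0.
    have f1 := lt0r_neq0 dNR; by field; rewrite ?f0 ?f1.
  have q1 : 1 <= N%:R / (N - d)%:R :> R by rewrite ler_pdivlMr // mul1r ler_nat leq_subr.
  have q2 : N%:R / (N - d)%:R <= 1 + y :> R.
    rewrite ler_pdivrMr // natrB; last by lia.
    have dr' : d%:R <= r%:R :> R by rewrite ler_nat ltnW.
    have yN : y * N%:R = 2 * r%:R by rewrite /y natrM divfK // lt0r_neq0.
    have yd : y * d%:R <= 1 * d%:R by apply: ler_wpM2r.
    have -> : (1 + y) * (N%:R - d%:R) = N%:R - d%:R + y * N%:R - y * d%:R by ring.
    rewrite yN; move: dr' yd; move: (y * _) => z; lra.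
  apply/andP; split; first by rewrite -[leLHS]mulr1; apply: ler_pM.
  by rewrite exprS; apply: ler_pM => //; apply: le_trans ler01 _.
have /andP[h1 h2] := h; rewrite h1 /=; apply: le_trans h2 _.
apply: (@le_trans _ _ ((1 + y) ^+ r)); first by rewrite ler_weXn2l // lerDl.
apply: le_trans (exprn_le_lin _ _) _; first by rewrite y0.
rewrite lerD2l exprS /y natrM.
have z0 : 0 <= r%:R / N%:R :> R by rewrite divr_ge0.
lra.
Qed.

Variables (n k : nat) (I J : {set 'I_n}).
Hypotheses (cI : #|I| = k) (cJ : #|J| = k) (kn : (k < n)%N).
Implicit Types (cs : seq (seq 'I_n)) (rho : seq nat).
Local Notation M := (step_mx R k I J).
Let N : R := n%:R - k%:R.

Lemma step_mxE x y :
  M x y = (step_ok I J (x, y))%:R * (if x \in I then 1 else N^-1).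
Proof.
rewrite /step_mx !mxE big_ord1 !mxE /step_ok /=.
case: ifP => xI; first by rewrite mul0r mulr0 addr0 mulr1.
have -> : rank_match I J x y = false by rewrite /rank_match xI.
by rewrite add0r mul1r mulrC.
Qed.

Lemma cycw_step_mx (c : seq 'I_n) :
  cycw M c = (all (step_ok I J) (zip c (rot 1 c)))%:R * N ^- count (fun x => x \notin I) c.
Proof.
transitivity (\prod_(p <- zip c (rot 1 c)) (step_ok I J p)%:R *
   \prod_(x <- c) (if x \in I then 1 else N^-1)).
  have -> : \prod_(x <- c) (if x \in I then 1 else N^-1) =
     \prod_(x <- unzip1 (zip c (rot 1 c))) (if x \in I then 1 else N^-1).
    by rewrite unzip1_zip // size_rot.
  rewrite big_map -big_split; apply: eq_bigr => -[x y] _; exact: step_mxE.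
congr (_ * _).
  by elim: (zip _ _) => [|p s IH]; rewrite ?big_nil // big_cons IH /= -natrM mulnb.
elim: (c) => [|x s IH]; rewrite ?big_nil ?expr0 ?invr1 // big_cons IH /=.
by case: (x \in I) => /=; rewrite ?mul1r // add1n exprS invfM.
Qed.

Lemma prod_cycw_step_mx cs : \prod_(c <- cs) cycw M c =
  (all (step_ok I J) (flatten [seq zip c (rot 1 c) | c <- cs]))%:R *
  N ^- count (fun x => x \notin I) (flatten cs).
Proof.
elim: cs => [|c cs IH]; first by rewrite big_nil expr0 invr1 mulr1.
rewrite big_cons IH cycw_step_mx /= all_cat count_cat exprD invfM -mulnb natrM.
by rewrite mulrACA.
Qed.

Lemma uniq_sum_ge0 rho : 0 <= uniq_sum R k I J rho.
Proof.
have -> : 0 = sumw (R := R) (n := n) rho (fun=> 0 * 0) by rewrite sumwZ mul0r.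
apply: sumw_le => cs _; rewrite mul0r mulr_ge0 //; apply: prodr_ge0 => c _.
by rewrite cycw_step_mx mulr_ge0 // invr_ge0 exprn_ge0 // ltW // (N_gt0 R kn).
Qed.

(** The images of points outside I are drawn without replacement in one sum and with replacement in
    the other; for boundedly many draws the weights agree up to 1 + O(1/N). *)
Lemma ext_mean_uniq_sum rho : (2 * sumn rho <= n - k)%N ->
  `|ext_mean R k I J rho - uniq_sum R k I J rho| <=
  2 ^+ (sumn rho).+1 * (sumn rho)%:R / N * uniq_sum R k I J rho.
Proof.
move=> rN; have N0 : 0 < N := N_gt0 R kn.
have NE : N = (n - k)%:R by rewrite natrB // ltnW.
have step cs : map size cs = rho ->
   let w := (uniq (flatten cs))%:R * \prod_(c <- cs) cycw M c in
   w <= (uniq (flatten cs) &&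
      all (step_ok I J) (flatten [seq zip c (rot 1 c) | c <- cs]))%:R *
    ((n - k - count (fun x => x \notin I) (flatten cs))`!%:R / (n - k)`!%:R)
   <= (1 + 2 ^+ (sumn rho).+1 * (sumn rho)%:R / N) * w.
  move=> hcs /=; rewrite prod_cycw_step_mx; set d := count _ _.
  have dr : (d <= sumn rho)%N by rewrite -hcs -size_flatten count_size.
  have nk0 : (0 < n - k)%N by rewrite subn_gt0.
  have /andP[h1 h2] := falling_weight dr rN nk0.
  rewrite -NE in h1 h2; set W := (X in 1 <= X) in h1; rewrite -/W in h2.
  have -> : (n - k - d)`!%:R / (n - k)`!%:R = W * N ^- d.
    have p : N ^+ d != 0 by rewrite expf_neq0 // lt0r_neq0.
    have q : (n - k)`!%:R != 0 :> R by rewrite pnatr_eq0 -lt0n fact_gt0.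
    by rewrite /W; move: p q; move: (N ^+ d) => a p q; field; rewrite p q.
  rewrite -mulnb natrM.
  case: (uniq _); last by rewrite !mul0r mulr0 lexx.
  case: (all _ _); last by rewrite !mul0r !mulr0 mul0r lexx.
  rewrite !mul1r; have p : 0 < N ^- d by rewrite invr_gt0 exprn_gt0.
  by rewrite -[X in X <= _ <= _]mul1r !ler_pM2r // h1.
have c0 : 0 <= 2 ^+ (sumn rho).+1 * (sumn rho)%:R / N by rewrite !mulr_ge0 ?exprn_ge0 ?invr_ge0 ?(ltW N0).
have l1 : uniq_sum R k I J rho <= ext_mean R k I J rho by apply: sumw_le => cs /step /andP[].
have l2 : ext_mean R k I J rho <= (1 + 2 ^+ (sumn rho).+1 * (sumn rho)%:R / N) * uniq_sum R k I J rho.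
  by rewrite /uniq_sum -sumwZ; apply: sumw_le => cs /step /andP[].
rewrite ger0_norm ?subr_ge0 // lerBlDr; move: l2; set a := _ * _ / _ => l2; lra.
Qed.

Definition ratio_const rho : R := overlap_const R rho + main_const R rho + 2 ^+ (sumn rho).+1 * (sumn rho)%:R * walk_const R rho.

Lemma ext_mean_dev K rho (m := count_mem 1%N rho) (g := fix1 R I J) :
  0%N \notin rho -> all (fun j => j <= K)%N rho -> (2 * sumn rho <= n - k)%N ->
  `|ext_mean R k I J rho - \prod_(j <- rho) main_factor R k I J j| <=
  ratio_const rho * (fixpred R I J m + g ^+ m.+1 / N + g ^+ m * dev_sum R k I J K).
Proof.
move=> rho0 rhoK rN; have N0 : 0 < N := N_gt0 R kn.
have h1 := ext_mean_uniq_sum rN; have h2 := uniq_sum_dev R cI cJ kn rho0 rhoK.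
have g1 : 1 <= g := fix1_ge1 R I J.
have e0 : 0 <= fixpred R I J m := fixpred_ge0 R I J _.
have D0 : 0 <= g ^+ m * dev_sum R k I J K by rewrite mulr_ge0 ?dev_sum_ge0 // exprn_ge0 // (le_trans ler01).
have u1 : uniq_sum R k I J rho <= walk_const R rho * g ^+ m.+1.
  apply: (@le_trans _ _ (walk_const R rho * g ^+ m)); last first.
    by rewrite ler_wpM2l ?walk_const_ge0 // ler_weXn2l.
  have /andP[_] := prod_cycle_sum R cI cJ kn rho; apply: le_trans.
  rewrite uniq_sumE // lerBlDr lerDl.
  have -> : 0 = sumw (R := R) (n := n) rho (fun=> 0 * 0) by rewrite sumwZ mul0r.
  by apply: sumw_le => cs _; rewrite mul0r mulr_ge0 ?kapw_ge0.
set U := uniq_sum R k I J rho in h1 h2 u1 *.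
have u0 : 0 <= U := uniq_sum_ge0 rho.
set B := fixpred R I J m + _ + _ in h2 *.
set b := 2 ^+ (sumn rho).+1 * (sumn rho)%:R in h1 *.
have b0 : 0 <= b by rewrite mulr_ge0 ?exprn_ge0.
have h3 : b / N * U <= b * walk_const R rho * B.
  apply: (@le_trans _ _ (b / N * (walk_const R rho * g ^+ m.+1))).
    by rewrite ler_wpM2l // divr_ge0 // ltW.
  have -> : b / N * (walk_const R rho * g ^+ m.+1) = b * walk_const R rho * (g ^+ m.+1 / N) by ring.
  by apply: ler_wpM2l; [rewrite mulr_ge0 ?walk_const_ge0|rewrite /B; lra].
have -> : ext_mean R k I J rho - \prod_(j <- rho) main_factor R k I J j =
  (ext_mean R k I J rho - U) + (U - \prod_(j <- rho) main_factor R k I J j) by ring.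
apply: le_trans (ler_normD _ _) _; rewrite /ratio_const mulrDl addrC; apply: lerD => //.
exact: le_trans h1 h3.
Qed.

End ExtensionWeights.

(** * Deviation of the chain frequencies *)

Section FrequencyDeviation.
Variable R : realType.
Variables (n k : nat) (I J : {set 'I_n}).
Hypotheses (cI : #|I| = k) (cJ : #|J| = k) (kn : (k < n)%N).
Let N : R := n%:R - k%:R.
Let t : R := k%:R / n%:R.

Definition chain_step l : R := chain_total R I J l.+1 - t * chain_total R I J l.

Lemma sqr_sum_le (F : nat -> R) p : (\sum_(i < p) `|F i|) ^+ 2 <= 2 ^+ p * \sum_(i < p) F i ^+ 2.
Proof.
elim: p => [|p IH]; first by rewrite !big_ord0 expr0n mulr0.
rewrite !big_ord_recr /=; set S := \sum_(i < p) `|F i| in IH *; set Q := \sum_(i < p) F i ^+ 2 in IH *.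
have h : (S + `|F p|) ^+ 2 <= 2 * S ^+ 2 + 2 * F p ^+ 2.
  rewrite -[F p ^+ 2]real_normK ?num_real //; move: `|F p| => a.
  have := sqr_ge0 (S - a); rewrite !expr2; lra.
apply: le_trans h _; rewrite [2 ^+ p.+1]exprS -mulrA -mulrDr ler_wpM2l // mulrDr lerD //.
by rewrite -[leLHS]mul1r ler_wpM2r ?sqr_ge0 // exprn_ege1 // ler1n.
Qed.

Lemma chain_total_dev l : `|chain_total R I J l - t ^+ l * n%:R| <= \sum_(i < l) `|chain_step i|.
Proof.
have /andP[t0 t1] := t_range R kn.
elim: l => [|l IH]; first by rewrite chain_total0 mul1r subrr normr0 big_ord0.
rewrite big_ord_recr /=.
have -> : chain_total R I J l.+1 - t ^+ l.+1 * n%:R =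
  t * (chain_total R I J l - t ^+ l * n%:R) + chain_step l by rewrite /chain_step exprS; ring.
apply: le_trans (ler_normD _ _) _; rewrite lerD2r normrM (ger0_norm t0).
by apply: le_trans IH; rewrite ler_piMl.
Qed.

(** A frequency is a second difference of chain totals over N, whose coefficients 1, 2, 1 add up to
    4. Totals up to l + 2 <= K + 1 occur, hence the K + 1 steps. *)
Lemma freq_dev_le K l : (l < K)%N ->
  `|freq_dev R k I J l| <= 4 / N * \sum_(i < K.+1) `|chain_step i|.
Proof.
move=> lK; have N0 : 0 < N := N_gt0 R kn.
have mono m : (m <= K.+1)%N -> `|chain_total R I J m - t ^+ m * n%:R| <= \sum_(i < K.+1) `|chain_step i|.
  move=> mK; apply: le_trans (chain_total_dev m) _.
  rewrite -(subnKC mK) big_split_ord /= lerDl; exact: sumr_ge0.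
have n0 : n%:R != 0 :> R by rewrite pnatr_eq0 -lt0n (leq_ltn_trans _ kn).
have -> : freq_dev R k I J l = ((chain_total R I J l - t ^+ l * n%:R) -
  2 * (chain_total R I J l.+1 - t ^+ l.+1 * n%:R) + (chain_total R I J l.+2 - t ^+ l.+2 * n%:R)) / N.
  rewrite /freq_dev (chain_freqE _ cI cJ) -/N -/t.
  have e : (1 - t) * t ^+ l = (t ^+ l * n%:R - 2 * (t ^+ l.+1 * n%:R) + t ^+ l.+2 * n%:R) / N.
    have NE : N = (1 - t) * n%:R by rewrite /N /t; field.
    rewrite !exprS NE; have t1 : 1 - t != 0.
      by move: (lt0r_neq0 N0); rewrite NE mulf_eq0 negb_or => /andP[].
    by field; rewrite t1 n0.
  by rewrite e; ring.
have := mono l; have := mono l.+1; have := mono l.+2.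
move=> /(_ lK) h2 /(_ (ltnW lK)) h1 /(_ (leqW (ltnW lK))) h0.
rewrite normrM normfV (gtr0_norm N0) [leRHS]mulrAC ler_pM2r ?invr_gt0 //.
apply: le_trans (ler_normD _ _) _; have := ler_normB (chain_total R I J l - t ^+ l * n%:R) (2 * (chain_total R I J l.+1 - t ^+ l.+1 * n%:R)).
rewrite normrM (ger0_norm (_ : 0 <= 2)) //; lra.
Qed.

Lemma dev_sum_sqr_le K : dev_sum R k I J K ^+ 2 <=
  16 * K%:R ^+ 2 * 2 ^+ K.+1 / N ^+ 2 * \sum_(i < K.+1) chain_step i ^+ 2.
Proof.
have N0 : 0 < N := N_gt0 R kn.
set S := \sum_(i < K.+1) `|chain_step i|.
have S0 : 0 <= S by apply: sumr_ge0.
have h : dev_sum R k I J K <= K%:R * (4 / N * S).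
  apply: (@le_trans _ _ (\sum_(l < K) 4 / N * S)); first by apply: ler_sum => l _; apply: freq_dev_le.
  by rewrite sumr_const card_ord [leRHS]mulr_natl.
have h2 := sqr_sum_le chain_step K.+1; rewrite -/S in h2.
apply: (@le_trans _ _ ((K%:R * (4 / N * S)) ^+ 2)).
  rewrite ler_pXn2r ?nnegrE ?dev_sum_ge0 //.
  by rewrite mulr_ge0 // mulr_ge0 // divr_ge0 // ltW.
have -> : (K%:R * (4 / N * S)) ^+ 2 = 16 * K%:R ^+ 2 / N ^+ 2 * S ^+ 2.
  by field; exact: lt0r_neq0.
rewrite [leRHS](_ : _ = 16 * K%:R ^+ 2 / N ^+ 2 * (2 ^+ K.+1 * \sum_(i < K.+1) chain_step i ^+ 2)); last by ring.
apply: ler_wpM2l => //; rewrite divr_ge0 ?sqr_ge0 // mulr_ge0 ?sqr_ge0 //.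
Qed.

End FrequencyDeviation.

(** * Means over pairs of subsets *)

Section PairMean.
Variable R : realType.

Definition pair_mean n k (F : {set 'I_n} -> {set 'I_n} -> R) : R :=
  (\sum_(I : {set 'I_n} | #|I| == k) \sum_(J : {set 'I_n} | #|J| == k) F I J) / 'C(n, k)%:R ^+ 2.

Variables n k : nat.
Implicit Types (F G : {set 'I_n} -> {set 'I_n} -> R) (I J : {set 'I_n}).
Local Notation mean := (pair_mean (n := n) k).

Lemma pair_mean_le F G : (forall I J, #|I| = k -> #|J| = k -> F I J <= G I J) -> mean F <= mean G.
Proof.
move=> h; rewrite /pair_mean ler_wpM2r ?invr_ge0 ?sqr_ge0 //.
by apply: ler_sum => I /eqP cI; apply: ler_sum => J /eqP cJ; apply: h.
Qed.

Lemma eq_pair_mean F G : (forall I J, #|I| = k -> #|J| = k -> F I J = G I J) -> mean F = mean G.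
Proof. by move=> h; apply/eqP; rewrite eq_le !pair_mean_le // => I J cI cJ; rewrite h. Qed.

Lemma pair_meanD F G : mean (fun I J => F I J + G I J) = mean F + mean G.
Proof. by rewrite /pair_mean; under eq_bigr do rewrite big_split; rewrite big_split mulrDl. Qed.

Lemma pair_meanZ a F : mean (fun I J => a * F I J) = a * mean F.
Proof. by rewrite /pair_mean; under eq_bigr do rewrite -mulr_sumr; rewrite -mulr_sumr mulrA. Qed.

Lemma pair_meanB F G : mean (fun I J => F I J - G I J) = mean F - mean G.
Proof. by rewrite -mulN1r -pair_meanZ -pair_meanD; apply: eq_pair_mean => I J _ _; rewrite mulN1r. Qed.

Lemma pair_mean_sum p (F : 'I_p -> {set 'I_n} -> {set 'I_n} -> R) :
  mean (fun I J => \sum_i F i I J) = \sum_i mean (F i).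
Proof.
rewrite /pair_mean; under eq_bigr do rewrite exchange_big /=.
by rewrite exchange_big mulr_suml.
Qed.

Lemma pair_mean_norm F G : (forall I J, #|I| = k -> #|J| = k -> `|F I J| <= G I J) -> `|mean F| <= mean G.
Proof.
move=> h; rewrite ler_norml -mulN1r -pair_meanZ; apply/andP; split; apply: pair_mean_le => I J cI cJ;
  have := h I J cI cJ; rewrite ler_norml => /andP[a b] //.
by rewrite mulN1r.
Qed.

Lemma pair_mean_ge0 F : (forall I J, #|I| = k -> #|J| = k -> 0 <= F I J) -> 0 <= mean F.
Proof.
move=> h; have -> : 0 = mean (fun=> fun=> 0 * 0) by rewrite pair_meanZ mul0r.
by apply: pair_mean_le => I J cI cJ; rewrite mul0r h.
Qed.

Lemma pair_mean_bin q :
  mean (fun I J => 'C(fixes (bits I) (bits J), q)%:R) = fixmean R q n k.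
Proof.
rewrite /pair_mean /fixmean fixbin0 natrX; congr (_ / _).
rewrite /fixbin -(sum_bits n k (fun v => wsum n k (fun w => 'C(fixes v w, q)%:R))).
by apply: eq_bigr => I _; rewrite -(sum_bits n k (fun w => 'C(fixes (bits I) w, q)%:R)).
Qed.

End PairMean.

Section PowersAndBinomials.
Variable R : realType.

(** The rule f C(f, q) = (q + 1) C(f, q + 1) + q C(f, q) expands powers in binomials, with leading
    coefficient m!. *)
Lemma pow_bin_dev m : exists2 C : R, 0 <= C & forall f : nat,
  `|f%:R ^+ m - m`!%:R * 'C(f, m)%:R| <= C * \sum_(q < m) 'C(f, q)%:R.
Proof.
elim: m => [|m [C C0 IH]].
  by exists 0 => // f; rewrite bin0 mulr1 subrr normr0 big_ord0 mulr0.
exists (2 * m%:R * C + m`!%:R * m%:R) => [|f]; first by rewrite addr_ge0 // !mulr_ge0.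
have step q : f%:R * 'C(f, q)%:R = q.+1%:R * 'C(f, q.+1)%:R + q%:R * 'C(f, q)%:R :> R.
  by rewrite mulrn_bin_left; ring.
have -> : f%:R ^+ m.+1 - (m.+1)`!%:R * 'C(f, m.+1)%:R =
   f%:R * (f%:R ^+ m - m`!%:R * 'C(f, m)%:R) + m`!%:R * m%:R * 'C(f, m)%:R :> R.
  rewrite mulrBr -exprS mulrCA step factS natrM; ring.
have {}IH := IH f.
rewrite big_ord_recr /=; set S' := \sum_(q < m) _ in IH *.
have S'0 : 0 <= S' by apply: sumr_ge0.
have b0 : 0 <= 'C(f, m)%:R :> R by [].
have fS : f%:R * S' <= 2 * m%:R * (S' + 'C(f, m)%:R).
  have -> : f%:R * S' = \sum_(q < m) (q.+1%:R * 'C(f, q.+1)%:R) + \sum_(q < m) (q%:R * 'C(f, q)%:R) :> R.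
    by rewrite mulr_sumr -big_split; apply: eq_bigr => q _; rewrite step.
  have h1 : \sum_(q < m) (q.+1%:R * 'C(f, q.+1)%:R) <= m%:R * (S' + 'C(f, m)%:R) :> R.
    apply: (@le_trans _ _ (\sum_(q < m) (m%:R * 'C(f, q.+1)%:R))).
      by apply: ler_sum => q _; rewrite ler_wpM2r // ler_nat.
    rewrite -mulr_sumr ler_wpM2l //.
    have -> : S' + 'C(f, m)%:R = \sum_(q < m.+1) 'C(f, q)%:R by rewrite big_ord_recr.
    by rewrite big_ord_recl lerDr.
  have h2 : \sum_(q < m) (q%:R * 'C(f, q)%:R) <= m%:R * S' :> R.
    by rewrite mulr_sumr; apply: ler_sum => q _; rewrite ler_wpM2r // ler_nat ltnW.
  have h3 : 0 <= m%:R * 'C(f, m)%:R :> R by rewrite mulr_ge0.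
  lra.
apply: le_trans (ler_normD _ _) _.
rewrite normrM (ger0_norm (ler0n _ f)) [X in _ + X]ger0_norm; last by rewrite !mulr_ge0.
rewrite mulrDl; apply: lerD.
  apply: (@le_trans _ _ (f%:R * (C * S'))); first by rewrite ler_wpM2l.
  by rewrite mulrCA [2 * _ * C]mulrC -mulrA ler_wpM2l.
by rewrite ler_wpM2l ?mulr_ge0 // lerDr.
Qed.

Lemma pow_bin_le m : exists2 C : R, 0 <= C & forall f : nat,
  (f%:R + 1) ^+ m <= C * \sum_(q < m.+1) 'C(f, q)%:R.
Proof.
have [C C0 h] := pow_bin_dev m.
exists (2 ^+ m * (1 + C + m`!%:R)) => [|f]; first by rewrite mulr_ge0 ?exprn_ge0 // !addr_ge0.
have S1 : 1 <= \sum_(q < m.+1) 'C(f, q)%:R :> R.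
  by rewrite big_ord_recl bin0 lerDl sumr_ge0.
have hf := h f; move: hf S1; rewrite big_ord_recr /=; set S := \sum_(q < m) _ => hf S1.
have S0 : 0 <= S by apply: sumr_ge0.
have b0 : 0 <= 'C(f, m)%:R :> R by [].
have hp : f%:R ^+ m <= (C + m`!%:R) * (S + 'C(f, m)%:R).
  move: hf; rewrite ler_norml => /andP[_]; rewrite lerBlDr => hf; apply: le_trans hf _.
  have : 0 <= C * 'C(f, m)%:R by rewrite mulr_ge0.
  have : 0 <= m`!%:R * S by rewrite mulr_ge0.
  lra.
have q0 : 0 <= 2 ^+ m :> R by rewrite exprn_ge0.
apply: (@le_trans _ _ (2 ^+ m * (1 + f%:R ^+ m))).
  case: f {h hf S1 hp S S0 b0} => [|f].
    rewrite add0r expr1n; apply: (@le_trans _ _ (1 * 1)); first by rewrite mulr1.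
    by apply: ler_pM => //; rewrite ?exprn_ege1 ?ler1n // lerDl exprn_ge0.
  apply: (@le_trans _ _ ((2 * f.+1%:R) ^+ m)).
    apply: lerXn2r; rewrite ?nnegrE ?mulr_ge0 ?addr_ge0 //.
    have : 1 <= f.+1%:R :> R by rewrite ler1n.
    lra.
  by rewrite exprMn ler_wpM2l // lerDr.
rewrite -mulrA ler_wpM2l //; lra.
Qed.

End PowersAndBinomials.

(** * Orders of magnitude in the bulk *)

Section Tame.
Variable R : realType.
Variable eps : R.
Hypothesis eps_gt0 : 0 < eps.
Implicit Types (n k p q m : nat) (F G : nat -> nat -> R).
Local Notation sq n := (Num.sqrt (n%:R : R)).

Definition bulk n k : bool := (eps * n%:R <= k%:R) && (k%:R <= (1 - eps) * n%:R).

(* F n k = O(n^((p-1)/2)) for k in the bulk. *)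
Definition tame p F := exists C : R, exists n0 : nat, 0 <= C /\
  forall n k, (n0 < n)%N -> bulk n k -> `|F n k| <= C * (sq n ^+ p / sq n).

Lemma bulk_lt n k : (0 < n)%N -> bulk n k -> (k < n)%N.
Proof.
move=> n0 /andP[_ h]; rewrite -(ltr_nat R); apply: le_lt_trans h _.
by rewrite gtr_pMl ?ltr0n // ltrBlDr ltrDl.
Qed.

Lemma bulk_gap n k : bulk n k -> eps * n%:R <= n%:R - k%:R.
Proof. by move=> /andP[_]; lra. Qed.

Lemma tame_le p F G : tame p G ->
  (exists n1, forall n k, (n1 < n)%N -> bulk n k -> `|F n k| <= `|G n k|) -> tame p F.
Proof.
move=> [C [n0 [C0 h]]] [n1 hFG]; exists C, (maxn n0 n1); split => // n k.
rewrite gtn_max => /andP[a b] bk; exact: le_trans (hFG n k b bk) (h n k a bk).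
Qed.

Lemma tameD p F G : tame p F -> tame p G -> tame p (fun n k => F n k + G n k).
Proof.
move=> [C [n0 [C0 h]]] [C' [n1 [C'0 h']]]; exists (C + C'), (maxn n0 n1).
split; first exact: addr_ge0.
move=> n k; rewrite gtn_max => /andP[a b] bk; rewrite mulrDl.
by apply: le_trans (ler_normD _ _) _; apply: lerD; [apply: h|apply: h'].
Qed.

Lemma tameM p (a : nat -> nat -> R) F (c : R) : (forall n k, (0 < n)%N -> bulk n k -> `|a n k| <= c) ->
  0 <= c -> tame p F -> tame p (fun n k => a n k * F n k).
Proof.
move=> ha c0 [C [n0 [C0 h]]]; exists (c * C), n0; split; first exact: mulr_ge0.
move=> n k nn bk; rewrite normrM -mulrA; apply: ler_pM => //; last exact: h.
by apply: ha => //; apply: leq_ltn_trans nn.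
Qed.

Lemma tameZ p (a : R) F : tame p F -> tame p (fun n k => a * F n k).
Proof. by move=> h; apply: (@tameM p (fun _ _ => a) F `|a|). Qed.

Lemma tame0 p : tame p (fun _ _ => 0).
Proof.
by exists 0, 0%N; split => // n k _ _; rewrite normr0 mul0r.
Qed.

Lemma tame_sum p m (F : nat -> nat -> nat -> R) : (forall i, (i < m)%N -> tame p (F i)) ->
  tame p (fun n k => \sum_(i < m) F i n k).
Proof.
elim: m => [|m IH] h.
  by apply: tame_le (tame0 p) _; exists 0%N => n k _ _; rewrite big_ord0.
apply: (@tame_le p _ (fun n k => \sum_(i < m) F i n k + F m n k)).
  by apply: tameD; [apply: IH => i im; apply: h; apply: leqW|apply: h].
by exists 0%N => n k _ _; rewrite big_ord_recr.
Qed.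

Lemma tame_widen p q F : (p <= q)%N -> tame p F -> tame q F.
Proof.
move=> pq [C [n0 [C0 h]]]; exists C, n0; split => // n k nn bk.
apply: le_trans (h n k nn bk) _; rewrite ler_wpM2l // ler_wpM2r ?invr_ge0 ?sqrtr_ge0 //.
by rewrite ler_weXn2l // sq_ge1 // (leq_ltn_trans _ nn).
Qed.

Lemma tame_fixmean q : tame q.+1 (fixmean R q).
Proof.
have [C [n0 h]] := fix_asymptotics q eps_gt0.
pose A : R := half_fact R q / q`!%:R * Num.sqrt eps^-1 ^+ q.
have A0 : 0 <= A by rewrite mulr_ge0 ?divr_ge0 ?half_fact_ge0 // exprn_ge0 ?sqrtr_ge0.
exists (A + `|C|), n0; split; first by rewrite addr_ge0.
move=> n k nn bk; have n0' : (0 < n)%N by apply: leq_ltn_trans nn.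
have /andP[b1 b2] := bk.
have s1 := sq_ge1 R n0'; have s0 : 0 < sq n by apply: lt_le_trans s1.
rewrite exprS mulrAC divff ?mul1r ?gt_eqF //.
have -> : fixmean R q n k = fixapprox R q n k + (fixmean R q n k - fixapprox R q n k) by ring.
apply: le_trans (ler_normD _ _) _; rewrite mulrDl; apply: lerD.
  rewrite /fixapprox ger0_norm; last first.
    by rewrite mulr_ge0 ?divr_ge0 ?half_fact_ge0 // exprn_ge0 ?sqrtr_ge0.
  rewrite /A -[leRHS]mulrA -exprMn -sqrtrM ?invr_ge0 ?(ltW eps_gt0) //.
  rewrite ler_wpM2l ?divr_ge0 ?half_fact_ge0 //.
  rewrite lerXn2r ?nnegrE ?sqrtr_ge0 // ler_wsqrtr //.
  by have /andP[] := fixscale_ge eps_gt0 n0' b1 b2.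
apply: le_trans (h n k nn b1 b2) _; apply: (@le_trans _ _ (`|C| * (sq n ^+ q / sq n))).
  by rewrite ler_wpM2r ?ler_norm // divr_ge0 ?exprn_ge0 ?sqrtr_ge0.
by rewrite ler_wpM2l // ler_pdivrMr // ler_peMr ?exprn_ge0 ?(ltW s0).
Qed.

Lemma tame_binsum p : tame p (fun n k =>
  pair_mean k (fun I J : {set 'I_n} => \sum_(q < p) 'C(fixes (bits I) (bits J), q)%:R : R)).
Proof.
apply: (@tame_le p _ (fun n k => \sum_(q < p) fixmean R q n k)).
  by apply: tame_sum => q qp; apply: tame_widen (tame_fixmean q).
exists 0%N => n k _ _; rewrite pair_mean_sum; under eq_bigr do rewrite pair_mean_bin //.
by [].
Qed.

Lemma tame_fix1 p : tame p.+1 (fun n k => pair_mean k (fun I J : {set 'I_n} => fix1 R I J ^+ p)).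
Proof.
have [C C0 h] := pow_bin_le R p.
apply: tame_le (tameZ C (tame_binsum p.+1)) _; exists 0%N => n k _ _.
rewrite -pair_meanZ ger0_norm; last first.
  by apply: pair_mean_ge0 => I J _ _; rewrite exprn_ge0 // (le_trans ler01) // fix1_ge1.
apply: le_trans (ler_norm _); apply: pair_mean_le => I J _ _.
by rewrite /fix1 fixcountE.
Qed.

Lemma tame_fixpred m : tame m (fun n k => pair_mean k (fun I J : {set 'I_n} => fixpred R I J m)).
Proof.
case: m => [|m]; last exact: tame_fix1.
apply: tame_le (tame0 0) _; exists 0%N => n k _ _.
by rewrite /pair_mean big1 ?mul0r // => I _; apply: big1.
Qed.

(** The moment of order m + 1 is O(n^((m+1)/2)), and n - k >= eps n. *)
Lemma tame_fix1_gap m : tame m (fun n k =>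
  pair_mean k (fun I J : {set 'I_n} => fix1 R I J ^+ m.+1 / (n%:R - k%:R))).
Proof.
have [C [n0 [C0 h]]] := tame_fix1 m.+1; exists (C / eps), n0.
split=> [|n k nn bk]; first by rewrite divr_ge0 // ltW.
have n0' : (0 < n)%N by apply: leq_ltn_trans nn.
have s0 : 0 < sq n by rewrite sqrtr_gt0 ltr0n.
have nR : 0 < n%:R :> R by rewrite ltr0n.
have N0 : 0 < n%:R - k%:R :> R by rewrite subr_gt0 ltr_nat; apply: bulk_lt bk.
have -> : pair_mean k (fun I J : {set 'I_n} => fix1 R I J ^+ m.+1 / (n%:R - k%:R)) =
   (n%:R - k%:R)^-1 * pair_mean k (fun I J : {set 'I_n} => fix1 R I J ^+ m.+1).
  by rewrite -pair_meanZ; apply: eq_pair_mean => I J _ _; rewrite mulrC.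
rewrite normrM normfV (gtr0_norm N0) mulrC ler_pdivrMr //.
apply: le_trans (h n k nn bk) _.
have -> : sq n ^+ m.+2 / sq n = sq n ^+ m / sq n * n%:R.
  have e (s a : R) : s != 0 -> s ^+ 2 = a -> s ^+ m.+2 / s = s ^+ m / s * a.
    by move=> s1 <-; rewrite !exprS expr0; field.
  by apply: e; rewrite ?gt_eqF // sqr_sqrtr // ltW.
have X0 : 0 <= sq n ^+ m / sq n by rewrite divr_ge0 ?exprn_ge0 ?(ltW s0).
move: (sq n ^+ m / sq n) X0 => X X0.
rewrite mulrA [leRHS](_ : _ = C * X * ((n%:R - k%:R) / eps)); last by ring.
rewrite ler_wpM2l ?mulr_ge0 // ler_pdivlMr // mulrC; exact: bulk_gap.
Qed.

(** The chain steps have mean square O(n), the squared number of fixed points included, and the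
    frequencies divide them by n - k >= eps n. *)
Lemma mean_dev_sum_sqr K : exists C : R, exists n0 : nat, 0 <= C /\
  forall n k, (n0 < n)%N -> bulk n k ->
  pair_mean k (fun I J : {set 'I_n} => dev_sum R k I J K ^+ 2) <= C / n%:R.
Proof.
have [C [n0 [C0 h]]] := tame_fix1 2.
pose A : R := 16 * K%:R ^+ 2 * 2 ^+ K.+1.
have A0 : 0 <= A by rewrite !mulr_ge0 ?exprn_ge0.
exists (A / eps ^+ 2 * (K.+1%:R * (108 + 3 * C))), n0; split.
  rewrite mulr_ge0 ?divr_ge0 ?exprn_ge0 ?(ltW eps_gt0) // mulr_ge0 // addr_ge0 ?mulr_ge0 //.
move=> n k nn bk; have n0' : (0 < n)%N by apply: leq_ltn_trans nn.
have kn := bulk_lt n0' bk; have nR : 0 < n%:R :> R by rewrite ltr0n.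
have s0 : 0 < sq n by rewrite sqrtr_gt0 ltr0n.
have en0 : 0 < eps * n%:R by rewrite mulr_gt0.
have N0 : 0 < n%:R - k%:R :> R by rewrite subr_gt0 ltr_nat.
have bin0' : 0 < 'C(n, k)%:R ^+ 2 :> R by rewrite exprn_gt0 // ltr0n bin_gt0 ltnW.
have f2 : pair_mean k (fun I J : {set 'I_n} => fixcount R I J ^+ 2) <= C * n%:R.
  apply: (@le_trans _ _ (pair_mean k (fun I J : {set 'I_n} => fix1 R I J ^+ 2))).
    apply: pair_mean_le => I J _ _; have f0 := fixcount_ge0 R I J.
    by rewrite lerXn2r ?nnegrE ?addr_ge0 // /fix1 lerDl.
  apply: le_trans (ler_norm _) _; apply: le_trans (h n k nn bk) _.
  by rewrite exprSr mulfK ?gt_eqF // sqr_sqrtr ?(ltW nR).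
have st l : pair_mean k (fun I J : {set 'I_n} => chain_step R k I J l ^+ 2) <= (108 + 3 * C) * n%:R.
  rewrite /pair_mean ler_pdivrMr //; move: f2; rewrite /pair_mean ler_pdivrMr // => f2.
  apply: le_trans (sum_chain_step_sqr l n0' f2) _; rewrite ler_wpM2r ?(ltW bin0') //; lra.
apply: (@le_trans _ _ (A / (n%:R - k%:R) ^+ 2 * \sum_(i < K.+1)
   pair_mean k (fun I J : {set 'I_n} => chain_step R k I J i ^+ 2))).
  rewrite -pair_mean_sum -pair_meanZ; apply: pair_mean_le => I J cI cJ.
  exact: dev_sum_sqr_le.
apply: (@le_trans _ _ (A / (eps * n%:R) ^+ 2 * (K.+1%:R * ((108 + 3 * C) * n%:R)))); last first.
  by rewrite le_eqVlt; apply/orP; left; apply/eqP; field; rewrite (gt_eqF nR) gt_eqF.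
apply: ler_pM.
- by rewrite divr_ge0 ?sqr_ge0.
- by apply: sumr_ge0 => i _; apply: pair_mean_ge0 => I J _ _; apply: sqr_ge0.
- rewrite ler_wpM2l // lef_pV2 ?posrE ?exprn_gt0 //.
  by rewrite lerXn2r ?nnegrE ?(ltW en0) ?(ltW N0) // bulk_gap.
apply: (@le_trans _ _ (\sum_(i < K.+1) (108 + 3 * C) * n%:R)); first by apply: ler_sum.
by rewrite sumr_const card_ord [leRHS]mulr_natl.
Qed.

(** The inequality 2 a b <= a^2 / w + w b^2 with w = n^((m+1)/2) balances the two terms: the mean of
    [fix1]^(2m) is O(n^m), the mean square deviation is O(1/n), and both bounds become
    O(n^((m-1)/2)). *)
Lemma tame_dev m K : tame m (fun n k =>
  pair_mean k (fun I J : {set 'I_n} => fix1 R I J ^+ m * dev_sum R k I J K)).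
Proof.
have [C [n0 [C0 h]]] := tame_fix1 (2 * m); have [D [n1 [D0 h']]] := mean_dev_sum_sqr K.
exists (2^-1 * (C + D)), (maxn n0 n1); split; first by rewrite mulr_ge0 ?addr_ge0.
move=> n k; rewrite gtn_max => /andP[nn nn'] bk.
have n0' : (0 < n)%N by apply: leq_ltn_trans nn.
have nR : 0 < n%:R :> R by rewrite ltr0n.
have s0 : 0 < sq n by rewrite sqrtr_gt0 ltr0n.
have ss : sq n ^+ 2 = n%:R by rewrite sqr_sqrtr ?(ltW nR).
have {}h := le_trans (ler_norm _) (h n k nn bk); have {}h' := h' n k nn' bk.
pose w := sq n ^+ m.+1; have w0 : 0 < w by rewrite exprn_gt0.
pose P := pair_mean k (fun I J : {set 'I_n} => fix1 R I J ^+ (2 * m)).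
pose Q := pair_mean k (fun I J : {set 'I_n} => dev_sum R k I J K ^+ 2).
apply: (@le_trans _ _ (2^-1 * (w^-1 * P + w * Q))).
  rewrite /P /Q -!pair_meanZ -pair_meanD -pair_meanZ; apply: pair_mean_norm => I J cI cJ.
  have g0 : 0 <= fix1 R I J ^+ m by rewrite exprn_ge0 // (le_trans ler01) // fix1_ge1.
  have d0 := dev_sum_ge0 R k I J K.
  rewrite ger0_norm ?mulr_ge0 // mulnC exprM.
  move: (fix1 R I J ^+ m) (dev_sum R k I J K) => a b in g0 d0 *.
  have : 0 <= w^-1 * (a - w * b) ^+ 2 by rewrite mulr_ge0 ?sqr_ge0 // invr_ge0 ltW.
  have -> : w^-1 * (a - w * b) ^+ 2 = w^-1 * a ^+ 2 + w * b ^+ 2 - 2 * (a * b).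
    by field; rewrite gt_eqF.
  lra.
rewrite -[leRHS]mulrA ler_wpM2l // mulrDl; apply: lerD.
  rewrite mulrC ler_pdivrMr //; apply: le_trans h _; rewrite -mulrA ler_wpM2l //.
  have e (s : R) : s != 0 -> s ^+ (2 * m).+1 / s = s ^+ m / s * s ^+ m.+1.
    by move=> s1; rewrite !exprS mulnC exprM expr2; field.
  by rewrite /w e // gt_eqF.
apply: (@le_trans _ _ (w * (D / n%:R))); first by rewrite ler_wpM2l ?(ltW w0).
have e (s a : R) : s != 0 -> s ^+ 2 = a -> s ^+ m.+1 * (D / a) = D * (s ^+ m / s).
  by move=> s1 <-; rewrite exprS; field.
by rewrite /w (e _ _ _ ss) // gt_eqF.
Qed.

End Tame.

(** * Asymptotics of the ratio *)

Section RatioAsymptotics.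
Variable R : realType.
Implicit Types (n k m q : nat) (rho : seq nat).
Local Notation sq n := (Num.sqrt (n%:R : R)).

Lemma all_leq_sumn rho : all (fun j => j <= sumn rho)%N rho.
Proof.
apply/allP => j; elim: rho => //= i s IH; rewrite inE => /orP[/eqP ->|/IH h].
  exact: leq_addr.
exact: leq_trans h (leq_addl _ _).
Qed.

Definition cycle_factor K rho n k : R :=
  \prod_(2 <= j < K.+1) (1 - (k%:R / n%:R) ^+ j) ^+ count_mem j rho.

Lemma cycle_factor_range K rho n k : (k <= n)%N -> 0 <= cycle_factor K rho n k <= 1.
Proof.
move=> kn; have /andP[t0 t1] := cprob_range R kn.
have h j : 0 <= 1 - (k%:R / n%:R : R) ^+ j <= 1.
  have : 0 <= (k%:R / n%:R : R) ^+ j <= 1 by rewrite exprn_ge0 // exprn_ile1.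
  lra.
rewrite /cycle_factor; elim/big_rec: _ => [|j x _ /andP[x0 x1]]; first by rewrite ler01 lexx.
have /andP[h0 h1] := h j.
by rewrite mulr_ge0 ?exprn_ge0 // -[leRHS]mul1r ler_pM ?exprn_ge0 ?exprn_ile1.
Qed.

Lemma prod_main_factor n k (I J : {set 'I_n}) K rho : 0%N \notin rho ->
  all (fun j => j <= K)%N rho ->
  \prod_(j <- rho) main_factor R k I J j =
  fixcount R I J ^+ count_mem 1%N rho * cycle_factor K rho n k.
Proof.
elim: rho => [|j rho IH] /=.
  by move=> _ _; rewrite big_nil mul1r /cycle_factor big1.
rewrite inE negb_or => /andP[j0 rho0] /andP[jK rhoK].
rewrite big_cons (IH rho0 rhoK) /cycle_factor /main_factor; case: (eqVneq j 1%N) => [->|j1] /=.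
  rewrite add1n exprS mulrA; congr (_ * _); apply: eq_big_nat => i /andP[i2 _].
  by rewrite (_ : (1 == i)%N = false) // ltn_eqF.
rewrite add0n mulrCA; congr (_ * _); under [RHS]eq_bigr do rewrite exprD.
rewrite big_split /=; congr (_ * _).
rewrite (bigD1_seq j) ?iota_uniq ?mem_index_iota //=; last first.
  by rewrite ltnS jK andbT; case: (j) j0 j1 => [|[]].
rewrite eqxx expr1 big1 ?mulr1 // => i ij; by rewrite eq_sym (negPf ij).
Qed.

Variable eps : R.
Hypothesis eps_gt0 : 0 < eps.

Lemma tame_ext_mean rho : 0%N \notin rho ->
  tame eps (count_mem 1%N rho) (fun n k =>
    pair_mean k (fun I J : {set 'I_n} => ext_mean R k I J rho) -
    pair_mean k (fun I J : {set 'I_n} => \prod_(j <- rho) main_factor R k I J j)).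
Proof.
move=> rho0; set m := count_mem 1%N rho; set K := sumn rho.
have rhoK := all_leq_sumn rho.
have h := tameZ (ratio_const R rho)
  (tameD (tameD (tame_fixpred eps_gt0 m) (tame_fix1_gap eps_gt0 m)) (tame_dev eps_gt0 m K)).
(* Beyond this bound n - k >= eps n exceeds twice the number of points of [rho], as the comparison
   of weights demands. *)
apply: tame_le h _; exists (Num.bound (2 * K%:R / eps)) => n k nn bk.
have n0 : (0 < n)%N by apply: leq_ltn_trans nn.
have kn := bulk_lt eps_gt0 n0 bk.
have rN : (2 * sumn rho <= n - k)%N.
  rewrite -(ler_nat R) natrB ?(ltnW kn) // natrM; apply: le_trans (bulk_gap bk).
  rewrite [eps * _]mulrC -ler_pdivrMr //; apply: (@le_trans _ _ (Num.bound (2 * K%:R / eps))%:R).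
    by apply/ltW/archi_boundP; rewrite divr_ge0 ?(ltW eps_gt0) // mulr_ge0.
  by rewrite ler_nat ltnW.
apply: le_trans (ler_norm _); rewrite -pair_meanB -!pair_meanD -pair_meanZ.
by apply: pair_mean_norm => I J cI cJ; apply: ext_mean_dev.
Qed.

Lemma tame_fix_power m : tame eps m (fun n k =>
  pair_mean k (fun I J : {set 'I_n} => fixcount R I J ^+ m) -
  half_fact R m * Num.sqrt (fixscale R n k) ^+ m).
Proof.
have [C C0 h] := pow_bin_dev R m.
have f0 : m`!%:R != 0 :> R by rewrite pnatr_eq0 -lt0n fact_gt0.
have h1 : tame eps m (fun n k => pair_mean k (fun I J : {set 'I_n} => fixcount R I J ^+ m) -
    m`!%:R * fixmean R m n k).
  apply: tame_le (tameZ C (tame_binsum eps_gt0 m)) _; exists 0%N => n k _ _.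
  rewrite -pair_mean_bin -!pair_meanZ -pair_meanB; apply: le_trans (ler_norm _).
  by apply: pair_mean_norm => I J _ _; rewrite fixcountE; exact: h.
have h2 : tame eps m (fun n k => m`!%:R * (fixmean R m n k - fixapprox R m n k)).
  apply: tameZ => //; have [D [n0 hD]] := fix_asymptotics m eps_gt0.
  exists `|D|, n0; split => // n k nn /andP[b1 b2]; apply: le_trans (hD n k nn b1 b2) _.
  by rewrite ler_wpM2r ?ler_norm // divr_ge0 ?exprn_ge0 ?sqrtr_ge0.
apply: tame_le (tameD h1 h2) _; exists 0%N => n k _ _.
rewrite le_eqVlt; apply/orP; left; apply/eqP; congr `|_|; rewrite /fixapprox.
by field.
Qed.

Lemma tame_ratio rho : 0%N \notin rho ->
  tame eps (count_mem 1%N rho) (fun n k =>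
    pair_mean k (fun I J : {set 'I_n} => ext_mean R k I J rho) -
    half_fact R (count_mem 1%N rho) * Num.sqrt (fixscale R n k) ^+ count_mem 1%N rho *
      cycle_factor (sumn rho) rho n k).
Proof.
move=> rho0; set m := count_mem 1%N rho; set K := sumn rho.
have rhoK := all_leq_sumn rho.
have h2 := tame_fix_power m.
have h3 : tame eps m (fun n k => cycle_factor K rho n k *
   (pair_mean k (fun I J : {set 'I_n} => fixcount R I J ^+ m) -
     half_fact R m * Num.sqrt (fixscale R n k) ^+ m)).
  apply: (tameM (c := 1)) h2 => // n k n0 bk.
  have /andP[a b] := cycle_factor_range K rho (ltnW (bulk_lt eps_gt0 n0 bk)).
  by rewrite ger0_norm.
apply: tame_le (tameD (tame_ext_mean rho0) h3) _; exists 0%N => n k _ _.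
rewrite le_eqVlt; apply/orP; left; apply/eqP; congr `|_|.
have -> : pair_mean k (fun I J : {set 'I_n} => \prod_(j <- rho) main_factor R k I J j) =
   cycle_factor K rho n k * pair_mean k (fun I J : {set 'I_n} => fixcount R I J ^+ m).
  by rewrite -pair_meanZ; apply: eq_pair_mean => I J _ _; rewrite (prod_main_factor _ _ _ rho0 rhoK) mulrC.
ring.
Qed.

Lemma powR_half (x : R) m : 0 <= x -> x `^ (m%:R / 2) = Num.sqrt x ^+ m.
Proof. by move=> x0; rewrite mulrC powRrM powR12_sqrt // powR_mulrn // sqrtr_ge0. Qed.

Lemma powR_half_pred n m : (0 < n)%N ->
  n%:R `^ ((m%:R - 1) / 2) = sq n ^+ m / sq n.
Proof.
move=> n0; rewrite mulrBl mul1r powRB ?powR_half //; last by rewrite pnatr_eq0 -lt0n n0 implybT.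
by rewrite powR12_sqrt.
Qed.

Lemma fixscaleE n k (t : R := k%:R / n%:R) : (k < n)%N ->
  n%:R * t ^+ 3 / (1 - t) = fixscale R n k.
Proof.
move=> kn; have n0 : n%:R != 0 :> R by rewrite pnatr_eq0 -lt0n (leq_ltn_trans _ kn).
have nk : n%:R - k%:R != 0 :> R by rewrite gt_eqF // subr_gt0 ltr_nat.
have t1 : 1 - t != 0.
  have -> : 1 - t = (n%:R - k%:R) / n%:R by rewrite /t; field.
  by rewrite mulf_neq0 ?invr_neq0.
rewrite /fixscale /t; field; rewrite n0 nk /=.
by [].
Qed.

End RatioAsymptotics.

Theorem theorem1p16 (R : realType) (rho : seq nat) (eps : R)
    (rho_part : is_partition rho) (eps_gt0 : 0 < eps) (eps_lt : eps < 2^-1) :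
  exists C : R, forall n k : nat,
    (maxn (sumn rho) 1 <= n)%N ->
    eps * n%:R <= k%:R -> k%:R <= (1 - eps) * n%:R ->
    let t : R := k%:R / n%:R in
    let m (j : nat) : nat := count_mem j rho in
    let Omega := perm_subsets n (sumn rho) in
    let N (x : 'S_n * {set 'I_n}) : R := (N_id k x.1)%:R in
    `| E_unif_cond Omega (restricts_with_type n rho) N / E_unif Omega N
       - real_fact ((m 1%N)%:R / 2)
         * (n%:R * t ^+ 3 / (1 - t)) `^ ((m 1%N)%:R / 2)
         * \prod_(2 <= j < (sumn rho).+1) (1 - t ^+ j) ^+ m j |
    <= C * n%:R `^ (((m 1%N)%:R - 1) / 2).
Proof.
have rho0 : 0%N \notin rho by case/andP: rho_part.
set m1 := count_mem 1%N rho; set r := sumn rho.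
pose err n k : R := pair_mean k (fun I J : {set 'I_n} => ext_mean R k I J rho) -
  half_fact R m1 * Num.sqrt (fixscale R n k) ^+ m1 * cycle_factor R r rho n k.
have [C [n0 [C0 h]]] := tame_ratio eps_gt0 rho0.
pose w n : R := n%:R `^ ((m1%:R - 1) / 2).
have w0 n : 0 <= w n := powR_ge0 _ _.
(* [C] serves the range n > [n0]; the finitely many other pairs (n, k) are covered by the sum of all
   their quotients of error by scale. *)
pose D : R := \sum_(n < n0.+1) \sum_(k < n.+1) `|err n k| / w n.
have D0 : 0 <= D by apply: sumr_ge0 => n _; apply: sumr_ge0 => k _; rewrite divr_ge0.
exists (C + D) => n k; rewrite geq_max => /andP[rn n1] kl ku; cbv beta zeta.
have bk : bulk eps n k by rewrite /bulk kl ku.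
have kn := bulk_lt eps_gt0 n1 bk.
rewrite (cond_ratio R rho_part rn (ltnW kn)) -/(pair_mean k _) (fixscaleE R kn).
rewrite powR_half; last first.
  by rewrite divr_ge0 ?exprn_ge0 // mulr_ge0 // subr_ge0 ler_nat ltnW.
rewrite -/(half_fact R _) -/m1 -/(cycle_factor R r rho n k) -/(err n k) -/(w n).
have [nn|nn] := leqP n n0; last first.
  rewrite mulrDl; apply: le_trans (_ : C * w n <= _); last by rewrite lerDl mulr_ge0.
  by rewrite /w powR_half_pred //; apply: h.
have wn : 0 < w n by rewrite powR_gt0 // ltr0n.
rewrite -ler_pdivrMr //; apply: le_trans (_ : D <= _); last by rewrite lerDr.
have nn' : (n < n0.+1)%N by [].
have kn' : (k < n.+1)%N by rewrite ltnW.
rewrite /D (bigD1 (Ordinal nn')) //= (bigD1 (Ordinal kn')) //= -addrA lerDl.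
by rewrite addr_ge0 // ?sumr_ge0 // => i _; rewrite ?sumr_ge0 // => *; rewrite divr_ge0.
Qed.
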